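(* Let $e>1$ be an integer, let $k\in[0,e-1]$, and let $\mathbf{k}$ be a field. Let $\overline{\mathcal C}=\bigoplus_{\mu\in\mathbb Z^{e+1}}\overline{\mathcal C}_\mu$ be an abelian $\mathrm{Hom}$-finite $\mathbf k$-linear category with the structure of a categorical representation of $\widetilde{\mathfrak{sl}}_{e+1}$ with respect to functors $\overline E_i,\overline F_i$, $i\in[0,e]$. Assume that $\overline{\mathcal C}_\mu=0$ whenever $\mu$ has a negative entry. For $\mu=(\mu_1,\dots,\mu_e)\in\mathbb Z^e$ put $\overline\mu=(\mu_1,\dots,\mu_k,0,\mu_{k+1},\dots,\mu_e)\in\mathbb Z^{e+1}$, $\mathcal C_\mu=\overline{\mathcal C}_{\overline\mu}$ and $\mathcal C=\bigoplus_{\mu\in\mathbb Z^e}\mathcal C_\mu\subset\overline{\mathcal C}$. Consider the endofunctors of $\mathcal C$ $$E_i=\begin{cases}\overline E_i|_{\mathcal C}&0\le i<k,\\ \overline E_k\overline E_{k+1}|_{\mathcal C}& i=k,\\ \overline E_{i+1}|_{\mathcal C}&k<i<e,\end{cases}\qquad F_i=\begin{cases}\overline F_i|_{\mathcal C}&0\le i<k,\\ \overline F_{k+1}\overline F_{k}|_{\mathcal C}& i=k,\\ \overline F_{i+1}|_{\mathcal C}&k<i<e.\end{cases}$$ Then $\mathcal C$ has the structure of a categorical representation of $\widetilde{\mathfrak{sl}}_e$ with respect to the functors $E_0,\dots,E_{e-1}$, $F_0,\dots,F_{e-1}$.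
   Context: **KLR algebra.** For $m>1$ let $\Gamma_m$ be the cyclic quiver with vertex set $I=\mathbb Z/m\mathbb Z$ (identified with $[0,m-1]$) and arrows $i\to i+1$. Let $h_{i,j}$ be the number of arrows from $i$ to $j$. Put $Q_{i,j}(u,v)=0$ if $i=j$ and $Q_{i,j}(u,v)=(v-u)^{h_{i,j}}(u-v)^{h_{j,i}}$ if $i\neq j$. For $\mathbf i=(i_1,\dots,i_d)\in I^d$ let $s_r(\mathbf i)$ be obtained by exchanging $i_r$ and $i_{r+1}$. The KLR algebra $R_d(\Gamma_m)$ is the $\mathbf k$-algebra generated by $e(\mathbf i)$ ($\mathbf i\in I^d$), $x_1,\dots,x_d$, $\tau_1,\dots,\tau_{d-1}$ with relations: $e(\mathbf i)e(\mathbf j)=\delta_{\mathbf i,\mathbf j}e(\mathbf i)$; $\sum_{\mathbf i}e(\mathbf i)=1$; $x_re(\mathbf i)=e(\mathbf i)x_r$; $\tau_re(\mathbf i)=e(s_r(\mathbf i))\tau_r$; $x_rx_s=x_sx_r$; $\tau_rx_{r+1}e(\mathbf i)=(x_r\tau_r+\delta_{i_r,i_{r+1}})e(\mathbf i)$; $x_{r+1}\tau_re(\mathbf i)=(\tau_rx_r+\delta_{i_r,i_{r+1}})e(\mathbf i)$; $\tau_rx_s=x_s\tau_r$ if $s\ne r,r+1$; $\tau_r\tau_s=\tau_s\tau_r$ if $|r-s|>1$; $\tau_r^2e(\mathbf i)=Q_{i_r,i_{r+1}}(x_r,x_{r+1})e(\mathbf i)$; and $(\tau_{r+1}\tau_r\tau_{r+1}-\tau_r\tau_{r+1}\tau_r)e(\mathbf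 i)$ equals $(x_{r+2}-x_r)^{-1}\big(Q_{i_r,i_{r+1}}(x_{r+2},x_{r+1})-Q_{i_r,i_{r+1}}(x_r,x_{r+1})\big)e(\mathbf i)$ if $i_r=i_{r+2}$ and $0$ otherwise. **Categorical representation.** Identify $\mathbb Z^m$ with the free abelian group on $\varepsilon_1,\dots,\varepsilon_m$, indices read modulo $m$ (so $\varepsilon_m=\varepsilon_0$), by $\mu=\sum_r\mu_r\varepsilon_r$, and let $\alpha_i=\varepsilon_i-\varepsilon_{i+1}$ for $i\in\mathbb Z/m\mathbb Z$. A categorical representation of $\widetilde{\mathfrak{sl}}_m$ in a $\mathrm{Hom}$-finite $\mathbf k$-linear abelian category $\mathcal D$, with respect to functors $E_i,F_i$ ($i\in[0,m-1]$), consists of: a decomposition $\mathcal D=\bigoplus_{\mu\in\mathbb Z^m}\mathcal D_\mu$; a pair $(E,F)$ of biadjoint exact endofunctors of $\mathcal D$; morphisms of functors $x\colon F\to F$, $\tau\colon F^2\to F^2$; decompositions $E=\bigoplus_{i}E_i$, $F=\bigoplus_iF_i$; such that (a) $E_i(\mathcal D_\mu)\subset\mathcal D_{\mu+\alpha_i}$ and $F_i(\mathcal D_\mu)\subset\mathcal D_{\mu-\alpha_i}$; (b) for each $d\in\mathbb N$ there is an algebra homomorphism $\psi_d\colon R_d(\Gamma_m)\to\mathrm{End}(F^d)^{\rm op}$ such that $\psi_d(e(\mathbf i))$ is the projector to $F_{i_d}\cdots F_{i_1}$, $\psi_d(x_r)=F^{d-r}xF^{r-1}$ and $\psi_d(\tau_r)=F^{d-r-1}\tau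 F^{r-1}$; (c) for each $M\in\mathcal D$ the endomorphism of $F(M)$ induced by $x$ is nilpotent. *)

(* Defs.v *)
From HB Require Import structures.
From mathcomp Require Import all_boot all_order all_algebra perm.
From mathcomp Require Import boolp.
From mathcomp Require Import monalg.

Set Implicit Arguments.
Unset Strict Implicit.
Unset Printing Implicit Defensive.

Import GRing.Theory.
Local Open Scope ring_scope.

(* Hom-finiteness is built in: a vectType is a finite-dimensional space. *)
Record linCat (k : fieldType) := LinCat {
  obj :> Type;
  hom : obj -> obj -> vectType k;
  idm : forall X, hom X X;
  comp : forall X Y Z, hom Y Z -> hom X Y -> hom X Z;
  compA : forall W X Y Z (h : hom Y Z) (g : hom X Y) (f : hom W X),
    comp h (comp g f) = comp (comp h g) f;
  comp1m : forall X Y (f : hom X Y), comp (idm Y) f = f;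
  compm1 : forall X Y (f : hom X Y), comp f (idm X) = f;
  comp_linear_l : forall X Y Z (f : hom X Y),
    linear (fun g : hom Y Z => comp g f);
  comp_linear_r : forall X Y Z (g : hom Y Z),
    linear (fun f : hom X Y => comp g f)
}.
Arguments hom {k l} X Y.
Arguments idm {k l} X.
Arguments comp {k l X Y Z} g f.
Notation "g \oc f" := (comp g f) (at level 40, left associativity).

Section Categories.
Variable k : fieldType.
Implicit Types C D B : linCat k.

Lemma compDl C (X Y Z : C) (g g' : hom Y Z) (f : hom X Y) :
  (g + g') \oc f = g \oc f + g' \oc f.
Proof. by have := comp_linear_l f 1 g g'; rewrite !scale1r. Qed.

Lemma compDr C (X Y Z : C) (g : hom Y Z) (f f' : hom X Y) :
  g \oc (f + f') = g \oc f + g \oc f'.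
Proof. by have := comp_linear_r g 1 f f'; rewrite !scale1r. Qed.

Lemma comp0m C (X Y Z : C) (f : hom X Y) : (0 : hom Y Z) \oc f = 0.
Proof. by apply: (addrI (0 \oc f)); rewrite -compDl !addr0. Qed.

Lemma compm0 C (X Y Z : C) (g : hom Y Z) : g \oc (0 : hom X Y) = 0.
Proof. by apply: (addrI (g \oc 0)); rewrite -compDr !addr0. Qed.

Lemma compZl C (X Y Z : C) a (g : hom Y Z) (f : hom X Y) :
  (a *: g) \oc f = a *: (g \oc f).
Proof. by have := comp_linear_l f a g 0; rewrite comp0m !addr0. Qed.

Lemma compZr C (X Y Z : C) a (g : hom Y Z) (f : hom X Y) :
  g \oc (a *: f) = a *: (g \oc f).
Proof. by have := comp_linear_r g a f 0; rewrite compm0 !addr0. Qed.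

Lemma compNl C (X Y Z : C) (g : hom Y Z) (f : hom X Y) :
  (- g) \oc f = - (g \oc f).
Proof. by rewrite -scaleN1r compZl scaleN1r. Qed.

Lemma comp_suml C (X Y Z : C) (I : finType) (g : I -> hom Y Z) (f : hom X Y) :
  (\sum_i g i) \oc f = \sum_i g i \oc f.
Proof.
by apply: (big_morph (fun g0 => g0 \oc f)) => [a b|]; rewrite ?compDl ?comp0m.
Qed.

Lemma comp_sumr C (X Y Z : C) (I : finType) (g : hom Y Z) (f : I -> hom X Y) :
  g \oc (\sum_i f i) = \sum_i g \oc f i.
Proof.
by apply: (big_morph (fun f0 => g \oc f0)) => [a b|]; rewrite ?compDr ?compm0.
Qed.

Definition is_zero C (X : C) : Prop :=
  forall Y, (forall f : hom X Y, f = 0) /\ (forall f : hom Y X, f = 0).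

Definition is_biproduct C (I : finType) (Xs : I -> C) (X : C)
    (inc : forall i, hom (Xs i) X) (pr : forall i, hom X (Xs i)) : Prop :=
  [/\ forall i, pr i \oc inc i = idm (Xs i),
      forall i j, i != j -> pr i \oc inc j = 0
    & \sum_i inc i \oc pr i = idm X].

Definition is_direct_sum C (I : finType) (Xs : I -> C) (X : C) : Prop :=
  exists inc pr, @is_biproduct C I Xs X inc pr.

Definition monic C (X Y : C) (f : hom X Y) : Prop :=
  forall W (g h : hom W X), f \oc g = f \oc h -> g = h.

Definition epic C (X Y : C) (f : hom X Y) : Prop :=
  forall Z (g h : hom Y Z), g \oc f = h \oc f -> g = h.

Definition is_kernel C (K X Y : C) (i : hom K X) (f : hom X Y) : Prop :=
  f \oc i = 0 /\
  forall W (g : hom W X), f \oc g = 0 -> exists! u : hom W K, i \oc u = g.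

Definition is_cokernel C (X Y Q : C) (p : hom Y Q) (f : hom X Y) : Prop :=
  p \oc f = 0 /\
  forall Z (g : hom Y Z), g \oc f = 0 -> exists! u : hom Q Z, u \oc p = g.

Record abelian C : Prop := Abelian {
  ab_sum : forall n (Xs : 'I_n -> C), exists X, is_direct_sum Xs X;
  ab_ker : forall (X Y : C) (f : hom X Y),
    exists (K : C) (i : hom K X), is_kernel i f;
  ab_coker : forall (X Y : C) (f : hom X Y),
    exists (Q : C) (p : hom Y Q), is_cokernel p f;
  ab_monic : forall (X Y : C) (f : hom X Y), monic f ->
    exists (Z : C) (g : hom Y Z), is_kernel f g;
  ab_epic : forall (X Y : C) (f : hom X Y), epic f ->
    exists (W : C) (g : hom W X), is_cokernel f g
}.

Definition short_exact C (X Y Z : C) (i : hom X Y) (p : hom Y Z) : Prop :=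
  is_kernel i p /\ is_cokernel p i.

(* C is the direct sum of the full subcategories C_w (w in W), which are
   additive and replete: ds_sum with n = 0 puts the zero objects in C_w, and
   with n = 1 makes C_w closed under isomorphism. *)
Record decomposition C (W : Type) (Cw : W -> C -> Prop) : Prop := Decomposition {
  ds_sum : forall w n (Xs : 'I_n -> C) X,
    (forall a, Cw w (Xs a)) -> is_direct_sum Xs X -> Cw w X;
  ds_orth : forall w w' (X Y : C), w <> w' -> Cw w X -> Cw w' Y ->
    forall f : hom X Y, f = 0;
  ds_span : forall X, exists n (w : 'I_n -> W) (Xs : 'I_n -> C),
    (forall a, Cw (w a) (Xs a)) /\ is_direct_sum Xs X
}.

Record functor C D := Functor {
  fobj :> C -> D;
  fmap : forall X Y : C, {linear hom X Y -> hom (fobj X) (fobj Y)};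
  fmap_id : forall X, fmap X X (idm X) = idm (fobj X);
  fmap_comp : forall X Y Z (g : hom Y Z) (f : hom X Y),
    fmap X Z (g \oc f) = fmap Y Z g \oc fmap X Y f
}.
Arguments fmap {C D} _ {X Y}.

Definition idF C : functor C C :=
  @Functor C C id (fun X Y => idfun) (fun X => erefl) (fun X Y Z g f => erefl).

Section CompFunctor.
Variables (C D B : linCat k) (G : functor D B) (F : functor C D).

Fact compF_id X : (fmap G \o fmap F) (idm X) = idm (G (F X)).
Proof. by rewrite /= !fmap_id. Qed.

Fact compF_comp X Y Z (g : hom Y Z) (f : hom X Y) :
  (fmap G \o fmap F) (g \oc f) =
  (fmap G \o fmap F) g \oc (fmap G \o fmap F) f.
Proof. by rewrite /= !fmap_comp. Qed.

Definition compF : functor C B :=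
  @Functor C B (fun X => G (F X)) (fun X Y => fmap G \o fmap F)
    compF_id compF_comp.
End CompFunctor.

Record nattrans C D (F G : functor C D) := NatTrans {
  ntc :> forall X, hom (F X) (G X);
  natural : forall X Y (f : hom X Y), ntc Y \oc fmap F f = fmap G f \oc ntc X
}.

Lemma nattransP C D (F G : functor C D) (s t : nattrans F G) :
  (forall X, s X = t X) -> s = t.
Proof.
case: s t => [s ns] [t nt] /= st; have E : s = t by apply: functional_extensionality_dep.
by subst t; congr NatTrans; apply: Prop_irrelevance.
Qed.

Section NatTransLmod.
Variables (C D : linCat k) (F G : functor C D).
Implicit Types s t : nattrans F G.

HB.instance Definition _ := gen_eqMixin (nattrans F G).
HB.instance Definition _ := gen_choiceMixin (nattrans F G).

Fact nt_zero_nat X Y (f : hom X Y) : 0 \oc fmap F f = fmap G f \oc 0.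
Proof. by rewrite comp0m compm0. Qed.
Definition nt_zero : nattrans F G := NatTrans nt_zero_nat.

Fact nt_add_nat s t X Y (f : hom X Y) :
  (s Y + t Y) \oc fmap F f = fmap G f \oc (s X + t X).
Proof. by rewrite compDl compDr !natural. Qed.
Definition nt_add s t : nattrans F G := NatTrans (nt_add_nat s t).

Fact nt_scale_nat a s X Y (f : hom X Y) :
  (a *: s Y) \oc fmap F f = fmap G f \oc (a *: s X).
Proof. by rewrite compZl compZr !natural. Qed.
Definition nt_scale a s : nattrans F G := NatTrans (nt_scale_nat a s).

Fact nt_addA : associative nt_add.
Proof. by move=> s t u; apply: nattransP => X /=; rewrite addrA. Qed.
Fact nt_addC : commutative nt_add.
Proof. by move=> s t; apply: nattransP => X /=; rewrite addrC. Qed.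
Fact nt_add0 : left_id nt_zero nt_add.
Proof. by move=> s; apply: nattransP => X /=; rewrite add0r. Qed.
Fact nt_addN : left_inverse nt_zero (nt_scale (-1)) nt_add.
Proof. by move=> s; apply: nattransP => X /=; rewrite scaleN1r addNr. Qed.

HB.instance Definition _ :=
  GRing.isZmodule.Build (nattrans F G) nt_addA nt_addC nt_add0 nt_addN.

Fact nt_scaleA a b s : nt_scale a (nt_scale b s) = nt_scale (a * b) s.
Proof. by apply: nattransP => X /=; rewrite scalerA. Qed.
Fact nt_scale1 : left_id 1 nt_scale.
Proof. by move=> s; apply: nattransP => X /=; rewrite scale1r. Qed.
Fact nt_scaleDr : right_distributive nt_scale +%R.
Proof. by move=> a s t; apply: nattransP => X /=; rewrite scalerDr. Qed.
Fact nt_scaleDl s : {morph nt_scale^~ s : a b / a + b}.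
Proof. by move=> a b; apply: nattransP => X /=; rewrite scalerDl. Qed.

HB.instance Definition _ := GRing.Zmodule_isLmodule.Build k (nattrans F G)
  nt_scaleA nt_scale1 nt_scaleDr nt_scaleDl.
End NatTransLmod.

Section NatTransOps.
Variables C D B : linCat k.

Fact nt_id_nat (F : functor C D) X Y (f : hom X Y) :
  idm (F Y) \oc fmap F f = fmap F f \oc idm (F X).
Proof. by rewrite comp1m compm1. Qed.
Definition nt_id (F : functor C D) : nattrans F F := NatTrans (@nt_id_nat F).

Fact nt_comp_nat (F G H : functor C D) (t : nattrans G H) (s : nattrans F G)
    X Y (f : hom X Y) :
  (t Y \oc s Y) \oc fmap F f = fmap H f \oc (t X \oc s X).
Proof. by rewrite -compA natural compA natural compA. Qed.
Definition nt_comp F G H (t : nattrans G H) (s : nattrans F G) : nattrans F H :=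
  NatTrans (nt_comp_nat t s).

Fact nt_hcomp_nat (G G' : functor D B) (F F' : functor C D)
    (t : nattrans G G') (s : nattrans F F') X Y (f : hom X Y) :
  (t (F' Y) \oc fmap G (s Y)) \oc fmap (compF G F) f =
  fmap (compF G' F') f \oc (t (F' X) \oc fmap G (s X)).
Proof.
rewrite /= -compA -fmap_comp (natural s) fmap_comp compA.
by rewrite (natural t (fmap F' f)) compA.
Qed.
Definition nt_hcomp G G' F F' (t : nattrans G G') (s : nattrans F F') :
    nattrans (compF G F) (compF G' F') :=
  @NatTrans C B (compF G F) (compF G' F') (fun X => t (F' X) \oc fmap G (s X))
    (nt_hcomp_nat t s).
End NatTransOps.

(* End(F), with product t * s = nt_comp t s. *)
Definition nat_end C D (F : functor C D) := nattrans F F.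

Section NatEndRing.
Variables (C D : linCat k) (F : functor C D).
Local Notation EF := (nat_end F).
Implicit Types s t u : EF.

HB.instance Definition _ := GRing.Lmodule.on EF.

Fact nt_compA : associative (fun t s : EF => nt_comp t s : EF).
Proof. by move=> s t u; apply: nattransP => X /=; rewrite compA. Qed.
Fact nt_comp1l : left_id (nt_id F : EF) (fun t s : EF => nt_comp t s : EF).
Proof. by move=> s; apply: nattransP => X /=; rewrite comp1m. Qed.
Fact nt_comp1r : right_id (nt_id F : EF) (fun t s : EF => nt_comp t s : EF).
Proof. by move=> s; apply: nattransP => X /=; rewrite compm1. Qed.
Fact nt_compDl :
  left_distributive (fun t s : EF => nt_comp t s : EF) +%R.
Proof. by move=> s t u; apply: nattransP => X /=; rewrite compDl. Qed.
Fact nt_compDr :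
  right_distributive (fun t s : EF => nt_comp t s : EF) +%R.
Proof. by move=> s t u; apply: nattransP => X /=; rewrite compDr. Qed.

HB.instance Definition _ := GRing.Zmodule_isPzRing.Build EF
  nt_compA nt_comp1l nt_comp1r nt_compDl nt_compDr.
End NatEndRing.

Definition adjoint C D (F : functor C D) (G : functor D C) : Prop :=
  exists (eta : nattrans (idF C) (compF G F)) (eps : nattrans (compF F G) (idF D)),
    (forall X, eps (F X) \oc fmap F (eta X) = idm (F X)) /\
    (forall Y, fmap G (eps Y) \oc eta (G Y) = idm (G Y)).

Definition exact_functor C D (F : functor C D) : Prop :=
  forall (X Y Z : C) (i : hom X Y) (p : hom Y Z),
    short_exact i p -> short_exact (fmap F i) (fmap F p).

Definition functor_sum C D (I : finType) (Fi : I -> functor C D) (F : functor C D)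
    (inc : forall i, nattrans (Fi i) F) (pr : forall i, nattrans F (Fi i)) : Prop :=
  forall X, is_biproduct (fun i => inc i X) (fun i => pr i X).

Lemma functor_direct_sum C D (F : functor C D) (I : finType) (Xs : I -> C) X :
  is_direct_sum Xs X -> is_direct_sum (fun i => F (Xs i)) (F X).
Proof.
move=> [inc [pr [h1 h2 h3]]].
exists (fun i => fmap F (inc i)), (fun i => fmap F (pr i)); split.
- by move=> i; rewrite -fmap_comp h1 fmap_id.
- by move=> i j ij; rewrite -fmap_comp h2 // linear0.
- by rewrite -fmap_id -h3 linear_sum; apply: eq_bigr => i _; rewrite fmap_comp.
Qed.

Definition full_sub C (P : C -> Prop) : linCat k :=
  @LinCat k {X : C | P X} (fun X Y => hom (sval X) (sval Y))
    (fun X => idm (sval X)) (fun X Y Z g f => g \oc f)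
    (fun W X Y Z => @compA k C _ _ _ _) (fun X Y => @comp1m k C _ _)
    (fun X Y => @compm1 k C _ _) (fun X Y Z => @comp_linear_l k C _ _ _)
    (fun X Y Z => @comp_linear_r k C _ _ _).

Definition restrict C (P : C -> Prop) (F : functor C C)
    (stable : forall X, P X -> P (F X)) : functor (full_sub P) (full_sub P) :=
  @Functor (full_sub P) (full_sub P)
    (fun X => exist P (F (sval X)) (stable (sval X) (svalP X)))
    (fun X Y => fmap F) (fun X => fmap_id F (sval X))
    (fun X Y Z => @fmap_comp C C F (sval X) (sval Y) (sval Z)).

Section Powers.
Variables (D : linCat k) (F : functor D D).

Fixpoint powF d : functor D D :=
  if d is d'.+1 then compF F (powF d') else idF D.

(* F^(d-r-1) x F^r : F^d -> F^d, for r < d (r counts from 0). *)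
Fixpoint pow_x (x : nat_end F) d r : nat_end (powF d) :=
  if d is d'.+1 then
    if r == d' then nt_hcomp x (nt_id (powF d'))
    else nt_hcomp (nt_id F) (pow_x x d' r)
  else nt_id _.

Definition tau_top (tau : nat_end (compF F F)) d : nat_end (powF d.+2) :=
  @NatTrans _ _ (powF d.+2) (powF d.+2) (fun X => tau (powF d X))
    (fun X Y f => natural tau (fmap (powF d) f)).

(* F^(d-r-2) tau F^r : F^d -> F^d, for r + 1 < d (r counts from 0). *)
Fixpoint pow_tau (tau : nat_end (compF F F)) d r : nat_end (powF d) :=
  if d is d'.+1 return nat_end (powF d) then
    (if d' is d''.+1 return nat_end (powF d') -> nat_end (powF d'.+1) then
       fun t => if r == d'' then tau_top tau d'' else nt_hcomp (nt_id F) t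
     else fun t => nt_hcomp (nt_id F) t) (pow_tau tau d' r)
  else nt_id _.

Variables (I : Type) (Fi : I -> functor D D).

(* F_{w_d} ... F_{w_1}; the letter w_d is w ord_max. *)
Fixpoint wordF d : ('I_d -> I) -> functor D D :=
  if d is d'.+1 then
    fun w => compF (Fi (w ord_max)) (wordF (fun a => w (widen_ord (leqnSn d') a)))
  else fun=> idF D.

Fixpoint word_inc (inc : forall i, nattrans (Fi i) F) d :
    forall w : 'I_d -> I, nattrans (wordF w) (powF d) :=
  if d is d'.+1 then
    fun w => nt_hcomp (inc (w ord_max)) (word_inc inc _)
  else fun w => nt_id (idF D).

Fixpoint word_pr (pr : forall i, nattrans F (Fi i)) d :
    forall w : 'I_d -> I, nattrans (powF d) (wordF w) :=
  if d is d'.+1 then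
    fun w => nt_hcomp (pr (w ord_max)) (word_pr pr _)
  else fun w => nt_id (idF D).

Definition word_proj inc pr d (w : 'I_d -> I) : nat_end (powF d) :=
  nt_comp (word_inc inc w) (word_pr pr w).
End Powers.
End Categories.

Arguments functor {k} C D.
Arguments fmap {k C D} _ {X Y}.

Section QuotientAlgebra.
Variables (k : fieldType) (A : lalgType k) (rel : A -> A -> Prop).

Inductive ideal_span : A -> Prop :=
| ideal_span0 : ideal_span 0
| ideal_spanD a u v b x :
    rel u v -> ideal_span x -> ideal_span (a * (u - v) * b + x).

Definition rel_ideal : {pred A} := fun x => `[< ideal_span x >].

Lemma rel_idealP x : reflect (ideal_span x) (x \in rel_ideal).
Proof. exact: asboolP. Qed.

Lemma ideal_span_add x y : ideal_span x -> ideal_span y -> ideal_span (x + y).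
Proof.
elim=> [|a u v b z uv _ IH] hy; first by rewrite add0r.
by rewrite -addrA; apply: ideal_spanD => //; apply: IH.
Qed.

Lemma ideal_span_mull c x : ideal_span x -> ideal_span (c * x).
Proof.
elim=> [|a u v b z uv _ IH]; first by rewrite mulr0; constructor.
by rewrite mulrDr !mulrA; constructor.
Qed.

Lemma ideal_span_mulr c x : ideal_span x -> ideal_span (x * c).
Proof.
elim=> [|a u v b z uv _ IH]; first by rewrite mul0r; constructor.
by rewrite mulrDl -!mulrA [a * _]mulrA; constructor.
Qed.

Fact rel_ideal_zmod : zmod_closed rel_ideal.
Proof.
split=> [|x y /rel_idealP hx /rel_idealP hy]; apply/rel_idealP; first by constructor.
by apply: ideal_span_add => //; rewrite -mulN1r; apply: ideal_span_mull.
Qed.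
HB.instance Definition _ := GRing.isZmodClosed.Build A rel_ideal rel_ideal_zmod.

Lemma ideal_span_scale c x : ideal_span x -> ideal_span (c *: x).
Proof. by move=> hx; rewrite -[x]mul1r scalerAl; apply: ideal_span_mull. Qed.

Definition quot_alg := {ideal_quot rel_ideal}.
HB.instance Definition _ := GRing.Zmodule.on quot_alg.

Definition quot_pi (x : A) : quot_alg := (\pi x)%qT.

Lemma quot_piP x y : quot_pi x = quot_pi y <-> ideal_span (x - y).
Proof.
split=> [/eqP|/rel_idealP]; first by rewrite -Quotient.idealrBE => /rel_idealP.
by rewrite Quotient.idealrBE => /eqP.
Qed.

Lemma quot_reprK (q : quot_alg) : quot_pi (repr q) = q.
Proof. exact: reprK. Qed.

Fact quot_pi_zmod : zmod_morphism quot_pi.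
Proof.
move=> x y; apply: etrans (Quotient.pi_add _ _ _) _.
by congr (Quotient.add _ _); apply: Quotient.pi_opp.
Qed.
HB.instance Definition _ :=
  GRing.isZmodMorphism.Build A quot_alg quot_pi quot_pi_zmod.

Definition quot_mul (p q : quot_alg) : quot_alg := quot_pi (repr p * repr q).
Definition quot_scale c (q : quot_alg) : quot_alg := quot_pi (c *: repr q).

Lemma quot_repr_pi x : ideal_span (repr (quot_pi x) - x).
Proof. by apply/quot_piP; rewrite quot_reprK. Qed.

Lemma quot_piM x y : quot_pi (x * y) = quot_mul (quot_pi x) (quot_pi y).
Proof.
apply/esym/quot_piP; set x' := repr _; set y' := repr _.
rewrite -[x' * y'](addrNK (x' * y)) -mulrBr -addrA -mulrBl.
apply: ideal_span_add; first by apply: ideal_span_mull; apply: quot_repr_pi.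
by apply: ideal_span_mulr; apply: quot_repr_pi.
Qed.

Lemma quot_piZ c x : quot_pi (c *: x) = quot_scale c (quot_pi x).
Proof.
apply/esym/quot_piP; rewrite -scalerBr; apply: ideal_span_scale.
exact: quot_repr_pi.
Qed.

Lemma quot_ind (P : quot_alg -> Prop) :
  (forall x, P (quot_pi x)) -> forall q, P q.
Proof. by move=> h q; rewrite -[q]quot_reprK. Qed.

Fact quot_mulA : associative quot_mul.
Proof.
by do 3!elim/quot_ind=> ?; rewrite -!quot_piM mulrA.
Qed.
Fact quot_mul1l : left_id (quot_pi 1) quot_mul.
Proof. by elim/quot_ind=> x; rewrite -quot_piM mul1r. Qed.
Fact quot_mul1r : right_id (quot_pi 1) quot_mul.
Proof. by elim/quot_ind=> x; rewrite -quot_piM mulr1. Qed.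
Fact quot_mulDl : left_distributive quot_mul +%R.
Proof.
by do 3!elim/quot_ind=> ?; rewrite -raddfD -!quot_piM mulrDl raddfD.
Qed.
Fact quot_mulDr : right_distributive quot_mul +%R.
Proof.
by do 3!elim/quot_ind=> ?; rewrite -raddfD -!quot_piM mulrDr raddfD.
Qed.
HB.instance Definition _ := GRing.Zmodule_isPzRing.Build quot_alg
  quot_mulA quot_mul1l quot_mul1r quot_mulDl quot_mulDr.

Fact quot_scaleA a b q : quot_scale a (quot_scale b q) = quot_scale (a * b) q.
Proof. by elim/quot_ind: q => x; rewrite -!quot_piZ scalerA. Qed.
Fact quot_scale1 : left_id 1 quot_scale.
Proof. by elim/quot_ind=> x; rewrite -quot_piZ scale1r. Qed.
Fact quot_scaleDr : right_distributive quot_scale +%R.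
Proof.
by move=> a; do 2!elim/quot_ind=> ?; rewrite -raddfD -!quot_piZ scalerDr raddfD.
Qed.
Fact quot_scaleDl q : {morph quot_scale^~ q : a b / a + b}.
Proof.
by elim/quot_ind: q => x a b; rewrite -!quot_piZ scalerDl raddfD.
Qed.
HB.instance Definition _ := GRing.Zmodule_isLmodule.Build k quot_alg
  quot_scaleA quot_scale1 quot_scaleDr quot_scaleDl.
End QuotientAlgebra.

(* The vertex set Z/m is 'I_m, and the successor of i is ordS i. *)
Definition nb_arrows m (i j : 'I_m) : nat := (j == ordS i).

Section Q.
Variables (A : pzRingType) (m : nat).
Implicit Types (i j : 'I_m) (u v w : A).

Definition Qpoly i j u v : A :=
  if i == j then 0
  else (v - u) ^+ nb_arrows i j * (u - v) ^+ nb_arrows j i.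

(* The polynomial (w - u)^-1 (Q_ij(w, v) - Q_ij(u, v)), computed from
   Q_ij(u, v) = (-1)^h_ij (u - v)^(h_ij + h_ji) and the geometric sum for
   w - u = (w - v) - (u - v); Qdiff is characterized by QdiffP. *)
Definition Qdiff i j u v w : A :=
  let n := (nb_arrows i j + nb_arrows j i)%N in
  if i == j then 0
  else (-1) ^+ nb_arrows i j *
       \sum_(s < n) (w - v) ^+ (n.-1 - s) * (u - v) ^+ s.

Lemma QdiffP i j u v w :
  u * v = v * u -> v * w = w * v -> u * w = w * u ->
  (w - u) * Qdiff i j u v w = Qpoly i j w v - Qpoly i j u v.
Proof.
move=> uv vw uw; rewrite /Qdiff /Qpoly; case: eqP => _; first by rewrite mulr0 subrr.
set a := nb_arrows i j; set b := nb_arrows j i.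
have Qe x : (v - x) ^+ a * (x - v) ^+ b = (-1) ^+ a * (x - v) ^+ (a + b).
  rewrite exprD mulrA -[v - x]opprB; congr (_ * _); exact: exprNn.
rewrite !Qe -mulrBr subrXX_comm; last first.
  by apply: commrB; apply/commr_sym/commrB.
by rewrite opprB addrA subrK !mulrA; congr (_ * _); apply: commr_sign.
Qed.
End Q.

Section KLR.
Variables (k : fieldType) (m d : nat).

Definition multi_index := {ffun 'I_d -> 'I_m}.

(* Generators e(i), x_a and tau_r. The strand a is an element of 'I_d, counted
   from 0, and tau_r crosses the strands r and r + 1. *)
Definition klr_gen : Type := (multi_index + 'I_d + 'I_d.-1)%type.

Lemma strand_hi_subproof (r : 'I_d.-1) : (r.+1 < d)%N.
Proof. by case: r => r /=; case: d. Qed.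
Definition strand_lo (r : 'I_d.-1) : 'I_d := widen_ord (leq_pred d) r.
Definition strand_hi (r : 'I_d.-1) : 'I_d := Ordinal (strand_hi_subproof r).

Definition swap (r : 'I_d.-1) (i : multi_index) : multi_index :=
  [ffun a => i (tperm (strand_lo r) (strand_hi r) a)].

Local Notation free := {malg k[{fmonom klr_gen}]}.
Definition free_gen (g : klr_gen) : free := mkmalgU (fmu g) 1.
Local Notation e i := (free_gen (inl (inl i))).
Local Notation x a := (free_gen (inl (inr a))).
Local Notation tau r := (free_gen (inr r)).
Local Notation lo := strand_lo.
Local Notation hi := strand_hi.

Inductive klr_rel : free -> free -> Prop :=
| klr_ee (i j : multi_index) : klr_rel (e i * e j) (if i == j then e i else 0)
| klr_e1 : klr_rel (\sum_(i : multi_index) e i) 1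
| klr_xe (a : 'I_d) (i : multi_index) : klr_rel (x a * e i) (e i * x a)
| klr_te (r : 'I_d.-1) (i : multi_index) :
    klr_rel (tau r * e i) (e (swap r i) * tau r)
| klr_xx (a b : 'I_d) : klr_rel (x a * x b) (x b * x a)
| klr_tx (r : 'I_d.-1) (i : multi_index) :
    klr_rel (tau r * x (hi r) * e i)
            ((x (lo r) * tau r + (i (lo r) == i (hi r))%:R) * e i)
| klr_xt (r : 'I_d.-1) (i : multi_index) :
    klr_rel (x (hi r) * tau r * e i)
            ((tau r * x (lo r) + (i (lo r) == i (hi r))%:R) * e i)
| klr_txC (r : 'I_d.-1) (a : 'I_d) : a != lo r -> a != hi r ->
    klr_rel (tau r * x a) (x a * tau r)
| klr_ttC (r s : 'I_d.-1) : (r.+1 < s)%N || (s.+1 < r)%N ->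
    klr_rel (tau r * tau s) (tau s * tau r)
| klr_tt (r : 'I_d.-1) (i : multi_index) :
    klr_rel (tau r * tau r * e i)
            (Qpoly (i (lo r)) (i (hi r)) (x (lo r)) (x (hi r)) * e i)
| klr_braid (r s : 'I_d.-1) (i : multi_index) : s = r.+1 :> nat ->
    klr_rel ((tau s * tau r * tau s - tau r * tau s * tau r) * e i)
            (if i (lo r) == i (hi s) then
               Qdiff (i (lo r)) (i (hi r)) (x (lo r)) (x (hi r)) (x (hi s)) * e i
             else 0).

Definition klr := quot_alg klr_rel.
HB.instance Definition _ := GRing.Lmodule.on klr.
HB.instance Definition _ := GRing.PzRing.on klr.

Definition klr_e (i : multi_index) : klr := quot_pi klr_rel (e i).
Definition klr_x (a : 'I_d) : klr := quot_pi klr_rel (x a).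
Definition klr_tau (r : 'I_d.-1) : klr := quot_pi klr_rel (tau r).
End KLR.

(* The weight (mu_1, ..., mu_m) is a row vector, with mu_p in column p - 1. Hence
   epsilon_r, for r in Z/m, has its 1 in column r - 1 mod m. *)
Definition weight m := 'rV[int]_m.
Definition epsilon m (r : 'I_m) : weight m := delta_mx 0 (ord_pred r).
Definition alpha m (i : 'I_m) : weight m := epsilon i - epsilon (ordS i).

Record cat_rep (k : fieldType) m (D : linCat k) (Dw : weight m -> D -> Prop)
    (Ei Fi : 'I_m -> functor D D) := CatRep {
  rep_abelian : abelian D;
  rep_dec : decomposition Dw;
  rep_E : functor D D;
  rep_F : functor D D;
  rep_adjEF : adjoint rep_E rep_F;
  rep_adjFE : adjoint rep_F rep_E;
  rep_exactE : exact_functor rep_E;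
  rep_exactF : exact_functor rep_F;
  rep_x : nat_end rep_F;
  rep_tau : nat_end (compF rep_F rep_F);
  rep_incE : forall i, nattrans (Ei i) rep_E;
  rep_prE : forall i, nattrans rep_E (Ei i);
  rep_sumE : functor_sum rep_incE rep_prE;
  rep_incF : forall i, nattrans (Fi i) rep_F;
  rep_prF : forall i, nattrans rep_F (Fi i);
  rep_sumF : functor_sum rep_incF rep_prF;
  rep_weightE : forall i mu X, Dw mu X -> Dw (mu + alpha i) (Ei i X);
  rep_weightF : forall i mu X, Dw mu X -> Dw (mu - alpha i) (Fi i X);
  (* The algebra homomorphism psi takes its values in End(F^d)^op. *)
  rep_klr : forall d, exists psi : klr k m d -> nat_end (powF rep_F d),
    [/\ linear psi, psi 1 = 1 & forall a b, psi (a * b) = psi b * psi a] /\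
    [/\ forall i : multi_index m d,
          psi (klr_e k i) = word_proj rep_incF rep_prF i,
        forall a : 'I_d, psi (klr_x k m a) = pow_x rep_x d a
      & forall r : 'I_d.-1, psi (klr_tau k m r) = pow_tau rep_tau d r];
  rep_nilp : forall M : D, exists n,
    iter n (comp (rep_x M)) (idm (rep_F M)) = 0
}.

Section Thin.
Variables (e : nat) (l : 'I_e).

Definition low (i : 'I_e) : 'I_e.+1 := widen_ord (leqnSn e) i.
Definition up (i : 'I_e) : 'I_e.+1 := lift ord0 i.

(* (mu_1, ..., mu_l, 0, mu_{l+1}, ..., mu_e) *)
Definition insert0 (mu : weight e) : weight e.+1 :=
  \row_j (if unlift (low l) j is Some j' then mu 0 j' else 0).

Lemma insert0D mu nu : insert0 (mu + nu) = insert0 mu + insert0 nu.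
Proof.
by apply/rowP=> j; rewrite !mxE; case: unlift => [j'|]; rewrite ?mxE ?addr0.
Qed.

Lemma insert0N mu : insert0 (- mu) = - insert0 mu.
Proof.
by apply/rowP=> j; rewrite !mxE; case: unlift => [j'|]; rewrite ?mxE ?oppr0.
Qed.

Lemma insert0_delta p : insert0 (delta_mx 0 p) = delta_mx 0 (lift (low l) p).
Proof.
apply/rowP=> j; rewrite !mxE; case: unliftP => [j' ->|->]; rewrite ?mxE /=.
  by rewrite (inj_eq lift_inj).
by rewrite (negPf (neq_lift _ _)).
Qed.

Lemma val_ord_pred n (i : 'I_n) :
  ord_pred i = (if i == 0 :> nat then n.-1 else i.-1) :> nat.
Proof.
case: n i => [[]//|n] [[|i] hi] /=; first by rewrite modn_small.
by rewrite modnDr modn_small // ltnW.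
Qed.

Lemma alphaE n (i : 'I_n) : alpha i = delta_mx 0 (ord_pred i) - delta_mx 0 i.
Proof. by rewrite /alpha /epsilon ordSK. Qed.

Lemma insert0_alpha (i : 'I_e) : insert0 (alpha i) =
  if (i < l)%N then alpha (low i)
  else if i == l then alpha (low l) + alpha (up l)
  else alpha (up i).
Proof.
have lo_pred : (i <= l)%N -> lift (low l) (ord_pred i) = ord_pred (low i).
  move=> il; apply: val_inj.
  change (bump l (ord_pred i) = ord_pred (low i) :> nat).
  rewrite !val_ord_pred /= /bump; have e0 := leq_ltn_trans (leq0n _) (ltn_ord l).
  case: eqP => [i0|/eqP i0]; first by rewrite -ltnS prednK // ltn_ord add1n prednK.
  by rewrite leqNgt prednK ?lt0n // il.
have lo_i : (i < l)%N -> lift (low l) i = low i.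
  by move=> il; apply: val_inj; rewrite /= /bump leqNgt il.
have hi_i : (l <= i)%N -> lift (low l) i = up i.
  by move=> il; apply: val_inj; rewrite /= /bump il.
have hi_pred : (l < i)%N -> lift (low l) (ord_pred i) = ord_pred (up i).
  move=> il; apply: val_inj; have i0 : (0 < i)%N by apply: leq_ltn_trans il.
  change (bump l (ord_pred i) = ord_pred (up i) :> nat).
  rewrite !val_ord_pred /= /bump (gtn_eqF i0) /=.
  by rewrite -ltnS prednK // il add1n prednK.
rewrite alphaE insert0D insert0N !insert0_delta.
case: (ltngtP i l) => [il|il|/val_inj il].
- by rewrite lo_pred ?lo_i ?alphaE // ltnW.
- by rewrite -val_eqE /= gtn_eqF // hi_pred // hi_i ?alphaE // ltnW.
- rewrite {3}il eqxx lo_pred ?hi_i ?il // !alphaE addrA; congr (_ - _).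
  rewrite -addrA -[LHS]addr0; congr (_ + _); apply/esym/eqP.
  rewrite addrC subr_eq0; apply/eqP; congr (delta_mx 0 _); apply: val_inj.
  exact: etrans (val_ord_pred (up l)) _.
Qed.

Variables (k : fieldType) (C : linCat k) (Cw : weight e.+1 -> C -> Prop).
Implicit Types Eb Fb : 'I_e.+1 -> functor C C.

Definition in_sub (X : C) : Prop :=
  exists n (mu : 'I_n -> weight e) (Xs : 'I_n -> C),
    (forall a, Cw (insert0 (mu a)) (Xs a)) /\ is_direct_sum Xs X.

Definition subC : linCat k := full_sub in_sub.
Definition subCw (mu : weight e) (X : subC) : Prop := Cw (insert0 mu) (sval X).

(* The endofunctors of the ambient category which restrict to E_i and F_i. *)
Definition mergeE Eb (i : 'I_e) : functor C C :=
  if (i < l)%N then Eb (low i)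
  else if i == l then compF (Eb (low l)) (Eb (up l))
  else Eb (up i).

Definition mergeF Fb (i : 'I_e) : functor C C :=
  if (i < l)%N then Fb (low i)
  else if i == l then compF (Fb (up l)) (Fb (low l))
  else Fb (up i).

Lemma mergeE_weight Eb :
  (forall i mu X, Cw mu X -> Cw (mu + alpha i) (Eb i X)) ->
  forall i mu X, Cw (insert0 mu) X -> Cw (insert0 (mu + alpha i)) (mergeE Eb i X).
Proof.
move=> hE i mu X hX; rewrite insert0D insert0_alpha /mergeE.
case: ifP => _; first exact: hE; case: ifP => _; last exact: hE.
by rewrite [alpha _ + _]addrC addrA; exact/hE/hE.
Qed.

Lemma mergeF_weight Fb :
  (forall i mu X, Cw mu X -> Cw (mu - alpha i) (Fb i X)) ->
  forall i mu X, Cw (insert0 mu) X -> Cw (insert0 (mu - alpha i)) (mergeF Fb i X).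
Proof.
move=> hF i mu X hX; rewrite insert0D insert0N insert0_alpha /mergeF.
case: ifP => _; first exact: hF; case: ifP => _; last exact: hF.
by rewrite opprD addrA; exact/hF/hF.
Qed.

Lemma mergeE_stable Eb :
  (forall i mu X, Cw mu X -> Cw (mu + alpha i) (Eb i X)) ->
  forall i X, in_sub X -> in_sub (mergeE Eb i X).
Proof.
move=> hE i X [n [mu [Xs [hXs hX]]]].
exists n, (fun a => mu a + alpha i), (fun a => mergeE Eb i (Xs a)).
by split=> [a|]; [apply: mergeE_weight | apply: functor_direct_sum].
Qed.

Lemma mergeF_stable Fb :
  (forall i mu X, Cw mu X -> Cw (mu - alpha i) (Fb i X)) ->
  forall i X, in_sub X -> in_sub (mergeF Fb i X).
Proof.
move=> hF i X [n [mu [Xs [hXs hX]]]].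
exists n, (fun a => mu a - alpha i), (fun a => mergeF Fb i (Xs a)).
by split=> [a|]; [apply: mergeF_weight | apply: functor_direct_sum].
Qed.

Definition subE Eb (hE : forall i mu X, Cw mu X -> Cw (mu + alpha i) (Eb i X))
    (i : 'I_e) : functor subC subC := restrict (mergeE_stable hE i).

Definition subF Fb (hF : forall i mu X, Cw mu X -> Cw (mu - alpha i) (Fb i X))
    (i : 'I_e) : functor subC subC := restrict (mergeF_stable hF i).
End Thin.

(* Main.v *)
(** Since F is the direct sum of the F_i, a categorical representation is the
    same as a biadjoint pair (E_i, F_i) for each i together with dots
    x_i : F_i -> F_i and crossings t_ij : F_j F_i -> F_i F_j satisfying the KLR
    relations on words of length 2 and 3: those of F^d follow by whiskering, and
    distinct weights alpha_i split an adjunction E -| F into components.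

    For the new letter k, put 1 = k, 2 = k + 1 and F_k = F_2 F_1, and compose
    crossings strand by strand. On the subcategory C every word with a prefix
    containing more 2's than 1's acts by zero, as the weight gets a negative
    entry. Hence the two dots on F_2 F_1 agree (their difference is t_21 t_12, which
    factors through F_1 F_2 = 0), and the braid relations on 121 and 212 lose one
    of their terms, so that t_12 t_11 t_21 = -1 and t_12 t_22 t_21 = -1 there. The
    crossing of two pairs is minus the composite of the four elementary
    crossings. Moving a strand a across it, the only corrections come from the
    triple points 1a1 and 2a2; the two identities turn them into multiples of
    t_a2 t_2a and t_1a t_a1, which gives the KLR correction for letters a outside the
    pair, and gives zero for a = 1 and a = 2, where the squares t_11 t_11 and
    t_22 t_22 vanish. *)
From HB Require Import structures.
From mathcomp Require Import all_boot all_order all_algebra perm.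
From mathcomp Require Import boolp.
From mathcomp Require Import finmap monalg zify.
Require Import Defs.

Set Implicit Arguments.
Unset Strict Implicit.
Unset Printing Implicit Defensive.

Import GRing.Theory.
Local Open Scope ring_scope.

(** * Adjunctions and finite sums of functors *)

Section LinearCategories.
Variable k : fieldType.
Implicit Types C D B : linCat k.

(** The vanishing is available only on C, while the merged functors pass through objects outside C:
    in F_1 M the inserted column has the entry 1. So the relations of the merged family are proved
    for endofunctors of the ambient category, at the objects satisfying a predicate [P], and are
    restricted to the full subcategory only at the end. The inserted column decides everything: F_1
    raises it by one, F_2 lowers it by one, the other letters keep it. The words whose vanishing is
    used are 2, 1a22 and 11222, read from the first letter applied.

    The constants depend on the number of vertices. As e + 1 > 2, two vertices of the large quiver
    are joined by at most one arrow, so its braid corrections are scalars. The small quiver may have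
    e = 2; its two vertices are then joined by two arrows and the correction is a linear polynomial.
    It appears as the sum of one contribution from strand 1 and one from strand 2, which is a
    Leibniz rule for divided differences.

    On quivers, merging the letters contracts the arrow k -> k + 1: arrows enter the pair at k and
    leave it from k + 1. *)

Lemma compNr C (X Y Z : C) (g : hom Y Z) (f : hom X Y) :
  g \oc (- f) = - (g \oc f).
Proof. by rewrite -scaleN1r compZr scaleN1r. Qed.

Lemma compBl C (X Y Z : C) (g g' : hom Y Z) (f : hom X Y) :
  (g - g') \oc f = g \oc f - g' \oc f.
Proof. by rewrite compDl compNl. Qed.

Lemma compBr C (X Y Z : C) (g : hom Y Z) (f f' : hom X Y) :
  g \oc (f - f') = g \oc f - g \oc f'.
Proof. by rewrite compDr compNr. Qed.

Lemma preL C (W X Y Z : C) (g : hom Y Z) (f : hom X Y) h :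
  g \oc f = h -> forall r : hom W X, g \oc (f \oc r) = h \oc r.
Proof. by move=> <- r; rewrite compA. Qed.

Lemma preR C (W X Y Y' Z : C) (g : hom Y Z) (f : hom X Y) (g' : hom Y' Z)
    (f' : hom X Y') : g \oc f = g' \oc f' ->
  forall r : hom W X, g \oc (f \oc r) = g' \oc (f' \oc r).
Proof. by move=> E r; rewrite !compA E. Qed.

Lemma fmap_compA C D (F : functor C D) (X Y Z : C) (W : D) (g : hom Y Z)
    (f : hom X Y) (r : hom W (F X)) :
  fmap F g \oc (fmap F f \oc r) = fmap F (g \oc f) \oc r.
Proof. by rewrite fmap_comp compA. Qed.

Lemma zero_dom C (X Y : C) (f : hom X Y) : idm X = 0 -> f = 0.
Proof. by move=> h; rewrite -[LHS]compm1 h compm0. Qed.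

Lemma zero_cod C (X Y : C) (f : hom X Y) : idm Y = 0 -> f = 0.
Proof. by move=> h; rewrite -[LHS]comp1m h comp0m. Qed.

Lemma is_zeroP C (X : C) : is_zero X <-> idm X = 0.
Proof.
split=> [/(_ X) [h _]|h Y]; first exact: h.
by split=> f; [apply: zero_dom | apply: zero_cod].
Qed.

Lemma fmap_zero C D (F : functor C D) X : idm X = 0 -> idm (F X) = 0.
Proof. by move=> h; rewrite -fmap_id h linear0. Qed.

Lemma direct_sum_hom0 C (I : finType) (Xs : I -> C) X Y (f : hom X Y) :
  is_direct_sum Xs X -> (forall i (g : hom (Xs i) Y), g = 0) -> f = 0.
Proof.
move=> [inc [pr [_ _ h]]] h0; rewrite -[LHS]compm1 -h comp_sumr big1 // => i _.
by rewrite compA [f \oc _]h0 comp0m.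
Qed.

Lemma direct_sum_zero C (I : finType) (Xs : I -> C) X :
  is_direct_sum Xs X -> (forall i, idm (Xs i) = 0) -> idm X = 0.
Proof.
move=> hX h0; apply: (direct_sum_hom0 _ hX) => i g; exact: zero_dom.
Qed.

Lemma direct_sum1 C (X : C) : is_direct_sum (fun _ : 'I_1 => X) X.
Proof.
exists (fun=> idm X), (fun=> idm X); split=> [i|i j|].
- by rewrite compm1.
- by rewrite !ord1 eqxx.
- by rewrite big_ord1 compm1.
Qed.

Section Adjoint.
Variables C D B : linCat k.

(** Units and counits as plain families of morphisms: their naturality squares then mention neither
    [idF] nor [compF], and rewriting applies directly. *)
Lemma adjointI (F : functor C D) (G : functor D C)
    (eta : forall X : C, hom X (G (F X))) (eps : forall Y : D, hom (F (G Y)) Y) :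
  (forall X X' (f : hom X X'), eta X' \oc f = fmap G (fmap F f) \oc eta X) ->
  (forall Y Y' (f : hom Y Y'), eps Y' \oc fmap F (fmap G f) = f \oc eps Y) ->
  (forall X, eps (F X) \oc fmap F (eta X) = idm (F X)) ->
  (forall Y, fmap G (eps Y) \oc eta (G Y) = idm (G Y)) -> adjoint F G.
Proof.
move=> nat_eta nat_eps t1 t2.
exists (@NatTrans k C C (idF C) (compF G F) eta nat_eta).
by exists (@NatTrans k D D (compF F G) (idF D) eps nat_eps).
Qed.

Lemma adjointE (F : functor C D) (G : functor D C) : adjoint F G ->
  exists (eta : forall X : C, hom X (G (F X)))
         (eps : forall Y : D, hom (F (G Y)) Y),
  [/\ forall X X' (f : hom X X'), eta X' \oc f = fmap G (fmap F f) \oc eta X,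
      forall Y Y' (f : hom Y Y'), eps Y' \oc fmap F (fmap G f) = f \oc eps Y,
      forall X, eps (F X) \oc fmap F (eta X) = idm (F X)
    & forall Y, fmap G (eps Y) \oc eta (G Y) = idm (G Y)].
Proof.
move=> [eta [eps [t1 t2]]]; exists eta, eps; split=> // X Y f.
  exact: (natural eta f).
exact: (natural eps f).
Qed.
End Adjoint.

Section AdjointComp.
Variables C D B : linCat k.

Lemma adjoint_comp (F : functor C D) (G : functor D C)
    (F' : functor D B) (G' : functor B D) :
  adjoint F G -> adjoint F' G' -> adjoint (compF F' F) (compF G G').
Proof.
move=> /adjointE[eta [eps [n1 n2 t1 t2]]] /adjointE[eta' [eps' [n1' n2' t1' t2']]].
apply: (@adjointI _ _ (compF F' F) (compF G G')
  (fun X => fmap G (eta' (F X)) \oc eta X)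
  (fun Y => eps' Y \oc fmap F' (eps (G' Y)))) => [X Y f|X Y f|X|Y] /=.
- by rewrite -compA n1 compA -fmap_comp n1' fmap_comp compA.
- by rewrite -compA -fmap_comp n2 fmap_comp compA n2' compA.
- rewrite -compA -fmap_comp [fmap F (_ \oc _)]fmap_comp [eps _ \oc _]compA n2.
  by rewrite -compA t1 compm1 t1'.
- rewrite compA -fmap_comp [fmap G' (_ \oc _)]fmap_comp.
  by rewrite -[fmap G' _ \oc _ \oc _]compA -n1' compA t2' comp1m t2.
Qed.
End AdjointComp.

Section AdjointLimits.
Variables C D : linCat k.

(** A morphism W -> G X killed by G f transposes to a morphism F W -> X killed by f; it factors
    through K, and the factor is transposed back. *)
Lemma right_adjoint_kernel (F : functor C D) (G : functor D C) (K X Y : D)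
    (i : hom K X) (f : hom X Y) :
  adjoint F G -> is_kernel i f -> is_kernel (fmap G i) (fmap G f).
Proof.
move=> /adjointE[eta [eps [n1 n2 t1 t2]]] [fi0 ker_i]; split.
  by rewrite -fmap_comp fi0 linear0.
move=> W g fg0.
have fg'0 : f \oc (eps X \oc fmap F g) = 0.
  by rewrite compA -n2 -compA -fmap_comp fg0 linear0 compm0.
have [u [iu uniq_u]] := ker_i _ _ fg'0.
exists (fmap G u \oc eta W); split.
  rewrite compA -fmap_comp iu fmap_comp -compA.
  by rewrite -n1 compA t2 comp1m.
move=> v iv; rewrite (uniq_u (eps K \oc fmap F v)).
  by rewrite fmap_comp -compA -n1 compA t2 comp1m.
by rewrite compA -n2 -compA -fmap_comp iv.
Qed.

Lemma left_adjoint_cokernel (F : functor C D) (G : functor D C) (X Y Q : C)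
    (p : hom Y Q) (f : hom X Y) :
  adjoint F G -> is_cokernel p f -> is_cokernel (fmap F p) (fmap F f).
Proof.
move=> /adjointE[eta [eps [n1 n2 t1 t2]]] [pf0 coker_p]; split.
  by rewrite -fmap_comp pf0 linear0.
move=> Z g gf0.
have gf'0 : (fmap G g \oc eta Y) \oc f = 0.
  by rewrite -compA n1 compA -fmap_comp gf0 linear0 comp0m.
have [u [up uniq_u]] := coker_p _ _ gf'0.
exists (eps Z \oc fmap F u); split.
  rewrite -compA -fmap_comp up fmap_comp compA.
  by rewrite n2 -compA t1 compm1.
move=> v vp; rewrite (uniq_u (fmap G v \oc eta Q)).
  by rewrite fmap_comp compA n2 -compA t1 compm1.
by rewrite -compA n1 compA -fmap_comp vp.
Qed.

End AdjointLimits.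

Lemma biadjoint_exact C D (F : functor C D) (G : functor D C) :
  adjoint F G -> adjoint G F -> exact_functor F.
Proof.
move=> FG GF X Y Z i p [ker_i coker_p]; split.
  exact: right_adjoint_kernel GF ker_i.
exact: left_adjoint_cokernel FG coker_p.
Qed.

Section Biproduct.
Variables (C : linCat k) (I : finType) (Xs : I -> C) (X : C).
Variables (inc : forall i, hom (Xs i) X) (pr : forall i, hom X (Xs i)).
Hypothesis XP : is_biproduct inc pr.

Lemma biproduct_ext Y (f g : hom X Y) :
  (forall i, f \oc inc i = g \oc inc i) -> f = g.
Proof.
case: XP => _ _ h fg; rewrite -[LHS]compm1 -[RHS]compm1 -h !comp_sumr.
by apply: eq_bigr => i _; rewrite !compA fg.
Qed.

Lemma biproduct_coext Y (f g : hom Y X) :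
  (forall i, pr i \oc f = pr i \oc g) -> f = g.
Proof.
case: XP => _ _ h fg; rewrite -[LHS]comp1m -[RHS]comp1m -h !comp_suml.
by apply: eq_bigr => i _; rewrite -!compA fg.
Qed.

End Biproduct.

Section SumFunctor.
Variables (D : linCat k) (I : finType).
Implicit Types Fi Gi : I -> functor D D.

(** The direct sums are chosen object by object. The choices need no compatibility, because
    morphisms act diagonally through the chosen inclusions and projections. *)
Lemma functor_sum_exists n (Fi : 'I_n -> functor D D) : abelian D ->
  exists (F : functor D D) (inc : forall i, nattrans (Fi i) F)
    (pr : forall i, nattrans F (Fi i)), functor_sum inc pr.
Proof.
move=> abD.
have hT0 X : exists T : {S : D & ((forall i, hom (Fi i X) S) *
    (forall i, hom S (Fi i X)))%type},
    is_biproduct (Xs := fun i => Fi i X) (projT2 T).1 (projT2 T).2.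
  have [S [inc [pr h]]] := ab_sum abD (fun i => Fi i X).
  by exists (existT _ S (inc, pr)).
pose T X := projT1 (cid (hT0 X)); have hT X := projT2 (cid (hT0 X)).
pose S X := projT1 (T X); pose inc X := (projT2 (T X)).1.
pose pr X := (projT2 (T X)).2.
have h1 X i : pr X i \oc inc X i = idm _ by case: (hT X).
have h2 X i j : i != j -> pr X i \oc inc X j = 0 by case: (hT X) => _ + _; apply.
have h3 X : \sum_i inc X i \oc pr X i = idm _ by case: (hT X).
pose m X Y (f : hom X Y) : hom (S X) (S Y) :=
  \sum_i inc Y i \oc fmap (Fi i) f \oc pr X i.
have inc_m X Y (f : hom X Y) i : m X Y f \oc inc X i = inc Y i \oc fmap (Fi i) f.
  rewrite comp_suml (bigD1 i) //= big1 ?addr0 => [|j ji].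
    by rewrite -[_ \oc inc X i]compA h1 compm1.
  by rewrite -[_ \oc inc X i]compA h2 // compm0.
have m_pr X Y (f : hom X Y) i : pr Y i \oc m X Y f = fmap (Fi i) f \oc pr X i.
  rewrite comp_sumr (bigD1 i) //= big1 ?addr0 => [|j ji].
    by rewrite !compA h1 comp1m.
  by rewrite !compA h2 1?eq_sym // !comp0m.
have m_lin X Y : linear (m X Y).
  move=> a f g; rewrite /m scaler_sumr -big_split; apply: eq_bigr => i _ /=.
  by rewrite linearP compDr compDl compZr compZl.
have m_id X : m X X (idm X) = idm (S X).
  by rewrite -h3; apply: eq_bigr => i _; rewrite fmap_id compm1.
have m_comp X Y Z (g : hom Y Z) (f : hom X Y) :
    m X Z (g \oc f) = m Y Z g \oc m X Y f.
  rewrite {3}/m comp_sumr; apply: eq_bigr => i _.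
  by rewrite fmap_comp -!compA compA -inc_m -compA.
pose mL X Y : {linear hom X Y -> hom (S X) (S Y)} := HB.pack (m X Y)
  (GRing.isLinear.Build _ _ _ _ (m X Y) (m_lin X Y)).
pose F := @Functor k D D S mL m_id m_comp.
have nat_inc i X Y (f : hom X Y) :
    inc Y i \oc fmap (Fi i) f = fmap F f \oc inc X i by rewrite -inc_m.
have nat_pr i X Y (f : hom X Y) :
    pr Y i \oc fmap F f = fmap (Fi i) f \oc pr X i by rewrite -m_pr.
by exists F, (fun i => @NatTrans _ _ _ _ F (fun X => inc X i) (nat_inc i)),
  (fun i => @NatTrans _ _ _ F _ (fun X => pr X i) (nat_pr i)).
Qed.

Variables (Ei Fi : I -> functor D D) (E F : functor D D).
Variables (incE : forall i, nattrans (Ei i) E) (prE : forall i, nattrans E (Ei i)).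
Variables (incF : forall i, nattrans (Fi i) F) (prF : forall i, nattrans F (Fi i)).
Hypotheses (sumE : functor_sum incE prE) (sumF : functor_sum incF prF).

(** Unit and counit are the sums of those of the summands, placed on the diagonal. [pr_et] and
    [ep_inc] recover the components, so the triangle identities reduce to those of each pair. *)
Lemma adjoint_sum : (forall i, adjoint (Ei i) (Fi i)) -> adjoint E F.
Proof.
move=> adj; pose c i := cid (adjointE (adj i)); pose c' i := cid (projT2 (c i)).
pose eta i := projT1 (c i); pose eps i := projT1 (c' i).
have n1 i X X' (f : hom X X') :
    eta i X' \oc f = fmap (Fi i) (fmap (Ei i) f) \oc eta i X.
  by have [] := projT2 (c' i).
have n2 i Y Y' (f : hom Y Y') :
    eps i Y' \oc fmap (Ei i) (fmap (Fi i) f) = f \oc eps i Y.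
  by have [] := projT2 (c' i).
have t1 i X : eps i (Ei i X) \oc fmap (Ei i) (eta i X) = idm (Ei i X).
  by have [] := projT2 (c' i).
have t2 i Y : fmap (Fi i) (eps i Y) \oc eta i (Fi i Y) = idm (Fi i Y).
  by have [] := projT2 (c' i).
pose u X i := fmap (Fi i) (incE i X) \oc eta i X.
pose v Y i := eps i Y \oc fmap (Ei i) (prF i Y).
pose et X := \sum_i incF i (E X) \oc u X i.
pose ep Y := \sum_i v Y i \oc prE i (F Y).
have pr_et X j : prF j (E X) \oc et X = u X j.
  rewrite comp_sumr; have [h1 h2 _] := sumF (E X).
  rewrite (bigD1 j) //= big1 ?addr0 => [|i ij]; first by rewrite compA h1 comp1m.
  by rewrite compA h2 1?eq_sym // comp0m.
have ep_inc Y j : ep Y \oc incE j (F Y) = v Y j.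
  rewrite comp_suml; have [h1 h2 _] := sumE (F Y).
  rewrite (bigD1 j) //= big1 ?addr0 => [|i ij]; first by rewrite -compA h1 compm1.
  by rewrite -compA h2 // compm0.
apply: (@adjointI _ _ E F et ep) => [X Y f|X Y f|X|Y].
- apply: (biproduct_coext (sumF _)) => i; rewrite compA pr_et.
  rewrite compA (natural (prF i)) -compA pr_et /u.
  by rewrite -compA n1 !compA -!fmap_comp (natural (incE i)).
- apply: (biproduct_ext (sumE _)) => i; rewrite -!compA ep_inc.
  rewrite -(natural (incE i)) compA ep_inc /v.
  by rewrite -compA -fmap_comp (natural (prF i)) fmap_comp !compA n2.
- apply: (biproduct_ext (sumE _)) => i; rewrite -compA comp1m.
  rewrite -(natural (incE i)) compA ep_inc /v.
  rewrite -compA -fmap_comp pr_et /u fmap_comp compA n2.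
  by rewrite -compA t1 compm1.
- apply: (biproduct_coext (sumF _)) => i; rewrite compA compm1.
  rewrite (natural (prF i)) -compA pr_et /u.
  by rewrite compA -fmap_comp ep_inc /v fmap_comp -compA -n1 compA t2 comp1m.
Qed.

(* The orthogonality hypothesis kills the mixed components of the unit. *)
Lemma adjoint_component :
  (forall i j, i != j ->
     forall (t : nattrans (idF D) (compF (Fi j) (Ei i))) X, t X = 0) ->
  adjoint E F -> forall i, adjoint (Ei i) (Fi i).
Proof.
move=> orth /adjointE[eta [eps [n1 n2 t1 t2]]] i.
pose w i j X := prF j (Ei i X) \oc (fmap F (prE i X) \oc eta X).
have nw a b X Y (f : hom X Y) :
    w a b Y \oc f = fmap (Fi b) (fmap (Ei a) f) \oc w a b X.
  rewrite /w -!compA n1 compA -[in LHS]compA; rewrite !compA.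
  rewrite -[_ \oc fmap F (prE a Y) \oc _]compA -fmap_comp (natural (prE a)).
  by rewrite fmap_comp compA (natural (prF b)).
have w0 a b X : a != b -> w a b X = 0.
  move=> ab; exact: (orth _ _ ab (@NatTrans _ _ _ (idF D) (compF (Fi b) (Ei a))
    (w a b) (nw a b)) X).
have wi X : incF i (Ei i X) \oc w i i X = fmap F (prE i X) \oc eta X.
  apply: (biproduct_coext (sumF _)) => j; have [h1 h2 _] := sumF (Ei i X).
  rewrite compA; have [->|ij] := eqVneq j i; first by rewrite h1 comp1m.
  by rewrite h2 // comp0m -/(w i j X) w0 // eq_sym.
pose ep Y := eps Y \oc fmap E (incF i Y) \oc incE i (Fi i Y).
apply: (@adjointI _ _ (Ei i) (Fi i) (w i i) ep) => [X Y f|X Y f|X|Y].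
- exact: nw.
- rewrite /ep -!compA (natural (incE i)) fmap_compA (natural (incF i)).
  by rewrite fmap_comp -!compA (preR (n2 _ _ f)).
- rewrite /ep -!compA (natural (incE i)) fmap_compA wi fmap_comp -!compA.
  rewrite (preR (n2 _ _ (prE i X))) (preL (t1 X)) comp1m.
  by have [h1 _ _] := sumE X; rewrite h1.
- pose g := eps Y \oc fmap E (incF i Y); pose Z := Fi i Y.
  have g0 j : j != i ->
      prF i Y \oc fmap F (g \oc (incE j Z \oc prE j Z)) \oc eta Z = 0.
    move=> ji; rewrite compA fmap_comp compA (natural (prF i)) -!compA.
    by rewrite -/(w j i Z) w0 // compm0.
  (* The identity of E Z is expanded over the summands; those other than [i] produce off-diagonal
     components of the unit, which [g0] kills. *)
  have gi : prF i Y \oc fmap F (g \oc (incE i Z \oc prE i Z)) \oc eta Z =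
      prF i Y \oc fmap F g \oc eta Z.
    have [_ _ h3] := sumE Z; rewrite -[in RHS](compm1 g) -h3 comp_sumr linear_sum.
    rewrite comp_sumr comp_suml (bigD1 i) //= [X in _ = _ + X]big1 ?addr0 //.
  rewrite /w -(preR (natural (prF i) (ep Y))) fmap_compA compA /ep -/g.
  rewrite -[_ \oc prE i _]compA gi /g fmap_comp -!compA -n1 (preL (t2 Y)) comp1m.
  by have [h1 _ _] := sumF Y; rewrite h1.
Qed.
End SumFunctor.
End LinearCategories.

(** * The subcategory of thin weights *)

Section FullSubcategories.
Variables (k : fieldType) (C : linCat k).

Lemma kernel_monic (K X Y : C) (i : hom K X) (f : hom X Y) :
  is_kernel i f -> monic i.
Proof.
move=> [fi0 ker_i] W g h gh; have fg0 : f \oc (i \oc g) = 0.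
  by rewrite compA fi0 comp0m.
by have [u [_ uniq_u]] := ker_i _ _ fg0; rewrite -(uniq_u g) // -(uniq_u h).
Qed.

Lemma cokernel_epic (X Y Q : C) (p : hom Y Q) (f : hom X Y) :
  is_cokernel p f -> epic p.
Proof.
move=> [pf0 coker_p] Z g h gh; have gf0 : (g \oc p) \oc f = 0.
  by rewrite -compA pf0 compm0.
by have [u [_ uniq_u]] := coker_p _ _ gf0; rewrite -(uniq_u g) // -(uniq_u h).
Qed.

Lemma monic_zero (X Y : C) (f : hom X Y) :
  (forall W (d : hom W X), f \oc d = 0 -> d = 0) -> monic f.
Proof.
move=> h W g g' E; apply/eqP; rewrite -subr_eq0; apply/eqP/h.
by rewrite compBr E subrr.
Qed.

Lemma epic_zero (X Y : C) (f : hom X Y) :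
  (forall Z (d : hom Y Z), d \oc f = 0 -> d = 0) -> epic f.
Proof.
move=> h W g g' E; apply/eqP; rewrite -subr_eq0; apply/eqP/h.
by rewrite compBl E subrr.
Qed.

Variable P : C -> Prop.
Hypothesis P_sum : forall n (Xs : 'I_n -> C) X,
  (forall a, P (Xs a)) -> is_direct_sum Xs X -> P X.
Hypothesis P_sub : forall X Y (f : hom X Y), monic f -> P Y -> P X.
Hypothesis P_quot : forall X Y (f : hom X Y), epic f -> P X -> P Y.
Hypothesis abC : abelian C.

Let sub := full_sub P.

Lemma full_sub_kernel (X Y : sub) (f : hom (sval X) (sval Y)) (K : C)
    (i : hom K (sval X)) : is_kernel i f ->
  exists PK : P K, @is_kernel k sub (exist _ K PK) X Y i f.
Proof.
move=> ker_i; have PK := P_sub (kernel_monic ker_i) (svalP X).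
by exists PK; case: ker_i => fi0 ker_i; split=> // W; apply: ker_i.
Qed.

Lemma full_sub_cokernel (X Y : sub) (f : hom (sval X) (sval Y)) (Q : C)
    (p : hom (sval Y) Q) : is_cokernel p f ->
  exists PQ : P Q, @is_cokernel k sub X Y (exist _ Q PQ) p f.
Proof.
move=> coker_p; have PQ := P_quot (cokernel_epic coker_p) (svalP Y).
by exists PQ; case: coker_p => pf0 coker_p; split=> // Z; apply: coker_p.
Qed.

(** The kernel taken in the ambient category is a subobject of X, so it lies in the subcategory,
    where monicity makes its inclusion zero. *)
Lemma full_sub_monic (X Y : sub) (f : hom X Y) :
  monic f -> monic (f : hom (sval X) (sval Y)).
Proof.
move=> mono_f; apply: monic_zero => W d fd0.
have [K [i ker_i]] := ab_ker abC (f : hom (sval X) (sval Y)).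
have [PK [fi0 _]] := full_sub_kernel ker_i.
have i0 : i = 0.
  apply: (mono_f (exist _ K PK) i 0); apply: etrans fi0 _.
  exact/esym/(@compm0 k C).
have [_ /(_ _ _ fd0)[u [<- _]]] := ker_i.
by rewrite i0 comp0m.
Qed.

Lemma full_sub_epic (X Y : sub) (f : hom X Y) :
  epic f -> epic (f : hom (sval X) (sval Y)).
Proof.
move=> epi_f; apply: epic_zero => W d df0.
have [Q [p coker_p]] := ab_coker abC (f : hom (sval X) (sval Y)).
have [PQ [pf0 _]] := full_sub_cokernel coker_p.
have p0 : p = 0.
  apply: (epi_f (exist _ Q PQ) p 0); apply: etrans pf0 _.
  exact/esym/(@comp0m k C).
have [_ /(_ _ _ df0)[u [<- _]]] := coker_p.
by rewrite p0 compm0.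
Qed.

Lemma full_sub_abelian : abelian sub.
Proof.
split.
- move=> n Xs; have [S dsS] := ab_sum abC (fun a => sval (Xs a)).
  have PS : P S by apply: (P_sum _ dsS) => a; apply: (svalP (Xs a)).
  by exists (exist _ S PS); apply: dsS.
- move=> X Y f; have [K [i /full_sub_kernel[PK ker_i]]] :=
    ab_ker abC (f : hom (sval X) (sval Y)).
  by exists (exist _ K PK), i.
- move=> X Y f; have [Q [p /full_sub_cokernel[PQ coker_p]]] :=
    ab_coker abC (f : hom (sval X) (sval Y)).
  by exists (exist _ Q PQ), p.
(* The target Z of [g] may lie outside the subcategory. Therefore [f] is shown to be the kernel of
   its cokernel, through which [g] factors. *)
- move=> X Y f /full_sub_monic /(ab_monic abC)[Z [g [gf0 ker_f]]].
  have [Q [p cok]] := ab_coker abC (f : hom (sval X) (sval Y)).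
  have [PQ [pf0 _]] := full_sub_cokernel cok.
  exists (exist _ Q PQ), p; split=> // W h ph0; apply: ker_f.
  case: cok => _ /(_ _ _ gf0)[u [<- _]].
  by rewrite -compA; apply: etrans (@compm0 k C _ _ _ u); congr comp.
- move=> X Y f /full_sub_epic /(ab_epic abC)[Z [g [fg0 coker_f]]].
  have [K [i ker]] := ab_ker abC (f : hom (sval X) (sval Y)).
  have [PK [fi0 _]] := full_sub_kernel ker.
  exists (exist _ K PK), i; split=> // W h hi0; apply: coker_f.
  case: ker => _ /(_ _ _ fg0)[u [<- _]].
  by rewrite compA; apply: etrans (@comp0m k C _ _ _ u); congr comp.
Qed.

Lemma adjoint_restrict (F G : functor C C) (PF : forall X, P X -> P (F X))
    (PG : forall X, P X -> P (G X)) :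
  adjoint F G -> adjoint (restrict PF) (restrict PG).
Proof.
move=> /adjointE[eta [eps [n1 n2 t1 t2]]].
apply: (@adjointI k sub sub (restrict PF) (restrict PG)
  (fun X => eta (sval X)) (fun X => eps (sval X))) => [X Y f|X Y f|X|X].
- exact: n1.
- exact: n2.
- exact: t1.
- exact: t2.
Qed.
End FullSubcategories.

Section ThinSubcategory.
Variables (k : fieldType) (e : nat) (l : 'I_e) (C : linCat k).
Variables (Cw : weight e.+1 -> C -> Prop) (decC : decomposition Cw).
Local Notation P := (in_sub l Cw).

Lemma weight_zero w (X : C) : idm X = 0 -> Cw w X.
Proof.
move=> X0; apply: (ds_sum decC (n := 0) (Xs := fun=> X)); first by case.
exists (fun=> 0), (fun=> 0); split; try by case.
by rewrite big_ord0 X0.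
Qed.

Lemma in_sub_weight w (X : C) : Cw w X ->
  forall mu, w = insert0 l mu -> P X.
Proof.
move=> hX mu E; exists 1%N, (fun=> mu), (fun=> X).
by split=> [_|]; [rewrite -E | apply: direct_sum1].
Qed.

Lemma in_subI n (Xs : 'I_n -> C) X : is_direct_sum Xs X ->
  (forall a, exists mu, Cw (insert0 l mu) (Xs a)) -> P X.
Proof. by move=> dsX /choice[mu hmu]; exists n, mu, Xs. Qed.

Lemma in_sub_homl X (Y : C) w : P X -> Cw w Y ->
  (forall mu, w <> insert0 l mu) -> forall f : hom X Y, f = 0.
Proof.
move=> [n [mu [Xs [hXs dsX]]]] hY wN f; apply: (direct_sum_hom0 _ dsX) => a g.
by apply: (ds_orth decC _ (hXs a) hY) => /esym/wN.
Qed.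

Lemma in_sub_homr X (Y : C) w : P X -> Cw w Y ->
  (forall mu, w <> insert0 l mu) -> forall f : hom Y X, f = 0.
Proof.
move=> [n [mu [Xs [hXs [inc [pr dsX]]]]]] hY wN f.
apply: (biproduct_coext dsX) => a; rewrite compm0.
exact: (ds_orth decC (wN (mu a)) hY (hXs a)).
Qed.

(** A summand of X of any other weight has zero projection by the hypothesis, hence is a zero
    object. Membership thus becomes a condition on morphisms out of X, which passes to sums and
    quotients; the dual test [in_sub_detectr] passes to subobjects. *)
Lemma in_sub_detectl (X : C) : (forall (Y : C) w, Cw w Y ->
  (forall mu, w <> insert0 l mu) -> forall f : hom X Y, f = 0) -> P X.
Proof.
move=> h; have [n [w [Xs [hXs dsX]]]] := ds_span decC X.
apply: (in_subI dsX) => a.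
have [[mu E]|N] := pselect (exists mu, w a = insert0 l mu).
  by exists mu; rewrite -E.
(* A zero object lies in every weight space, so the weight 0 serves. *)
exists 0; apply: weight_zero; have [inc [pr [h1 _ _]]] := dsX.
rewrite -h1 (h _ _ (hXs a) _ (pr a)) ?comp0m // => mu E; apply: N.
by exists mu.
Qed.

Lemma in_sub_detectr (X : C) : (forall (Y : C) w, Cw w Y ->
  (forall mu, w <> insert0 l mu) -> forall f : hom Y X, f = 0) -> P X.
Proof.
move=> h; have [n [w [Xs [hXs dsX]]]] := ds_span decC X.
apply: (in_subI dsX) => a.
have [[mu E]|N] := pselect (exists mu, w a = insert0 l mu).
  by exists mu; rewrite -E.
exists 0; apply: weight_zero; have [inc [pr [h1 _ _]]] := dsX.
rewrite -h1 (h _ _ (hXs a) _ (inc a)) ?compm0 // => mu E; apply: N.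
by exists mu.
Qed.

Lemma in_sub_sum n (Xs : 'I_n -> C) X :
  (forall a, P (Xs a)) -> is_direct_sum Xs X -> P X.
Proof.
move=> hXs dsX; apply: in_sub_detectl => Y w hY wN f.
by apply: (direct_sum_hom0 _ dsX) => a g; apply: in_sub_homl hY wN g.
Qed.

Lemma in_sub_monic X Y (f : hom X Y) : monic f -> P Y -> P X.
Proof.
move=> mono_f hY; apply: in_sub_detectr => Z w hZ wN g.
by apply: mono_f; rewrite compm0; apply: in_sub_homr hZ wN _.
Qed.

Lemma in_sub_epic X Y (f : hom X Y) : epic f -> P X -> P Y.
Proof.
move=> epi_f hX; apply: in_sub_detectl => Z w hZ wN g.
by apply: epi_f; rewrite comp0m; apply: in_sub_homl hZ wN _.
Qed.

Lemma subC_abelian : abelian C -> abelian (subC l Cw).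
Proof.
exact: (full_sub_abelian in_sub_sum in_sub_monic in_sub_epic).
Qed.

Lemma insert0_inj : injective (@insert0 e l).
Proof.
move=> mu nu E; apply/rowP => j; have /rowP/(_ (lift (low l) j)) := E.
by rewrite !mxE liftK.
Qed.

Lemma subC_decomposition : decomposition (@subCw e l k C Cw).
Proof.
split.
- by move=> w n Xs X; apply: (ds_sum decC).
- move=> w w' X Y ww' hX hY; apply: (ds_orth decC _ hX hY).
  by move=> /insert0_inj.
- move=> [X [n [mu [Xs [hXs dsX]]]]].
  exists n, mu, (fun a => exist _ (Xs a) (in_sub_weight (hXs a) erefl)).
  by split=> [a|]; [apply: hXs | apply: dsX].
Qed.
End ThinSubcategory.

(** * Splitting the adjunctions by weights *)

Section WeightAdjunctions.
Variables (k : fieldType) (m : nat) (D : linCat k).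
Variables (Dw : weight m -> D -> Prop) (Ei Fi : 'I_m -> functor D D).

(** Column [i] of [alpha i] is -1, whereas in [alpha j] with [j] different from [i] it is 0 or 1. *)
Lemma alpha_inj : (1 < m)%N -> injective (@alpha m).
Proof.
move=> m1 i j E; apply/eqP/negPn/negP => ij.
have /rowP/(_ i) := E; rewrite !alphaE !mxE !eqxx /= (negPf ij) subr0.
have -> : (i == ord_pred i) = false.
  apply/negbTE/eqP => /(congr1 (@nat_of_ord m)); rewrite val_ord_pred.
  case: i {E ij} => [[|i] hi] /=; first by case: m m1 {hi} => [|[]].
  by move/esym/n_Sn.
by case: (_ == _).
Qed.

Lemma rep_adjoint_EF (rep : cat_rep Dw Ei Fi) (i : 'I_m) : (1 < m)%N ->
  adjoint (Ei i) (Fi i) /\ adjoint (Fi i) (Ei i).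
Proof.
move=> m1; split; [apply: (adjoint_component (rep_sumE rep) (rep_sumF rep) _
  (rep_adjEF rep)) | apply: (adjoint_component (rep_sumF rep) (rep_sumE rep) _
  (rep_adjFE rep))] => a b ab t X.
all: have [n [w [Xs [hXs dsX]]]] := ds_span (rep_dec rep) X.
(* By naturality it is enough to look at weight objects. There [t] maps into a weight shifted by the
   difference of two distinct [alpha], so it is zero. *)
all: have [inc [pr hX]] := dsX; apply: (biproduct_ext hX) => c; rewrite comp0m.
all: have /= -> := natural t (inc c); rewrite [t (Xs c)](_ : _ = 0) ?compm0 //.
  apply: (ds_orth (rep_dec rep) _ (hXs c)
    (rep_weightF rep b (rep_weightE rep a (hXs c)))).
  move/eqP; rewrite -subr_eq0 -addrA opprD addrA subrr sub0r oppr_eq0 subr_eq0.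
  by move=> /eqP/(alpha_inj m1)/eqP; rewrite (negPf ab).
apply: (ds_orth (rep_dec rep) _ (hXs c)
  (rep_weightE rep b (rep_weightF rep a (hXs c)))).
move/eqP; rewrite -subr_eq0 -addrA opprD addrA subrr sub0r oppr_eq0 addrC subr_eq0.
by move=> /eqP/(alpha_inj m1)/esym/eqP; rewrite (negPf ab).
Qed.
End WeightAdjunctions.

(** * Crossings of composite strands *)

Section Crossings.
Variables (k : fieldType) (D : linCat k).
Implicit Types A B C : functor D D.

Definition cross A B := nattrans (compF B A) (compF A B).

(* Objects are read as words: in C (B (A M)) the strand A comes first. *)
Definition braidR A B C (cAB : cross A B) (cAC : cross A C) (cBC : cross B C)
    (M : D) : hom (C (B (A M))) (A (B (C M))) :=
  cAB (C M) \oc (fmap B (cAC M) \oc cBC (A M)).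

Definition braidL A B C (cAB : cross A B) (cAC : cross A C) (cBC : cross B C)
    (M : D) : hom (C (B (A M))) (A (B (C M))) :=
  fmap A (cBC M) \oc (cAC (B M) \oc fmap C (cAB M)).

Definition defect A B C (cAB : cross A B) (cAC : cross A C) (cBC : cross B C) M :=
  braidR cAB cAC cBC M - braidL cAB cAC cBC M.

Lemma cross_nat A B (c : cross A B) M N (f : hom M N) :
  c N \oc fmap B (fmap A f) = fmap A (fmap B f) \oc c M.
Proof. exact: (natural c f). Qed.

Section Composite.
Variables A1 A2 B : functor D D.

Fact crossL_nat (c1 : cross A1 B) (c2 : cross A2 B) M N (f : hom M N) :
  (fmap A2 (c1 N) \oc c2 (A1 N)) \oc fmap (compF B (compF A2 A1)) f =
  fmap (compF (compF A2 A1) B) f \oc (fmap A2 (c1 M) \oc c2 (A1 M)).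
Proof.
by rewrite /= -compA cross_nat !compA -!fmap_comp cross_nat.
Qed.

Definition crossL (c1 : cross A1 B) (c2 : cross A2 B) : cross (compF A2 A1) B :=
  @NatTrans k D D (compF B (compF A2 A1)) (compF (compF A2 A1) B)
    (fun M => fmap A2 (c1 M) \oc c2 (A1 M)) (@crossL_nat c1 c2).

Fact crossR_nat (c1 : cross B A1) (c2 : cross B A2) M N (f : hom M N) :
  (c2 (A1 N) \oc fmap A2 (c1 N)) \oc fmap (compF (compF A2 A1) B) f =
  fmap (compF B (compF A2 A1)) f \oc (c2 (A1 M) \oc fmap A2 (c1 M)).
Proof.
by rewrite /= -compA -fmap_comp cross_nat fmap_comp !compA cross_nat.
Qed.

Definition crossR (c1 : cross B A1) (c2 : cross B A2) : cross B (compF A2 A1) :=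
  @NatTrans k D D (compF (compF A2 A1) B) (compF B (compF A2 A1))
    (fun M => c2 (A1 M) \oc fmap A2 (c1 M)) (@crossR_nat c1 c2).
End Composite.

(** The crossings [c11] and [c22] involve disjoint strands and commute; this is the only difference
    between the two orders. *)
Lemma crossLR A1 A2 B1 B2 (c11 : cross A1 B1) (c12 : cross A1 B2)
    (c21 : cross A2 B1) (c22 : cross A2 B2) M :
  crossL (crossR c11 c12) (crossR c21 c22) M =
  crossR (crossL c11 c21) (crossL c12 c22) M.
Proof.
rewrite /= !fmap_comp -!compA; congr comp; rewrite !compA; congr comp.
by rewrite cross_nat.
Qed.

Lemma ntN A B (s : nattrans A B) (M : D) : (- s) M = - s M.
Proof. exact: scaleN1r. Qed.

Section DefectOpp.
Variables (A B C : functor D D) (cAB : cross A B) (cAC : cross A C).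
Variables (cBC : cross B C) (M : D).

Lemma defectN1 : defect (- cAB) cAC cBC M = - defect cAB cAC cBC M.
Proof.
by rewrite /defect /braidR /braidL !ntN linearN !(compNl, compNr) opprD.
Qed.

Lemma defectN2 : defect cAB (- cAC) cBC M = - defect cAB cAC cBC M.
Proof.
by rewrite /defect /braidR /braidL !ntN linearN !(compNl, compNr) opprD.
Qed.

Lemma defectN3 : defect cAB cAC (- cBC) M = - defect cAB cAC cBC M.
Proof.
by rewrite /defect /braidR /braidL !ntN linearN !(compNl, compNr) opprD.
Qed.
End DefectOpp.

(** Telescoping: the crossing of B and C slides past A2 and then past A1, and the intermediate
    position cancels. [defectM] and [defectR] split the middle and the last strand in the same
    way. *)
Lemma defectL A1 A2 B C (a1B : cross A1 B) (a2B : cross A2 B)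
    (a1C : cross A1 C) (a2C : cross A2 C) (cBC : cross B C) M :
  defect (crossL a1B a2B) (crossL a1C a2C) cBC M =
  fmap A2 (a1B (C M) \oc fmap B (a1C M)) \oc defect a2B a2C cBC (A1 M) +
  fmap A2 (defect a1B a1C cBC M) \oc a2C (B (A1 M)) \oc fmap C (a2B (A1 M)).
Proof.
have eR : braidR (crossL a1B a2B) (crossL a1C a2C) cBC M =
    fmap A2 (a1B (C M) \oc fmap B (a1C M)) \oc braidR a2B a2C cBC (A1 M).
  rewrite /braidR /= !fmap_comp -!compA.
  by rewrite (preR (cross_nat a2B (a1C M))).
have eL : braidL (crossL a1B a2B) (crossL a1C a2C) cBC M =
    fmap A2 (braidL a1B a1C cBC M) \oc a2C (B (A1 M)) \oc fmap C (a2B (A1 M)).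
  rewrite /braidL /= !fmap_comp -!compA.
  by rewrite (preR (cross_nat a2C (a1B M))).
rewrite /defect compBr linearB !compBl eR eL addrA; congr (_ - _).
rewrite [X in _ - X + _](_ : _ =
  fmap A2 (braidR a1B a1C cBC M) \oc a2C (B (A1 M)) \oc fmap C (a2B (A1 M))).
  by rewrite subrK.
by rewrite /braidR /braidL !fmap_comp -!compA.
Qed.

Lemma defectM A B1 B2 C (aB1 : cross A B1) (aB2 : cross A B2) (cAC : cross A C)
    (b1C : cross B1 C) (b2C : cross B2 C) M :
  defect (crossR aB1 aB2) cAC (crossL b1C b2C) M =
  aB2 (B1 (C M)) \oc fmap B2 (defect aB1 cAC b1C M) \oc b2C (B1 (A M)) +
  fmap A (fmap B2 (b1C M)) \oc defect aB2 cAC b2C (B1 M) \oc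
    fmap C (fmap B2 (aB1 M)).
Proof.
have eR : braidR (crossR aB1 aB2) cAC (crossL b1C b2C) M =
    aB2 (B1 (C M)) \oc fmap B2 (braidR aB1 cAC b1C M) \oc b2C (B1 (A M)).
  by rewrite /braidR /= !fmap_comp -!compA.
have eL : braidL (crossR aB1 aB2) cAC (crossL b1C b2C) M =
    fmap A (fmap B2 (b1C M)) \oc braidL aB2 cAC b2C (B1 M) \oc
    fmap C (fmap B2 (aB1 M)).
  by rewrite /braidL /= !fmap_comp -!compA.
rewrite /defect linearB !compBr !compBl eR eL addrA; congr (_ - _).
rewrite [X in _ - X + _](_ : _ = fmap A (fmap B2 (b1C M)) \oc
  braidR aB2 cAC b2C (B1 M) \oc fmap C (fmap B2 (aB1 M))); first by rewrite subrK.
rewrite /braidR /braidL !fmap_comp -!compA (preR (cross_nat aB2 (b1C M))).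
by rewrite cross_nat.
Qed.

Lemma defectR A B C1 C2 (cAB : cross A B) (aC1 : cross A C1) (aC2 : cross A C2)
    (bC1 : cross B C1) (bC2 : cross B C2) M :
  defect cAB (crossR aC1 aC2) (crossR bC1 bC2) M =
  defect cAB aC2 bC2 (C1 M) \oc fmap C2 (fmap B (aC1 M) \oc bC1 (A M)) +
  fmap A (bC2 (C1 M)) \oc aC2 (B (C1 M)) \oc fmap C2 (defect cAB aC1 bC1 M).
Proof.
have eR : braidR cAB (crossR aC1 aC2) (crossR bC1 bC2) M =
    braidR cAB aC2 bC2 (C1 M) \oc fmap C2 (fmap B (aC1 M) \oc bC1 (A M)).
  rewrite /braidR /= !fmap_comp -!compA.
  by rewrite (preR (cross_nat bC2 (aC1 M))).
have eL : braidL cAB (crossR aC1 aC2) (crossR bC1 bC2) M =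
    fmap A (bC2 (C1 M)) \oc aC2 (B (C1 M)) \oc fmap C2 (braidL cAB aC1 bC1 M).
  rewrite /braidL /= !fmap_comp -!compA.
  by rewrite (preR (cross_nat aC2 (bC1 M))).
rewrite /defect linearB !compBr !compBl eR eL addrA; congr (_ - _).
rewrite [X in _ - X + _](_ : _ = fmap A (bC2 (C1 M)) \oc aC2 (B (C1 M)) \oc
  fmap C2 (braidR cAB aC1 bC1 M)); first by rewrite subrK.
by rewrite /braidR /braidL !fmap_comp -!compA.
Qed.
End Crossings.

(** * The crossing of two pairs *)

Section PairStrand.
Variables (k : fieldType) (D : linCat k) (F1 F2 : functor D D).
Variables (x1 : nattrans F1 F1) (x2 : nattrans F2 F2).
Variables (c11 : cross F1 F1) (c12 : cross F1 F2).
Variables (c21 : cross F2 F1) (c22 : cross F2 F2).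
Local Notation P := (compF F2 F1).

Hypothesis sq11 : forall M, c11 M \oc c11 M = 0.
Hypothesis sq22 : forall M, c22 M \oc c22 M = 0.
Hypothesis sq12 : forall M, c21 M \oc c12 M = x2 (F1 M) - fmap F2 (x1 M).
Hypothesis slide11_in : forall M,
  c11 M \oc x1 (F1 M) = fmap F1 (x1 M) \oc c11 M + idm _.
Hypothesis slide11_out : forall M,
  x1 (F1 M) \oc c11 M = c11 M \oc fmap F1 (x1 M) + idm _.
Hypothesis slide22_in : forall M,
  c22 M \oc x2 (F2 M) = fmap F2 (x2 M) \oc c22 M + idm _.
Hypothesis slide21_in : forall M,
  c21 M \oc x1 (F2 M) = fmap F2 (x1 M) \oc c21 M.
Hypothesis slide12_out : forall M,
  x1 (F2 M) \oc c12 M = c12 M \oc fmap F2 (x1 M).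
Hypothesis defect121 : forall M, defect c12 c11 c21 M = - idm _.
Hypothesis defect212 : forall M, defect c21 c22 c12 M = idm _.

Definition pair_cross : cross P P := crossL (crossR c11 c12) (crossR c21 c22).

(** [braidR] begins with [c12], which lands in F1 (F2 (F2 M)) = 0, so the whole defect is carried by
    [braidL]. *)
Lemma braidL212 M : idm (F2 (F2 M)) = 0 ->
  braidL c21 c22 c12 M = - idm (F2 (F1 (F2 M))).
Proof.
move=> M0; have /eqP := defect212 M; rewrite /defect /braidR.
rewrite [c12 _](zero_cod _ (fmap_zero F1 M0)) !compm0 sub0r => /eqP <-.
by rewrite opprK.
Qed.

Lemma braidR121 M : idm (F2 M) = 0 ->
  braidR c12 c11 c21 M = - idm (F1 (F2 (F1 M))).
Proof.
move=> M0; have /eqP := defect121 M; rewrite /defect /braidL.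
rewrite [c12 M](zero_cod _ (fmap_zero F1 M0)) linear0 !compm0 subr0.
by move/eqP.
Qed.

(* Since c21 c12 = x2 - x1, the two dots on a pair agree where F2 vanishes. *)
Lemma pair_dot M : idm (F2 M) = 0 -> x2 (F1 M) = fmap F2 (x1 M).
Proof.
move=> M0; apply/eqP; rewrite -subr_eq0 -sq12.
by rewrite [c12 M](zero_cod _ (fmap_zero F1 M0)) compm0.
Qed.

(** The dot on strand 1 passes [c12] freely and meets an equal letter only at [c11]. The correction
    erases that crossing, and the three remaining ones form a braid 212. *)
Lemma pair_slide_out M :
  fmap F2 (x1 (P M)) \oc pair_cross M =
  pair_cross M \oc fmap P (fmap F2 (x1 M)) + braidL c21 c22 c12 (F1 M).
Proof.
rewrite /pair_cross /braidL /= !fmap_comp -!compA.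
rewrite fmap_compA slide12_out fmap_comp -!compA.
rewrite [fmap F2 (fmap F2 (x1 _)) \oc _]fmap_compA -[fmap F2 (x1 _) \oc _]fmap_comp.
rewrite slide11_out !linearD /= !fmap_id compDl comp1m compDr; congr (_ + _).
rewrite !fmap_comp -!compA -(preR (cross_nat c22 _)); congr (_ \oc (_ \oc _)).
by rewrite -!fmap_comp cross_nat.
Qed.

Lemma pair_slide_in M :
  pair_cross M \oc fmap F2 (x1 (P M)) =
  fmap P (fmap F2 (x1 M)) \oc pair_cross M + braidL c21 c22 c12 (F1 M).
Proof.
rewrite /pair_cross /braidL /= !fmap_comp -!compA.
rewrite -fmap_comp slide21_in fmap_comp (preR (cross_nat c22 _)).
rewrite [fmap F2 (fmap F2 (c11 M)) \oc _]fmap_compA -fmap_comp.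
rewrite slide11_in linearD /= linearD /= !fmap_comp !fmap_id compDl comp1m compDr.
congr (_ + _); rewrite -!compA ![fmap F2 (c12 _) \oc (_ \oc _)]fmap_compA.
by rewrite cross_nat !fmap_comp -!compA.
Qed.

(** In the middle of the square stands c21 c12 = x2 - x1. In the x1 term the two [c22] become
    adjacent; in the x2 term c22 x2 c22 = - c22, after which the two [c11] become adjacent. Both
    terms vanish. *)
Lemma pair_square M : pair_cross M \oc pair_cross M = 0.
Proof.
have c22_dot N : c22 N \oc (fmap F2 (x2 N) \oc c22 N) = - c22 N.
  have -> : fmap F2 (x2 N) \oc c22 N = c22 N \oc x2 (F2 N) - idm _.
    by rewrite slide22_in addrK.
  by rewrite compBr compA sq22 comp0m sub0r compm1.
have z22 N W (r : hom W _) : c22 N \oc (c22 N \oc r) = 0.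
  by rewrite compA sq22 comp0m.
have z11 N W (r : hom W _) :
    fmap F2 (fmap F2 (c11 N)) \oc (fmap F2 (fmap F2 (c11 N)) \oc r) = 0.
  by rewrite compA -!fmap_comp sq11 !linear0 comp0m.
rewrite /pair_cross /= !fmap_comp -!compA.
rewrite [fmap F2 (c21 _) \oc (_ \oc _)]fmap_compA sq12 linearB /= compBl compBr.
rewrite -!(preR (cross_nat c22 (c11 M))) -(preR (cross_nat c22 (x1 _))) z22 subr0.
rewrite [X in _ \oc (_ \oc X)](_ : _ = - (c22 (F1 (F1 M)) \oc
  (fmap F2 (fmap F2 (c11 M)) \oc fmap F2 (c21 (F1 M))))); last first.
  by rewrite -compNl -c22_dot -!compA.
by rewrite (preR (cross_nat c22 (c11 M))) !compNr z11 compm0 oppr0.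
Qed.

Section Pass.
Variables (A : functor D D) (c1a : cross F1 A) (c2a : cross F2 A).
Variables (ca1 : cross A F1) (ca2 : cross A F2) (g1 g2 : k).
Hypothesis defect1a1 : forall M, defect c1a c11 ca1 M = g1 *: idm _.
Hypothesis defect2a2 : forall M, defect c2a c22 ca2 M = g2 *: idm _.
Hypothesis defect1a2 : forall M, defect c1a c12 ca2 M = 0.
Hypothesis defect2a1 : forall M, defect c2a c21 ca1 M = 0.

(* Only the triple points (1, a, 1) and (2, a, 2) contribute; resolving them
   leaves one of the braids 121 and 212 surrounded by two crossings with a. *)
Lemma pair_defect M :
  defect (crossL c1a c2a) pair_cross (crossR ca1 ca2) M =
  g2 *: fmap F2 (c1a (P M) \oc
    (fmap A (braidR c12 c11 c21 M) \oc ca1 (P M))) +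
  g1 *: (fmap P (ca2 (F1 M)) \oc
    (braidL c21 c22 c12 (A (F1 M)) \oc fmap P (c2a (F1 M)))).
Proof.
rewrite /pair_cross defectL !defectR defect2a2 defect1a1 defect1a2 defect2a1.
rewrite linear0 compm0 addr0 comp0m add0r !compZl comp1m !compZr.
congr (_ *: _ + _).
  by rewrite /braidR /= !fmap_comp -!compA.
rewrite linearZ /= fmap_id compZr linearZ /= !compZl compm1; congr (_ *: _).
by rewrite /braidL /= !fmap_comp -!compA.
Qed.

(** Once the braids 121 and 212 are replaced by -1, the surrounding crossings with [a] close up to
    squares. Each alternative in the hypotheses either drops its term or makes that replacement
    available. *)
Lemma pair_defect_square M :
  g2 = 0 \/ idm (F2 M) = 0 -> g1 = 0 \/ idm (F2 (F2 (A (F1 M)))) = 0 ->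
  defect (crossL c1a c2a) pair_cross (crossR ca1 ca2) M =
  - (g2 *: fmap F2 (c1a (P M) \oc ca1 (P M)) +
     g1 *: fmap P (ca2 (F1 M) \oc c2a (F1 M))).
Proof.
move=> h2 h1; rewrite pair_defect opprD -!scalerN; congr (_ + _).
  case: h2 => [->|h2]; first by rewrite !scale0r.
  by rewrite braidR121 // !(scalerN, linearN, compNl, compNr) fmap_id comp1m.
case: h1 => [->|h1]; first by rewrite !scale0r.
by rewrite braidL212 // compNl comp1m compNr -fmap_comp.
Qed.

Variables (caa : cross A A) (h1 h2 : k).
Hypothesis defecta1a : forall M, defect ca1 caa c1a M = h1 *: idm _.
Hypothesis defecta2a : forall M, defect ca2 caa c2a M = h2 *: idm _.

(** A correction on one strand of the pair leaves the other strand crossing [a] twice, hence a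
    square. *)
Lemma pair_middle_defect M :
  defect (crossR ca1 ca2) caa (crossL c1a c2a) M =
  h1 *: (ca2 (F1 (A M)) \oc c2a (F1 (A M))) +
  h2 *: fmap A (fmap F2 (c1a M \oc ca1 M)).
Proof.
rewrite defectM defecta1a defecta2a linearZ /= fmap_id compZr compZl compm1.
by rewrite compZr compm1 compZl -!fmap_comp.
Qed.
End Pass.
End PairStrand.

(** * KLR relations for a family of functors *)

(** An alias of [hom X X] that carries the ring structure in which [Qpoly] and [Qdiff] are evaluated
    at the dots. *)
Definition endo (k : fieldType) (C : linCat k) (X : C) : Type := hom X X.

Section EndoRing.
Variables (k : fieldType) (C : linCat k) (X : C).
Implicit Types u v w : endo X.

HB.instance Definition _ := GRing.Lmodule.on (endo X).

Fact endo_mulA : associative (fun u v : endo X => u \oc v : endo X).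
Proof. by move=> u v w; apply: compA. Qed.
Fact endo_mul1l : left_id (idm X : endo X) (fun u v : endo X => u \oc v : endo X).
Proof. by move=> u; apply: comp1m. Qed.
Fact endo_mul1r : right_id (idm X : endo X) (fun u v : endo X => u \oc v : endo X).
Proof. by move=> u; apply: compm1. Qed.
Fact endo_mulDl :
  left_distributive (fun u v : endo X => u \oc v : endo X) +%R.
Proof. by move=> u v w; apply: compDl. Qed.
Fact endo_mulDr :
  right_distributive (fun u v : endo X => u \oc v : endo X) +%R.
Proof. by move=> u v w; apply: compDr. Qed.

HB.instance Definition _ := GRing.Zmodule_isPzRing.Build (endo X)
  endo_mulA endo_mul1l endo_mul1r endo_mulDl endo_mulDr.

Lemma endoM u v : u * v = u \oc v. Proof. by []. Qed.
Lemma endo1 : 1 = idm X :> endo X. Proof. by []. Qed.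
End EndoRing.

Section FunctorEndo.
Variables (k : fieldType) (C D : linCat k).

Section Fmap.
Variables (F : functor C D) (X : C).

Definition fmap_endo (u : endo X) : endo (F X) := fmap F u.

Fact fmap_endo_zmod : zmod_morphism fmap_endo.
Proof. by move=> u v; apply: (linearB (fmap F)). Qed.
HB.instance Definition _ :=
  GRing.isZmodMorphism.Build (endo X) (endo (F X)) fmap_endo fmap_endo_zmod.

Fact fmap_endo_monoid : monoid_morphism fmap_endo.
Proof. by split=> [|u v]; [apply: fmap_id | apply: fmap_comp]. Qed.
HB.instance Definition _ :=
  GRing.isMonoidMorphism.Build (endo X) (endo (F X)) fmap_endo fmap_endo_monoid.
End Fmap.

End FunctorEndo.

Section QMorphism.
Variables (A B : pzRingType) (m : nat) (i j : 'I_m).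

Lemma Qpoly_morph (f : {rmorphism A -> B}) u v :
  f (Qpoly i j u v) = Qpoly i j (f u) (f v).
Proof.
rewrite /Qpoly; case: ifP => _; first exact: rmorph0.
by rewrite rmorphM !rmorphXn !rmorphB.
Qed.

Lemma Qdiff_morph (f : {rmorphism A -> B}) u v w :
  f (Qdiff i j u v w) = Qdiff i j (f u) (f v) (f w).
Proof.
rewrite /Qdiff; case: ifP => _; first exact: rmorph0.
rewrite rmorphM rmorphXn rmorphN1 rmorph_sum; congr (_ * _).
by apply: eq_bigr => s _; rewrite rmorphM !rmorphXn !rmorphB.
Qed.
End QMorphism.

Lemma fmap_Qpoly (k : fieldType) (C D : linCat k) (F : functor C D) (X : C) m
    (i j : 'I_m) (u v : endo X) :
  fmap F (Qpoly i j u v : endo X) =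
  Qpoly i j (fmap F u : endo (F X)) (fmap F v : endo (F X)).
Proof. exact: (Qpoly_morph i j (fmap_endo F (X := X))). Qed.

Section Intertwine.
Variables (k : fieldType) (C : linCat k) (X Y : C) (f : hom X Y).

Lemma intertwineX (u : endo X) (u' : endo Y) n :
  u' \oc f = f \oc u -> (u' ^+ n : endo Y) \oc f = f \oc (u ^+ n : endo X).
Proof.
move=> E; elim: n => [|n IH]; first by rewrite !expr0 !endo1 comp1m compm1.
by rewrite !exprS !endoM -compA IH !compA E.
Qed.

Lemma intertwine_Qpoly m (i j : 'I_m) (u v : endo X) (u' v' : endo Y) :
  u' \oc f = f \oc u -> v' \oc f = f \oc v ->
  (Qpoly i j u' v' : endo Y) \oc f = f \oc (Qpoly i j u v : endo X).
Proof.
move=> eu ev; rewrite /Qpoly; case: ifP => _; first by rewrite comp0m compm0.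
rewrite !endoM -compA (intertwineX _ (u := u - v)).
  by rewrite !compA (intertwineX _ (u := v - u)) // compBl compBr eu ev.
by rewrite compBl compBr eu ev.
Qed.

Lemma intertwine_Qdiff m (i j : 'I_m) (u v w : endo X) (u' v' w' : endo Y) :
  u' \oc f = f \oc u -> v' \oc f = f \oc v -> w' \oc f = f \oc w ->
  (Qdiff i j u' v' w' : endo Y) \oc f = f \oc (Qdiff i j u v w : endo X).
Proof.
move=> eu ev ew; rewrite /Qdiff; case: ifP => _; first by rewrite comp0m compm0.
have em : (-1 : endo Y) \oc f = f \oc (-1 : endo X).
  by rewrite compNl compNr endo1 comp1m compm1.
rewrite !endoM -compA comp_suml [RHS]compA -(intertwineX _ em) -[RHS]compA.
congr comp; rewrite comp_sumr; apply: eq_bigr => s _.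
rewrite !endoM -compA (intertwineX _ (u := u - v)).
  by rewrite !compA (intertwineX _ (u := w - v)) // compBl compBr ew ev.
by rewrite compBl compBr eu ev.
Qed.
End Intertwine.

(* t i j crosses the word (i, j), of value F_j F_i; on F_j (F_i M) the dot x_1 is
   fmap (Fi j) (x i M) and x_2 is x j (Fi i M). The relations whose two sides
   have the same type only for equal letters are stated separately, so that no
   casts occur. *)
Record klr_rels (k : fieldType) (D : linCat k) m (Fi : 'I_m -> functor D D)
    (P : D -> Prop) (x : forall i, nattrans (Fi i) (Fi i))
    (t : forall i j, cross (Fi i) (Fi j)) : Prop := KlrRels {
  rel_slide_in : forall i j M, P M -> i != j ->
    t i j M \oc x j (Fi i M) = fmap (Fi i) (x j M) \oc t i j M;
  rel_slide_out : forall i j M, P M -> i != j ->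
    x i (Fi j M) \oc t i j M = t i j M \oc fmap (Fi j) (x i M);
  rel_slide_in_eq : forall i M, P M ->
    t i i M \oc x i (Fi i M) = fmap (Fi i) (x i M) \oc t i i M + idm _;
  rel_slide_out_eq : forall i M, P M ->
    x i (Fi i M) \oc t i i M = t i i M \oc fmap (Fi i) (x i M) + idm _;
  rel_square : forall i j M, P M -> t j i M \oc t i j M =
    Qpoly i j (fmap (Fi j) (x i M) : endo (Fi j (Fi i M))) (x j (Fi i M));
  rel_braid : forall i j l M, P M -> i != l ->
    defect (t i j) (t i l) (t j l) M = 0;
  rel_braid_eq : forall i j M, P M -> defect (t i j) (t i i) (t j i) M =
    Qdiff i j (fmap (Fi i) (fmap (Fi j) (x i M)) : endo (Fi i (Fi j (Fi i M))))
      (fmap (Fi i) (x j (Fi i M))) (x i (Fi j (Fi i M)))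
}.

Lemma val_ordS n (i : 'I_n) :
  ordS i = (if i.+1 == n then 0 else i.+1) :> nat.
Proof.
rewrite /=; case: ifP => [/eqP->|h]; first by rewrite modnn.
by rewrite modn_small // ltn_neqAle h ltn_ord.
Qed.

Lemma nb_arrowsE n (i j : 'I_n) : nb_arrows i j =
  ((j == i.+1 :> nat) || (i.+1 == n) && (j == 0 :> nat)) :> nat.
Proof.
rewrite /nb_arrows -val_eqE; change (val (ordS i)) with (nat_of_ord (ordS i)).
rewrite val_ordS; congr nat_of_bool; change (val j) with (nat_of_ord j).
case: (i.+1 =P n) => [E|_] /=; last by rewrite orbF.
by rewrite E (ltn_eqF (ltn_ord j)).
Qed.

Lemma nb_arrows_le1 n (i j : 'I_n) : (2 < n)%N ->
  (nb_arrows i j + nb_arrows j i <= 1)%N.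
Proof.
by move=> n2; rewrite !nb_arrowsE; have := ltn_ord i; have := ltn_ord j; lia.
Qed.

(** * Contraction of one arrow of the cyclic quiver *)

Section Arrows.
Variables (e : nat) (l : 'I_e).
Local Notation b1 := (low l).
Local Notation b2 := (up l).

Definition is_single (a : 'I_e.+1) := (a != b1) && (a != b2).

Lemma val_up : up l = l.+1 :> nat.
Proof. by rewrite /= /bump add1n. Qed.

Lemma is_singleE a : is_single a = (a != l :> nat) && (a != l.+1 :> nat).
Proof. by rewrite /is_single -!val_eqE [val b2]val_up. Qed.

(** The only arrow out of [b1] ends at [b2], and it is the only arrow into [b2]. *)
Lemma nb_arrows_single a : is_single a ->
  nb_arrows b1 a = 0%N /\ nb_arrows a b2 = 0%N.
Proof.
rewrite is_singleE => sa; have := ltn_ord l; have := ltn_ord a.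
by rewrite !nb_arrowsE val_up /= => lt_a lt_l; split; lia.
Qed.

Lemma pair_neq : b1 != b2.
Proof. by rewrite -val_eqE [val b2]val_up neq_ltn ltnSn. Qed.

(* The letter l is spelled by the pair (b1, b2), written None. *)
Definition code (i : 'I_e) : option 'I_e.+1 :=
  if (i < l)%N then Some (low i) else if i == l then None else Some (up i).

Definition code_valid (p : option 'I_e.+1) :=
  if p is Some a then is_single a else true.

Variant code_spec (i : 'I_e) : option 'I_e.+1 -> Prop :=
| CodePair of i = l : code_spec i None
| CodeSingle (a : 'I_e.+1) of (i != l :> nat) &
    a = (if (i < l)%N then i : nat else i.+1) :> nat : code_spec i (Some a).

Lemma codeP i : code_spec i (code i).
Proof.
rewrite /code; case: ltnP => il; first by constructor; rewrite ?il // neq_ltn il.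
case: eqVneq => [->|il']; first by constructor.
by constructor; rewrite ?ltnNge ?il //= /bump add1n.
Qed.

Lemma code_validP i : code_valid (code i).
Proof.
case: codeP => // a il; rewrite /code_valid is_singleE.
by case: ltnP => h ->; lia.
Qed.

Lemma code_inj : injective code.
Proof.
move=> i j; case: codeP => [->|a il ea]; case: codeP => [->|b jl eb] // [ab].
apply: val_inj; move: ea eb; rewrite ab => -> /=.
by do 2!case: ltnP => ?; lia.
Qed.

Hypothesis e1 : (1 < e)%N.

(** The cycle has e + 1 > 2 vertices, so the arrow from [b1] to [b2] has no companion in the other
    direction. *)
Lemma nb_arrows_pair : nb_arrows b1 b2 = 1%N /\ nb_arrows b2 b1 = 0%N.
Proof.
have := ltn_ord l; rewrite !nb_arrowsE val_up /= => lt_l; split; lia.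
Qed.

(** Contracting the arrow from [b1] to [b2] turns the cycle with e + 1 vertices into the cycle with
    e vertices: arrows leave the merged vertex from [b2] and enter it at [b1]. *)
Lemma nb_arrows_code i j :
  match code i, code j with
  | None, None => True
  | None, Some b => nb_arrows i j = nb_arrows b2 b
  | Some a, None => nb_arrows i j = nb_arrows a b1
  | Some a, Some b => nb_arrows i j = nb_arrows a b
  end.
Proof.
have := e1; have := ltn_ord i; have := ltn_ord j; have := ltn_ord l.
case: codeP => [->|a il ea]; case: codeP => [->|b jl eb] //;
  rewrite !nb_arrowsE ?val_up ?ea ?eb /=.
- by case: (ltnP j l) => ?; lia.
- by case: (ltnP i l) => ?; lia.
- by case: (ltnP i l) => ?; case: (ltnP j l) => ?; lia.
Qed.
End Arrows.

(** * Polynomials of the contracted quiver *)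

Section PairPolynomials.
Variables (k : fieldType) (D : linCat k) (X : D).
Variables (e : nat) (l : 'I_e).
Hypothesis e1 : (1 < e)%N.
Local Notation b1 := (low l).
Local Notation b2 := (up l).
Local Notation code := (code l).
Implicit Types u v w : endo X.

(* The value of the constant Qdiff i j when at most one arrow joins i and j. *)
Definition gamma n (i j : 'I_n) : k :=
  if i == j then 0
  else (-1) ^+ nb_arrows i j * (nb_arrows i j + nb_arrows j i)%:R.

Lemma Qdiff_gamma n (i j : 'I_n) u v w : (2 < n)%N ->
  Qdiff i j u v w = gamma i j *: (1 : endo X).
Proof.
move=> /(nb_arrows_le1 i j); rewrite /Qdiff /gamma; case: ifP => _.
  by rewrite scale0r.
rewrite /nb_arrows; case: (j == _); case: (i == _) => //= _;
  rewrite ?big_ord0 ?big_ord1 ?expr0 ?expr1 ?mulr1 ?mulr0 ?scale0r ?mul1r;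
  rewrite ?scale1r //.
by rewrite scaleN1r.
Qed.

Section Pair.
Variables (i j : 'I_e) (a : 'I_e.+1).
Hypotheses (ci : code i = None) (cj : code j = Some a).

Let arrows : [/\ nb_arrows i j = nb_arrows b2 a, nb_arrows j i = nb_arrows a b1,
  nb_arrows b1 a = 0%N & nb_arrows a b2 = 0%N] /\
  [/\ (i == j) = false, (a == b1) = false & (a == b2) = false].
Proof.
have := nb_arrows_code l e1 i j; have := nb_arrows_code l e1 j i.
rewrite ci cj => -> ->; have := code_validP l j; rewrite cj /= => sa.
have [-> ->] := nb_arrows_single sa; split=> //.
have /andP[/negPf-> /negPf->] := sa; split=> //.
by apply/eqP => ij; move: ci; rewrite ij cj.
Qed.

Let nij : (i == j) = false. Proof. by case: arrows => _ []. Qed.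
Let nji : (j == i) = false. Proof. by rewrite eq_sym. Qed.
Let na1 : (a == b1) = false. Proof. by case: arrows => _ []. Qed.
Let n1a : (b1 == a) = false. Proof. by rewrite eq_sym. Qed.
Let na2 : (a == b2) = false. Proof. by case: arrows => _ []. Qed.
Let n2a : (b2 == a) = false. Proof. by rewrite eq_sym. Qed.
Let nE := (nij, nji, na1, n1a, na2, n2a).

Lemma Qpoly_pairL u v : Qpoly i j u v = Qpoly b2 a u v * Qpoly b1 a u v.
Proof.
have [[ij ji a1 a2] _] := arrows.
by rewrite /Qpoly !nE ij ji a1 a2 !expr0 mulr1 mul1r.
Qed.

Lemma Qpoly_pairR u v : Qpoly j i u v = Qpoly a b1 u v * Qpoly a b2 u v.
Proof.
have [[ij ji a1 a2] _] := arrows.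
by rewrite /Qpoly !nE ij ji a1 a2 !expr0 mulr1 mul1r.
Qed.

(** The Leibniz rule for the divided difference of the product in [Qpoly_pairL], with the divided
    differences of the factors equal to the constants [gamma], and with Q_1a(w, v) = Q_a1(v, w). It
    is checked on the four patterns of arrows. *)
Lemma Qdiff_pairL u v w : Qdiff i j u v w =
  gamma b2 a *: Qpoly a b1 v w + gamma b1 a *: Qpoly b2 a u v.
Proof.
have [[ij ji a1 a2] _] := arrows.
rewrite /Qdiff /Qpoly /gamma !nE ij ji a1 a2 !expr0 !(mulr1, mul1r, addn0, add0n).
rewrite /nb_arrows; case: (a == _); case: (b1 == _) => /=;
rewrite ?big_ord0 ?big_ord_recr ?big_ord0 /= ?expr0 ?expr1;
rewrite !(mulr1, mulr0, mul1r, scale0r, scale1r, scaleN1r, addr0, add0r) //.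
(* Arrows in both directions between [i] and [j]: this is the case e = 2, where [Qdiff] is not
   constant. *)
by rewrite mulN1r opprD [- (u - v)]opprB.
Qed.

Lemma Qdiff_pairR u v w : Qdiff j i u v w =
  gamma a b1 *: Qpoly b2 a v w + gamma a b2 *: Qpoly a b1 u v.
Proof.
have [[ij ji a1 a2] _] := arrows.
rewrite /Qdiff /Qpoly /gamma !nE ij ji a1 a2 !expr0 !(mulr1, mul1r, addn0, add0n).
rewrite /nb_arrows; case: (a == _); case: (b1 == _) => /=;
rewrite ?big_ord0 ?big_ord_recr ?big_ord0 /= ?expr0 ?expr1;
rewrite !(mulr1, mulr0, mul1r, scale0r, scale1r, scaleN1r, addr0, add0r) //.
by rewrite mulN1r opprD [- (u - v)]opprB.
Qed.
End Pair.

Section Singles.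
Variables (A : pzRingType) (i j : 'I_e) (a b : 'I_e.+1).
Hypotheses (ci : code i = Some a) (cj : code j = Some b).

Lemma code_single_eq : (i == j) = (a == b).
Proof.
have <- : (code i == code j) = (a == b) by rewrite ci cj.
by apply/esym/inj_eq/code_inj.
Qed.

Let arrows : nb_arrows i j = nb_arrows a b /\ nb_arrows j i = nb_arrows b a.
Proof.
have := nb_arrows_code l e1 i j; have := nb_arrows_code l e1 j i.
by rewrite ci cj => -> ->.
Qed.

Lemma Qpoly_single (u v : A) : Qpoly i j u v = Qpoly a b u v.
Proof. by rewrite /Qpoly code_single_eq; case: arrows => -> ->. Qed.

Lemma Qdiff_single (u v w : A) : Qdiff i j u v w = Qdiff a b u v w.
Proof. by rewrite /Qdiff code_single_eq; case: arrows => -> ->. Qed.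
End Singles.
End PairPolynomials.

(** * The merged family *)

Section MergedRelations.
Variables (k : fieldType) (D : linCat k) (e : nat) (l : 'I_e).
Hypothesis e1 : (1 < e)%N.
Variables (Fb : 'I_e.+1 -> functor D D) (x : forall i, nattrans (Fb i) (Fb i)).
Variable t : forall i j, cross (Fb i) (Fb j).
Hypothesis rels : klr_rels (fun=> True) x t.
Local Notation b1 := (low l).
Local Notation b2 := (up l).
Local Notation F1 := (Fb b1).
Local Notation F2 := (Fb b2).

Definition merged_functor (p : option 'I_e.+1) : functor D D :=
  if p is Some a then Fb a else compF F2 F1.
Local Notation G := merged_functor.

Variable P : D -> Prop.
Hypothesis P_stable : forall p M, code_valid l p -> P M -> P (G p M).
Hypothesis F2_zero : forall M, P M -> idm (F2 M) = 0.
Hypothesis F22_zero : forall M a, P M -> is_single l a ->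
  idm (F2 (F2 (Fb a (F1 M)))) = 0.
Hypothesis F222_zero : forall M, P M -> idm (F2 (F2 (F2 (F1 (F1 M))))) = 0.

(** The dot of a pair is put on strand 1; at objects of [P] it agrees with the dot on strand 2, by
    [dots]. *)
Definition pair_x_comp M : hom (G None M) (G None M) := fmap F2 (x b1 M).
Fact pair_x_nat M N (f : hom M N) :
  pair_x_comp N \oc fmap (G None) f = fmap (G None) f \oc pair_x_comp M.
Proof. by rewrite /= -!fmap_comp (natural (x b1)). Qed.
Definition pair_x : nattrans (G None) (G None) := NatTrans pair_x_nat.

Definition merged_x p : nattrans (G p) (G p) :=
  if p is Some a then x a else pair_x.

Local Notation cpp := (pair_cross (t b1 b1) (t b1 b2) (t b2 b1) (t b2 b2)).

(* By braidL212 the crossing of two pairs slides dots with correction -1, whence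
   the sign. *)
Definition merged_t p q : cross (G p) (G q) :=
  match p, q return cross (G p) (G q) with
  | Some a, Some b => t a b
  | Some a, None => crossR (t a b1) (t a b2)
  | None, Some b => crossL (t b1 b) (t b2 b)
  | None, None => - cpp
  end.

Local Notation cL a := (crossL (t b1 a) (t b2 a)).

Let b12 : b1 != b2 := pair_neq l.
Let b21 : b2 != b1. Proof. by rewrite eq_sym. Qed.
Let e2 : (2 < e.+1)%N := e1.

Let single1 a : is_single l a -> a != b1. Proof. by case/andP. Qed.
Let single2 a : is_single l a -> a != b2. Proof. by case/andP. Qed.
Let single1' a : is_single l a -> b1 != a. Proof. by rewrite eq_sym => /andP[]. Qed.
Let single2' a : is_single l a -> b2 != a.
Proof. by rewrite eq_sym => /andP[]. Qed.

Let slide_in (a b : 'I_e.+1) M : a != b ->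
  t a b M \oc x b (Fb a M) = fmap (Fb a) (x b M) \oc t a b M.
Proof. exact: (rel_slide_in rels I). Qed.
Let slide_out (a b : 'I_e.+1) M : a != b ->
  x a (Fb b M) \oc t a b M = t a b M \oc fmap (Fb b) (x a M).
Proof. exact: (rel_slide_out rels I). Qed.
Let slide_in_eq (a : 'I_e.+1) M :
  t a a M \oc x a (Fb a M) = fmap (Fb a) (x a M) \oc t a a M + idm _.
Proof. exact: (rel_slide_in_eq rels _ I). Qed.
Let slide_out_eq (a : 'I_e.+1) M :
  x a (Fb a M) \oc t a a M = t a a M \oc fmap (Fb a) (x a M) + idm _.
Proof. exact: (rel_slide_out_eq rels _ I). Qed.
Let square (a b : 'I_e.+1) M : t b a M \oc t a b M =
  Qpoly a b (fmap (Fb b) (x a M) : endo (Fb b (Fb a M))) (x b (Fb a M)).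
Proof. exact: (rel_square rels _ _ I). Qed.
Let square_eq (a : 'I_e.+1) M : t a a M \oc t a a M = 0.
Proof. by rewrite square /Qpoly eqxx. Qed.
Let square12 M : t b2 b1 M \oc t b1 b2 M = x b2 (F1 M) - fmap F2 (x b1 M).
Proof.
rewrite square /Qpoly (negPf b12); have [-> ->] := nb_arrows_pair l e1.
by rewrite expr0 mulr1 expr1.
Qed.
Let braid (a b c : 'I_e.+1) M : a != c -> defect (t a b) (t a c) (t b c) M = 0.
Proof. exact: (rel_braid rels _ I). Qed.
Let braid_eq (a b : 'I_e.+1) M :
  defect (t a b) (t a a) (t b a) M = gamma k a b *: idm _.
Proof. by rewrite (rel_braid_eq rels _ _ I) (Qdiff_gamma _ _ _ _ _ e2). Qed.

Let gamma12 : gamma k b1 b2 = -1.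
Proof.
rewrite /gamma (negPf b12); have [-> ->] := nb_arrows_pair l e1.
by rewrite mulr1.
Qed.
Let gamma21 : gamma k b2 b1 = 1.
Proof.
rewrite /gamma (negPf b21); have [-> ->] := nb_arrows_pair l e1.
by rewrite mulr1.
Qed.
Let gamma_eq (a : 'I_e.+1) : gamma k a a = 0. Proof. by rewrite /gamma eqxx. Qed.
Let braid121 M : defect (t b1 b2) (t b1 b1) (t b2 b1) M = - idm _.
Proof. by rewrite braid_eq gamma12 scaleN1r. Qed.
Let braid212 M : defect (t b2 b1) (t b2 b2) (t b1 b2) M = idm _.
Proof. by rewrite braid_eq gamma21 scale1r. Qed.

Let dots M : P M -> x b2 (F1 M) = fmap F2 (x b1 M).
Proof. by move=> PM; apply: (pair_dot square12); apply: F2_zero. Qed.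

Let P_fb a M : is_single l a -> P M -> P (Fb a M).
Proof. exact: (P_stable (p := Some a)). Qed.
Let P_pair M : P M -> P (F2 (F1 M)).
Proof. exact: (P_stable (p := None)). Qed.

Lemma merged_slide_in p q M : code_valid l p -> code_valid l q -> P M -> p != q ->
  merged_t p q M \oc merged_x q (G p M) =
  fmap (G p) (merged_x q M) \oc merged_t p q M.
Proof.
case: p q => [a|] [b|] //= sa sb PM ab.
- exact: slide_in.
- rewrite -compA -fmap_comp slide_in ?single1 // fmap_comp compA.
  by rewrite /pair_x_comp (cross_nat (t a b2)) compA.
- rewrite -compA slide_in ?single2' // !compA -!fmap_comp.
  by rewrite slide_in ?single1'.
Qed.

Lemma merged_slide_out p q M : code_valid l p -> code_valid l q -> P M -> p != q ->
  merged_x p (G q M) \oc merged_t p q M =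
  merged_t p q M \oc fmap (G q) (merged_x p M).
Proof.
case: p q => [a|] [b|] //= sa sb PM ab.
- exact: slide_out.
- rewrite compA slide_out ?single2 // -!compA -!fmap_comp.
  by rewrite slide_out ?single1.
- rewrite /pair_x_comp compA -fmap_comp slide_out ?single1' // fmap_comp -!compA.
  by rewrite (cross_nat (t b2 b)).
Qed.

Let L212 M : P M ->
  braidL (t b2 b1) (t b2 b2) (t b1 b2) (F1 M) = - idm (F2 (F1 (F2 (F1 M)))).
Proof.
by move=> PM; apply: (braidL212 braid212); apply/F2_zero/P_pair.
Qed.

Lemma merged_slide_in_eq p M : code_valid l p -> P M ->
  merged_t p p M \oc merged_x p (G p M) =
  fmap (G p) (merged_x p M) \oc merged_t p p M + idm _.
Proof.
case: p => [a|] sa PM; first exact: slide_in_eq.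
have E := pair_slide_in (t b1 b2) (t b2 b2) (slide_in_eq b1)
  (fun M => slide_in M b21) M.
by rewrite [merged_t _ _]/= ntN compNl compNr E L212 // opprD opprK.
Qed.

Lemma merged_slide_out_eq p M : code_valid l p -> P M ->
  merged_x p (G p M) \oc merged_t p p M =
  merged_t p p M \oc fmap (G p) (merged_x p M) + idm _.
Proof.
case: p => [a|] sa PM; first exact: slide_out_eq.
have E := pair_slide_out (t b2 b1) (t b2 b2) (slide_out_eq b1)
  (fun M => slide_out M b12) M.
by rewrite [merged_t _ _]/= ntN compNl compNr E L212 // opprD opprK.
Qed.

Local Notation code := (code l).

(** When a pair crosses a single strand twice, the square of one strand of the pair is nested inside
    that of the other. The inner polynomial slides out past the outer crossing, and [dots] expresses
    both polynomials in the dot of strand 1. *)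
Lemma merged_square i j p q M : code i = p -> code j = q -> P M ->
  merged_t q p M \oc merged_t p q M =
  Qpoly i j (fmap (G q) (merged_x p M) : endo (G q (G p M))) (merged_x q (G p M)).
Proof.
move=> ci cj PM; have := code_validP l i; have := code_validP l j; rewrite ci cj.
case: p q ci cj => [a|] [b|] ci cj.
- by move=> _ _; rewrite /= square (Qpoly_single e1 ci cj).
- move=> _ sa; rewrite /= (Qpoly_pairR e1 cj ci) endoM -!compA.
  rewrite [t b2 a _ \oc _]compA square.
  rewrite (intertwine_Qpoly (f := fmap F2 (t a b1 M)) _ _
    (u := fmap F2 (fmap F1 (x a M)) : endo _)
    (v := x b2 (F1 (Fb a M)) : endo _)).
  + by rewrite fmap_compA square fmap_Qpoly dots //; apply: P_fb.
  + by rewrite -!fmap_comp slide_out ?single1.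
  + exact: (natural (x b2)).
- move=> sb _; rewrite /= (Qpoly_pairL e1 ci cj) endoM -!compA.
  rewrite fmap_compA square fmap_Qpoly.
  rewrite (intertwine_Qpoly (f := t b2 b (F1 M)) _ _
    (u := fmap (Fb b) (fmap F2 (x b1 M)) : endo _)
    (v := x b (F2 (F1 M)) : endo _)).
  + by rewrite compA square dots.
  + exact: (esym (cross_nat (t b2 b) (x b1 M))).
  + by rewrite slide_in ?single2'.
- move=> _ _; rewrite /merged_t ntN compNl compNr opprK.
  rewrite (pair_square (square_eq b1) (square_eq b2) square12 (slide_in_eq b2)).
  have -> : i = j by apply: (@code_inj _ l); rewrite ci cj.
  by rewrite /Qpoly eqxx.
Qed.

(** Distinct outer codes share no letter, so every elementary braid in the expansion has distinct
    outer letters and hence no defect. *)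
Lemma merged_braid p q r M : code_valid l p -> code_valid l q -> code_valid l r ->
  p != r -> defect (merged_t p q) (merged_t p r) (merged_t q r) M = 0.
Proof.
case: p q r => [a|] [b|] [c|] //= sa sb sc.
- exact: braid.
- move=> _; rewrite defectR !braid ?single1 ?single2 //.
  by rewrite linear0 compm0 comp0m addr0.
- by move=> ac; rewrite defectM !braid // linear0 !(compm0, comp0m) addr0.
- move=> _; rewrite defectN3 defectM !defectR !braid ?single1 ?single2 //.
  by rewrite !linear0 !(compm0, comp0m, addr0, linear0, oppr0).
- move=> _; rewrite defectL !braid ?single1' ?single2' // linear0.
  by rewrite !(compm0, comp0m) addr0.
- move=> _; rewrite defectN1 defectL !defectM !braid ?single1' ?single2' //.
  by rewrite !linear0 !(compm0, comp0m, addr0, linear0, oppr0).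
Qed.

(* The middle pair is split: passing its strand 1 (resp. 2) only leaves a multiple
   of the square of t b1 b1 (resp. t b2 b2). *)
Lemma pair_braid M : P M -> defect cpp cpp cpp M = 0.
Proof.
move=> PM; rewrite {1}(_ : cpp = crossR (cL b1) (cL b2)); last first.
  by apply: nattransP => N; apply: crossLR.
rewrite defectM.
rewrite (pair_defect_square braid121 braid212 (braid_eq b1 b1) (braid_eq b2 b1)
  (fun N => braid b1 N b12) (fun N => braid b1 N b21)); last 2 first.
- by right; apply: F2_zero.
- by left; rewrite gamma_eq.
rewrite (pair_defect_square braid121 braid212 (braid_eq b1 b2) (braid_eq b2 b2)
  (fun N => braid b2 N b12) (fun N => braid b2 N b21)); last 2 first.
- by left; rewrite gamma_eq.
- by right; apply: F222_zero.
by rewrite !gamma_eq !square_eq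
  !(linear0, scaler0, scale0r, addr0, oppr0, compm0, comp0m).
Qed.

(** Each summand of [Qdiff_pairL] and [Qdiff_pairR] is the contribution of one triple point: [gamma]
    for one letter of the pair, times the square of the crossings with the other letter. *)
Lemma merged_braid_eq i j p q M : code i = p -> code j = q -> P M ->
  defect (merged_t p q) (merged_t p p) (merged_t q p) M =
  Qdiff i j
    (fmap (G p) (fmap (G q) (merged_x p M)) : endo (G p (G q (G p M))))
    (fmap (G p) (merged_x q (G p M))) (merged_x p (G q (G p M))).
Proof.
move=> ci cj PM; have := code_validP l i; have := code_validP l j; rewrite ci cj.
case: p q ci cj => [a|] [b|] ci cj.
- by move=> _ _; rewrite /= (rel_braid_eq rels _ _ I) (Qdiff_single e1 ci cj).
- move=> _ sa; rewrite /= (Qdiff_pairR e1 cj ci).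
  rewrite (pair_middle_defect (braid_eq a b1) (braid_eq a b2)).
  rewrite square (square a b1) !fmap_Qpoly dots //; apply: P_fb => //.
(* The minus sign in [merged_t] for two pairs cancels the one in [pair_defect_square]. *)
- move=> sb _; rewrite /= (Qdiff_pairL e1 ci cj) defectN2.
  rewrite (pair_defect_square braid121 braid212 (braid_eq b1 b) (braid_eq b2 b)
    (fun N => braid b N b12) (fun N => braid b N b21)); last 2 first.
  + by right; apply: F2_zero.
  + by right; apply: F22_zero.
  by rewrite opprK !square fmap_Qpoly (fmap_Qpoly (compF F2 F1)) dots.
- move=> _ _; rewrite /merged_t !(defectN1, defectN2, defectN3) pair_braid // !oppr0.
  have -> : i = j by apply: (@code_inj _ l); rewrite ci cj.
  by rewrite /Qdiff eqxx.
Qed.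

Lemma merged_rels :
  klr_rels (Fi := fun i => G (code i)) P (fun i => merged_x (code i))
    (fun i j => merged_t (code i) (code j)).
Proof.
have vc := code_validP l; have ic := inj_eq (@code_inj e l).
split=> [i j M PM ij|i j M PM ij|i M PM|i M PM|i j M PM|i j h M PM ih|i j M PM].
- by apply: merged_slide_in; rewrite ?ic.
- by apply: merged_slide_out; rewrite ?ic.
- exact: merged_slide_in_eq.
- exact: merged_slide_out_eq.
- exact: merged_square.
- by apply: merged_braid; rewrite ?ic.
- exact: merged_braid_eq.
Qed.
End MergedRelations.

(** * Actions of the KLR algebras on powers of a functor *)

(** A ring morphism into the opposite ring, since [psi] takes its values in End(F^d)^op. *)
Definition anti_morphism (A B : pzRingType) (f : A -> B) : Prop :=
  [/\ zmod_morphism f, f 1 = 1 & forall a b, f (a * b) = f b * f a].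

Section AntiMorphism.
Variables (A B : pzRingType) (f : A -> B).
Hypothesis fP : anti_morphism f.

Lemma anti_sub a b : f (a - b) = f a - f b. Proof. by case: fP. Qed.
Lemma anti0 : f 0 = 0. Proof. by have := anti_sub 0 0; rewrite !subrr. Qed.
Lemma antiN a : f (- a) = - f a. Proof. by rewrite -sub0r anti_sub anti0 sub0r. Qed.
Lemma antiD a b : f (a + b) = f a + f b.
Proof. by rewrite -{1}[b]opprK anti_sub antiN opprK. Qed.
Lemma anti1 : f 1 = 1. Proof. by case: fP. Qed.
Lemma antiM a b : f (a * b) = f b * f a. Proof. by case: fP. Qed.

Lemma antiX a n : f (a ^+ n) = f a ^+ n.
Proof. by elim: n => [|n IH]; rewrite ?expr0 ?anti1 // exprS antiM IH exprSr. Qed.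

Lemma anti_sum (I : finType) (F : I -> A) : f (\sum_i F i) = \sum_i f (F i).
Proof. by apply: (big_morph f antiD anti0). Qed.

Lemma anti_nat (b : bool) : f b%:R = b%:R.
Proof. by case: b; rewrite ?anti0 ?anti1. Qed.

Lemma anti_Qpoly m (i j : 'I_m) u v : f (Qpoly i j u v) = Qpoly i j (f u) (f v).
Proof.
rewrite /Qpoly; case: ifP => _; first exact: anti0.
rewrite antiM !antiX !anti_sub; apply: commrX; apply: commr_sym; apply: commrX.
by rewrite -[f v - f u]opprB /GRing.comm mulrN mulNr.
Qed.

(** The summands are products of powers of [w - v] and [u - v], whose images commute, so the
    reversal of products leaves no trace. *)
Lemma anti_Qdiff m (i j : 'I_m) u v w :
  f u * f v = f v * f u -> f v * f w = f w * f v -> f u * f w = f w * f u ->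
  f (Qdiff i j u v w) = Qdiff i j (f u) (f v) (f w).
Proof.
move=> uv vw uw; rewrite /Qdiff; case: ifP => _; first exact: anti0.
rewrite antiM antiX antiN anti1 anti_sum.
apply: etrans (commr_sign _ _) _; congr (_ * _).
apply: eq_bigr => s _; rewrite antiM !antiX !anti_sub.
apply: commrX; apply: commr_sym; apply: commrX; apply: commrB.
  by apply: commr_sym; apply: commrB => //; apply: commr_sym.
by apply: commr_sym; apply: commrB => //; apply: commr_sym.
Qed.

(* Compositional forms: evaluating f on a concrete expression by rewriting with
   antiM would make unification unfold the multiplication of A. *)
Lemma antiM_eq a b a' b' : f a = a' -> f b = b' -> f (a * b) = b' * a'.
Proof. by move=> <- <-; apply: antiM. Qed.

Lemma antiD_eq a b a' b' : f a = a' -> f b = b' -> f (a + b) = a' + b'.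
Proof. by move=> <- <-; apply: antiD. Qed.

Lemma antiB_eq a b a' b' : f a = a' -> f b = b' -> f (a - b) = a' - b'.
Proof. by move=> <- <-; apply: anti_sub. Qed.

Lemma anti_Qpoly_eq m (i j : 'I_m) u v u' v' :
  f u = u' -> f v = v' -> f (Qpoly i j u v) = Qpoly i j u' v'.
Proof. by move=> <- <-; apply: anti_Qpoly. Qed.

Lemma anti_Qdiff_eq m (i j : 'I_m) u v w u' v' w' :
  u' * v' = v' * u' -> v' * w' = w' * v' -> u' * w' = w' * u' ->
  f u = u' -> f v = v' -> f w = w' ->
  f (Qdiff i j u v w) = Qdiff i j u' v' w'.
Proof.
move=> uv vw uw eu ev ew; move: uv vw uw; rewrite -eu -ev -ew.
exact: anti_Qdiff.
Qed.

Lemma anti_sum_eq (I : finType) (F : I -> A) (F' : I -> B) :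
  (forall i, f (F i) = F' i) -> f (\sum_i F i) = \sum_i F' i.
Proof. by move=> E; rewrite anti_sum; apply: eq_bigr => i _. Qed.
End AntiMorphism.

Section QuotientMap.
Variables (k : fieldType) (A : lalgType k) (rel : A -> A -> Prop).

Lemma quot_pi_linear c (a b : A) :
  quot_pi rel (c *: a + b) = c *: quot_pi rel a + quot_pi rel b.
Proof. by rewrite raddfD; congr (_ + _); apply: quot_piZ. Qed.

Lemma quot_pi_mul (a b : A) : quot_pi rel (a * b) = quot_pi rel a * quot_pi rel b.
Proof. exact: quot_piM. Qed.
End QuotientMap.

Section NatEnd.
Variables (k : fieldType) (C D : linCat k) (F : functor C D).
Implicit Types s t : nat_end F.

Lemma nat_endM s t X : (s * t) X = s X \oc t X. Proof. by []. Qed.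
Lemma nat_end1 X : (1 : nat_end F) X = idm (F X). Proof. by []. Qed.
Lemma nat_end0 X : (0 : nat_end F) X = 0. Proof. by []. Qed.
Lemma nat_endD s t X : (s + t) X = s X + t X. Proof. by []. Qed.
Lemma nat_endB s t X : (s - t) X = s X - t X.
Proof. by congr (_ + _); apply: scaleN1r. Qed.
Lemma nat_endZl a s t : a *: s * t = a *: (s * t).
Proof. by apply: nattransP => X; apply: compZl. Qed.
Lemma nat_endZr a s t : s * (a *: t) = a *: (s * t).
Proof. by apply: nattransP => X; apply: compZr. Qed.

Definition nt_eval X (s : nat_end F) : endo (F X) := s X.

Fact nt_eval_zmod X : zmod_morphism (nt_eval X).
Proof. by move=> s t; apply: nat_endB. Qed.
HB.instance Definition _ X :=
  GRing.isZmodMorphism.Build (nat_end F) (endo (F X)) (nt_eval X) (nt_eval_zmod X).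
Fact nt_eval_monoid X : monoid_morphism (nt_eval X).
Proof. by split. Qed.
HB.instance Definition _ X :=
  GRing.isMonoidMorphism.Build (nat_end F) (endo (F X)) (nt_eval X)
    (nt_eval_monoid X).

Lemma nat_end_Qpoly m (i j : 'I_m) s t X :
  (Qpoly i j s t) X = Qpoly i j (s X : endo (F X)) (t X).
Proof. exact: (Qpoly_morph i j (nt_eval X)). Qed.

Lemma nat_end_Qdiff m (i j : 'I_m) s t u X :
  (Qdiff i j s t u) X = Qdiff i j (s X : endo (F X)) (t X) (u X).
Proof. exact: (Qdiff_morph i j (nt_eval X)). Qed.

(** * Evaluation of the free algebra *)

Section FreeEval.
Variables (G : choiceType) (g : G -> nat_end F).
Local Notation free := {malg k[{fmonom G}]}.

(** The first letter becomes the rightmost factor, so that concatenation of words is sent to the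
    reversed product. *)
Definition word_eval (w : {fmonom G}) : nat_end F :=
  foldr (fun a s => s * g a) 1 (w : seq G).

Definition free_eval (a : free) : nat_end F :=
  \sum_(w <- msupp a) a@_w *: word_eval w.

Lemma word_evalM v w : word_eval (mmul v w) = word_eval w * word_eval v.
Proof.
rewrite /word_eval fmM foldr_cat; elim: (v : seq G) => [|a s IH] /=.
  by rewrite mulr1.
by rewrite IH mulrA.
Qed.

(** Sums over the supports of several elements can be compared once they are written over a common
    finite set. *)
Lemma free_evalEw (d : {fset {fmonom G}}) a : (msupp a `<=` d)%fset ->
  free_eval a = \sum_(w <- d) a@_w *: word_eval w.
Proof.
move=> le; rewrite /free_eval (big_fset_incl _ le) => //= w _ /mcoeff_outdom ->.
by rewrite scale0r.
Qed.

Lemma free_eval_linear : linear free_eval.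
Proof.
move=> c a b; pose d := (msupp (c *: a + b) `|` (msupp a `|` msupp b))%fset.
have d1 : (msupp (c *: a + b) `<=` d)%fset by rewrite fsubsetUl.
have d2 : (msupp a `<=` d)%fset by rewrite /d fsetUC -fsetUA fsubsetUl.
have d3 : (msupp b `<=` d)%fset by rewrite /d fsetUA fsubsetUr.
rewrite (free_evalEw d1) (free_evalEw d2) (free_evalEw d3).
rewrite scaler_sumr -big_split; apply: eq_bigr => w _ /=.
by rewrite mcoeffD mcoeffZ scalerDl scalerA.
Qed.

Lemma free_evalU c w : free_eval << c *g w >> = c *: word_eval w.
Proof. by rewrite (free_evalEw msuppU_le) big_seq_fset1 mcoeffUU. Qed.

Lemma free_eval_gen a : free_eval << fmu a >> = g a.
Proof. by rewrite free_evalU scale1r /word_eval fmU /= mul1r. Qed.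

Lemma free_eval_anti : anti_morphism free_eval.
Proof.
have evB : zmod_morphism free_eval.
  by move=> a b; rewrite addrC -scaleN1r free_eval_linear scaleN1r addrC.
split=> [//||a b].
  have -> : (1 : free) = << 1 *g mone >> by [].
  by rewrite free_evalU scale1r /word_eval fm1.
have evD u v : free_eval (u + v) = free_eval u + free_eval v.
  by rewrite -[u]scale1r free_eval_linear !scale1r.
have ev0 : free_eval 0 = 0 by rewrite -(subrr 0) evB subrr.
rewrite malgME (big_morph _ evD ev0) [RHS]mulr_sumr; apply: eq_bigr => v _.
rewrite (big_morph _ evD ev0) mulr_suml; apply: eq_bigr => w _.
by rewrite free_evalU word_evalM nat_endZl nat_endZr scalerA mulrC.
Qed.
End FreeEval.
End NatEnd.

(** * The KLR relations on F, F^2 and F^3 *)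

Section LocalRelations.
Variables (k : fieldType) (D : linCat k) (m : nat).
Variables (Fi : 'I_m -> functor D D) (F : functor D D).
Variables (inc : forall i, nattrans (Fi i) F) (pr : forall i, nattrans F (Fi i)).
Implicit Types (i j l : 'I_m) (N : D).

Definition idem_word1 i N : hom (F N) (F N) := inc i N \oc pr i N.
Definition idem_word2 i j N : hom (F (F N)) (F (F N)) :=
  idem_word1 j (F N) \oc fmap F (idem_word1 i N).
Definition idem_word3 i j l N : hom (F (F (F N))) (F (F (F N))) :=
  idem_word1 l (F (F N)) \oc fmap F (idem_word2 i j N).

Lemma idem_nat i N N' (f : hom N N') :
  idem_word1 i N' \oc fmap F f = fmap F f \oc idem_word1 i N.
Proof. by rewrite /idem_word1 -compA (natural (pr i)) !compA (natural (inc i)). Qed.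

Lemma idem2_nat i j N N' (f : hom N N') :
  idem_word2 i j N' \oc fmap F (fmap F f) = fmap F (fmap F f) \oc idem_word2 i j N.
Proof. by rewrite /idem_word2 -compA -fmap_comp !idem_nat fmap_comp -!compA. Qed.

(** The relations involving at most three adjacent strands, without whiskering. Idempotents stand on
    the left because [psi] reverses the products of the form (relation) * e(i). *)
Record local_rels (x : nat_end F) (tau : nat_end (compF F F)) : Prop := LocalRels {
  loc_xe : forall i N, idem_word1 i N \oc x N = x N \oc idem_word1 i N;
  loc_te : forall i j N, idem_word2 i j N \oc tau N = tau N \oc idem_word2 j i N;
  loc_in : forall i j N, idem_word2 i j N \oc (tau N \oc x (F N)) =
    idem_word2 i j N \oc (fmap F (x N) \oc tau N + (i == j)%:R *: idm (F (F N)));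
  loc_out : forall i j N, idem_word2 i j N \oc (x (F N) \oc tau N) =
    idem_word2 i j N \oc (tau N \oc fmap F (x N) + (i == j)%:R *: idm (F (F N)));
  loc_square : forall i j N, idem_word2 i j N \oc (tau N \oc tau N) =
    idem_word2 i j N \oc (Qpoly i j (fmap F (x N) : endo (F (F N))) (x (F N)));
  loc_braid : forall i j l N, idem_word3 i j l N \oc
      (tau (F N) \oc (fmap F (tau N) \oc tau (F N)) -
       fmap F (tau N) \oc (tau (F N) \oc fmap F (tau N))) =
    idem_word3 i j l N \oc (if i == l then
      Qdiff i j (fmap F (fmap F (x N)) : endo (F (F (F N)))) (fmap F (x (F N)))
        (x (F (F N))) else 0)
}.

Hypothesis sumF : functor_sum inc pr.

Lemma pr_inc i N : pr i N \oc inc i N = idm _.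
Proof. by have [h _ _] := sumF N. Qed.
Lemma pr_inc0 i j N : i != j -> pr i N \oc inc j N = 0.
Proof. by move=> ij; have [_ h _] := sumF N; apply: h. Qed.

Definition pr_word2 i j N : hom (F (F N)) (Fi j (Fi i N)) :=
  fmap (Fi j) (pr i N) \oc pr j (F N).
Definition inc_word2 i j N : hom (Fi j (Fi i N)) (F (F N)) :=
  inc j (F N) \oc fmap (Fi j) (inc i N).
Definition pr_word3 i j l N : hom (F (F (F N))) (Fi l (Fi j (Fi i N))) :=
  fmap (Fi l) (pr_word2 i j N) \oc pr l (F (F N)).
Definition inc_word3 i j l N : hom (Fi l (Fi j (Fi i N))) (F (F (F N))) :=
  inc l (F (F N)) \oc fmap (Fi l) (inc_word2 i j N).

Lemma idem2E i j N : idem_word2 i j N = inc_word2 i j N \oc pr_word2 i j N.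
Proof.
rewrite /idem_word2 /idem_word1 /inc_word2 /pr_word2 -!compA; congr comp.
by rewrite (natural (pr j)) fmap_comp -!compA.
Qed.

Lemma idem3E i j l N : idem_word3 i j l N = inc_word3 i j l N \oc pr_word3 i j l N.
Proof.
rewrite /idem_word3 idem2E /inc_word3 /pr_word3 /idem_word1 -!compA; congr comp.
by rewrite (natural (pr l)) fmap_compA /inc_word2 -!compA.
Qed.

Lemma pr_inc2 i j N : pr_word2 i j N \oc inc_word2 i j N = idm _.
Proof.
rewrite /pr_word2 /inc_word2 -!compA (preL (pr_inc _ _)) comp1m -fmap_comp pr_inc.
exact: fmap_id.
Qed.

Lemma pr_inc3 i j l N : pr_word3 i j l N \oc inc_word3 i j l N = idm _.
Proof.
rewrite /pr_word3 /inc_word3 -!compA (preL (pr_inc _ _)) comp1m -fmap_comp pr_inc2.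
exact: fmap_id.
Qed.

Lemma idem2_eqP i j N W (a b : hom W (F (F N))) :
  idem_word2 i j N \oc a = idem_word2 i j N \oc b <->
  pr_word2 i j N \oc a = pr_word2 i j N \oc b.
Proof.
rewrite idem2E -[_ \oc a]compA -[_ \oc b]compA; split=> [E|->] //.
have := congr1 (comp (pr_word2 i j N)) E.
by rewrite !(preL (pr_inc2 _ _ _)) !comp1m.
Qed.

Lemma idem3_eqP i j l N W (a b : hom W (F (F (F N)))) :
  idem_word3 i j l N \oc a = idem_word3 i j l N \oc b <->
  pr_word3 i j l N \oc a = pr_word3 i j l N \oc b.
Proof.
rewrite idem3E -[_ \oc a]compA -[_ \oc b]compA; split=> [E|->] //.
have := congr1 (comp (pr_word3 i j l N)) E.
by rewrite !(preL (pr_inc3 _ _ _ _)) !comp1m.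
Qed.

Lemma pr2_cancel i j N W (a b : hom (Fi j (Fi i N)) W) :
  a \oc pr_word2 i j N = b \oc pr_word2 i j N -> a = b.
Proof.
move=> /(congr1 (fun f => f \oc inc_word2 i j N)).
by rewrite -[LHS]compA -[RHS]compA pr_inc2 !compm1.
Qed.

Lemma pr3_cancel i j l N W (a b : hom (Fi l (Fi j (Fi i N))) W) :
  a \oc pr_word3 i j l N = b \oc pr_word3 i j l N -> a = b.
Proof.
move=> /(congr1 (fun f => f \oc inc_word3 i j l N)).
by rewrite -[LHS]compA -[RHS]compA pr_inc3 !compm1.
Qed.

Variables (x : nat_end F) (tau : nat_end (compF F F)).
Variables (xi : forall i, nattrans (Fi i) (Fi i)).
Variable t : forall i j, cross (Fi i) (Fi j).
Hypothesis pr_x : forall i N, pr i N \oc x N = xi i N \oc pr i N.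
Hypothesis pr_t : forall i j N,
  pr_word2 j i N \oc tau N = t i j N \oc pr_word2 i j N.

Lemma pr2_hi i j N : pr_word2 i j N \oc x (F N) = xi j (Fi i N) \oc pr_word2 i j N.
Proof. by rewrite /pr_word2 -compA pr_x !compA (natural (xi j)). Qed.

Lemma pr2_lo i j N :
  pr_word2 i j N \oc fmap F (x N) = fmap (Fi j) (xi i N) \oc pr_word2 i j N.
Proof.
by rewrite /pr_word2 -compA (natural (pr j)) !compA -!fmap_comp pr_x.
Qed.

Lemma pr3_low i j i' j' l N a b : pr_word2 i j N \oc a = b \oc pr_word2 i' j' N ->
  pr_word3 i j l N \oc fmap F a = fmap (Fi l) b \oc pr_word3 i' j' l N.
Proof.
by move=> E; rewrite /pr_word3 -compA (natural (pr l)) !compA -!fmap_comp E.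
Qed.

Lemma pr3_x2 i j l N :
  pr_word3 i j l N \oc x (F (F N)) = xi l (Fi j (Fi i N)) \oc pr_word3 i j l N.
Proof. by rewrite /pr_word3 -compA pr_x !compA (natural (xi l)). Qed.

(** [pr_word3] is built by splitting off the top letter; the regrouped form exposes the two top
    letters, on which [tau (F N)] acts. *)
Lemma pr3E i j l N :
  pr_word3 i j l N = fmap (Fi l) (fmap (Fi j) (pr i N)) \oc pr_word2 j l (F N).
Proof. by rewrite /pr_word3 /pr_word2 fmap_comp -!compA. Qed.

Lemma pr3_t i j l N :
  pr_word3 i j l N \oc tau (F N) = t l j (Fi i N) \oc pr_word3 i l j N.
Proof. by rewrite !pr3E -compA pr_t !compA cross_nat. Qed.

Lemma pr3_braid i j l N : pr_word3 l j i N \oc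
    (tau (F N) \oc (fmap F (tau N) \oc tau (F N)) -
     fmap F (tau N) \oc (tau (F N) \oc fmap F (tau N))) =
  defect (t i j) (t i l) (t j l) N \oc pr_word3 i j l N.
Proof.
have lo a b c := @pr3_low _ _ _ _ c N _ _ (pr_t a b N).
rewrite compBr compBl /braidR /braidL; congr (_ - _).
  rewrite (preR (pr3_t _ _ _ _)) (preR (lo _ _ _)) pr3_t.
  by rewrite -[RHS]compA -[(_ \oc _) \oc pr_word3 _ _ _ _]compA.
rewrite (preR (lo _ _ _)) (preR (pr3_t _ _ _ _)) lo.
by rewrite -[RHS]compA -[(_ \oc _) \oc pr_word3 _ _ _ _]compA.
Qed.

Let pr2_in i j N : pr_word2 j i N \oc (tau N \oc x (F N)) =
  (t i j N \oc xi j (Fi i N)) \oc pr_word2 i j N.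
Proof. by rewrite (preR (pr_t _ _ _)) pr2_hi [LHS]compA. Qed.

Let pr2_in' i j N : pr_word2 j i N \oc (fmap F (x N) \oc tau N) =
  (fmap (Fi i) (xi j N) \oc t i j N) \oc pr_word2 i j N.
Proof. by rewrite (preR (pr2_lo _ _ _)) pr_t [LHS]compA. Qed.

Let pr2_out i j N : pr_word2 j i N \oc (x (F N) \oc tau N) =
  (xi i (Fi j N) \oc t i j N) \oc pr_word2 i j N.
Proof. by rewrite (preR (pr2_hi _ _ _)) pr_t [LHS]compA. Qed.

Let pr2_out' i j N : pr_word2 j i N \oc (tau N \oc fmap F (x N)) =
  (t i j N \oc fmap (Fi j) (xi i N)) \oc pr_word2 i j N.
Proof. by rewrite (preR (pr_t _ _ _)) pr2_lo [LHS]compA. Qed.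

Let pr2_square i j N : pr_word2 i j N \oc (tau N \oc tau N) =
  (t j i N \oc t i j N) \oc pr_word2 i j N.
Proof. by rewrite (preR (pr_t _ _ _)) pr_t [LHS]compA. Qed.

Lemma local_klr_rels : local_rels x tau -> klr_rels (fun=> True) xi t.
Proof.
move=> [_ _ hin hout hsq hbr]; split.
(* The idempotent acts after [tau], so it carries the word obtained from (i, j) by exchanging the
   letters. *)
- move=> i j N _ ij; apply: pr2_cancel; have /idem2_eqP := hin j i N.
  by rewrite eq_sym (negPf ij) scale0r addr0 pr2_in pr2_in'.
- move=> i j N _ ij; apply: pr2_cancel; have /idem2_eqP := hout j i N.
  by rewrite eq_sym (negPf ij) scale0r addr0 pr2_out pr2_out'.
- move=> i N _; apply: pr2_cancel; have /idem2_eqP := hin i i N.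
  by rewrite eqxx scale1r compDr compm1 pr2_in pr2_in' compDl comp1m.
- move=> i N _; apply: pr2_cancel; have /idem2_eqP := hout i i N.
  by rewrite eqxx scale1r compDr compm1 pr2_out pr2_out' compDl comp1m.
- move=> i j N _; apply: pr2_cancel; have /idem2_eqP := hsq i j N.
  rewrite pr2_square => ->.
  by apply/esym/intertwine_Qpoly; rewrite ?pr2_lo ?pr2_hi.
- move=> i j l N _ il; apply: pr3_cancel; have /idem3_eqP := hbr l j i N.
  by rewrite pr3_braid eq_sym (negPf il) comp0m compm0.
- move=> i j N _; apply: pr3_cancel; have /idem3_eqP := hbr i j i N.
  rewrite pr3_braid eqxx => ->.
  apply/esym/intertwine_Qdiff; rewrite ?pr3_x2 //.
    exact/esym/pr3_low/pr2_lo.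
  exact/esym/pr3_low/pr2_hi.
Qed.

Lemma klr_local_rels :
  (forall i j N, tau N \oc inc_word2 i j N = inc_word2 j i N \oc t i j N) ->
  (forall i N, x N \oc inc i N = inc i N \oc xi i N) ->
  klr_rels (fun=> True) xi t -> local_rels x tau.
Proof.
move=> t_inc x_inc rels; split.
- by move=> i N; rewrite /idem_word1 -compA pr_x !compA x_inc.
- move=> i j N; rewrite !idem2E -[LHS]compA pr_t [LHS]compA -t_inc.
  by rewrite -[LHS]compA.
- move=> i j N; apply/idem2_eqP; rewrite compDr pr2_in pr2_in' compZr compm1.
  have [<-|ij] := eqVneq i j.
    by rewrite (rel_slide_in_eq rels) // compDl comp1m scale1r.
  by rewrite (rel_slide_in rels) // 1?eq_sym // scale0r addr0.
- move=> i j N; apply/idem2_eqP; rewrite compDr pr2_out pr2_out' compZr compm1.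
  have [<-|ij] := eqVneq i j.
    by rewrite (rel_slide_out_eq rels) // compDl comp1m scale1r.
  by rewrite (rel_slide_out rels) // 1?eq_sym // scale0r addr0.
- move=> i j N; apply/idem2_eqP; rewrite pr2_square (rel_square rels) //.
  by apply/intertwine_Qpoly; rewrite ?pr2_lo ?pr2_hi.
- move=> i j l N; apply/idem3_eqP; rewrite pr3_braid.
  have [<-|il] := eqVneq i l; last first.
    by rewrite (rel_braid rels) ?comp0m ?compm0 // eq_sym.
  rewrite (rel_braid_eq rels) //.
  apply/intertwine_Qdiff; rewrite ?pr3_x2 //.
    exact/esym/pr3_low/pr2_lo.
  exact/esym/pr3_low/pr2_hi.
Qed.
End LocalRelations.

(** * Words and the action on powers of F *)

Section MultiIndices.
Variables m d : nat.
Implicit Types w : nat -> 'I_m.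

(* A multi-index read off an infinite word, so that prefixes need no casts. *)
Definition prefix_index w : multi_index m d := [ffun a : 'I_d => w a].

Definition swap_word r w n : 'I_m :=
  if n == r then w r.+1 else if n == r.+1 then w r else w n.

Lemma prefix_index_fun w : (prefix_index w : 'I_d -> 'I_m) = fun a => w a.
Proof. by apply: functional_extensionality_dep => a; rewrite ffunE. Qed.

Lemma prefix_indexK (i0 : 'I_m) (i : multi_index m d) :
  exists w, i = prefix_index w.
Proof.
(* The letter [i0] pads the word beyond its first d letters. *)
exists (fun n => if insub n is Some a then i a else i0).
by apply/ffunP => a; rewrite ffunE valK.
Qed.

Lemma swap_prefix_index (r : 'I_d.-1) w :
  swap r (prefix_index w) = prefix_index (swap_word r w).
Proof.
apply/ffunP => a; rewrite !ffunE /swap_word; case: tpermP => [->|->|] /=.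
- by rewrite eqxx.
- by rewrite eqxx gtn_eqF.
move=> /eqP a1 /eqP a2; rewrite -val_eqE /= in a1; rewrite -val_eqE /= in a2.
by rewrite (negPf a1) (negPf a2).
Qed.
End MultiIndices.

Section Powers.
Variables (k : fieldType) (D : linCat k) (m : nat).
Variables (Fi : 'I_m -> functor D D) (F : functor D D).
Variables (inc : forall i, nattrans (Fi i) F) (pr : forall i, nattrans F (Fi i)).
Variables (x : nat_end F) (tau : nat_end (compF F F)).
Implicit Types (M N : D) (w : nat -> 'I_m).
Local Notation idem := (idem_word1 inc pr).
Local Notation idem2 := (idem_word2 inc pr).
Local Notation idem3 := (idem_word3 inc pr).
Local Notation powF := (powF F).

Lemma pow_x_top d M : pow_x x d.+1 d M = x (powF d M).
Proof. by rewrite /= eqxx /= fmap_id compm1. Qed.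

Lemma pow_x_low d r M : (r < d)%N -> pow_x x d.+1 r M = fmap F (pow_x x d r M).
Proof. by move=> rd; rewrite /= (ltn_eqF rd) /= comp1m. Qed.

Lemma pow_tau_top d M : pow_tau tau d.+2 d M = tau (powF d M).
Proof. by rewrite /= eqxx. Qed.

Lemma pow_tau_low d r M : (r.+1 < d)%N ->
  pow_tau tau d.+1 r M = fmap F (pow_tau tau d r M).
Proof.
case: d => [//|d] rd; rewrite ltnS in rd.
by rewrite /= (ltn_eqF rd) /= comp1m.
Qed.

Fixpoint word_idem d w M : hom (powF d M) (powF d M) :=
  if d is d'.+1 then idem (w d') (powF d' M) \oc fmap F (word_idem d' w M)
  else idm M.

Lemma word_projS d (v : 'I_d.+1 -> 'I_m) M : word_proj inc pr v M =
  idem (v ord_max) (powF d M) \oc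
    fmap F (word_proj inc pr (fun a => v (widen_ord (leqnSn d) a)) M).
Proof.
rewrite /word_proj /= -!compA; congr comp.
by rewrite fmap_comp compA -(natural (pr _)) -compA.
Qed.

Lemma word_proj_idem d w M : word_proj inc pr (prefix_index d w) M = word_idem d w M.
Proof.
rewrite prefix_index_fun; elim: d => [|d IH]; first exact: comp1m.
by rewrite word_projS [RHS]/= -IH.
Qed.

Lemma word_idem_ext d w w' M : (forall n, (n < d)%N -> w n = w' n) ->
  word_idem d w M = word_idem d w' M.
Proof.
elim: d => [//|d IH] E /=; rewrite E // IH // => n nd.
by apply: E; apply: ltnW.
Qed.

Lemma word_idem1 w M : word_idem 1 w M = idem (w 0%N) M.
Proof. by rewrite /= fmap_id compm1. Qed.

Lemma word_idem2 w M : word_idem 2 w M = idem2 (w 0%N) (w 1%N) M.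
Proof. by rewrite /= fmap_id compm1. Qed.

Lemma word_idem3 w M : word_idem 3 w M = idem3 (w 0%N) (w 1%N) (w 2%N) M.
Proof. by rewrite /= fmap_id compm1. Qed.

Local Notation free d := {malg k[{fmonom (klr_gen m d)}]}.
Local Notation gen g := (free_gen k g).

(** The common shape of [psi] composed with the quotient map and of the evaluation [free_eval]. The
    images of both sides of each relation are thus computed once and serve both directions of the
    equivalence. *)
Record power_gens d (Psi : free d -> nat_end (powF d)) : Prop := PowerGens {
  act_anti : anti_morphism Psi;
  act_e : forall i : multi_index m d,
    Psi (gen (inl (inl i))) = word_proj inc pr i;
  act_x : forall a : 'I_d, Psi (gen (inl (inr a))) = pow_x x d a;
  act_t : forall r : 'I_d.-1, Psi (gen (inr r)) = pow_tau tau d r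
}.

Section Images.
Variables (d : nat) (Psi : free d -> nat_end (powF d)).
Hypothesis act : power_gens Psi.
Local Notation E i := (word_proj inc pr i : nat_end (powF d)).
Local Notation X a := (pow_x x d a : nat_end (powF d)).
Local Notation T r := (pow_tau tau d r : nat_end (powF d)).
Local Notation e i := (gen (inl (inl i)) : free d).
Local Notation x_ a := (gen (inl (inr a)) : free d).
Local Notation t_ r := (gen (inr r) : free d).
Implicit Types (i j : multi_index m d) (r s : 'I_d.-1).

Let an := act_anti act.
Let M := antiM_eq an.
Let ee := act_e act.
Let xx := act_x act.
Let tt := act_t act.

Lemma image_ee i j : Psi (e i * e j) = E j * E i.
Proof. exact: (M (ee i) (ee j)). Qed.
Lemma image_xe a i : Psi (x_ a * e i) = E i * X a.
Proof. exact: (M (xx a) (ee i)). Qed.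
Lemma image_ex a i : Psi (e i * x_ a) = X a * E i.
Proof. exact: (M (ee i) (xx a)). Qed.
Lemma image_te r i : Psi (t_ r * e i) = E i * T r.
Proof. exact: (M (tt r) (ee i)). Qed.
Lemma image_et r i : Psi (e i * t_ r) = T r * E i.
Proof. exact: (M (ee i) (tt r)). Qed.
Lemma image_xx a b : Psi (x_ a * x_ b) = X b * X a.
Proof. exact: (M (xx a) (xx b)). Qed.
Lemma image_tx r a : Psi (t_ r * x_ a) = X a * T r.
Proof. exact: (M (tt r) (xx a)). Qed.
Lemma image_xt r a : Psi (x_ a * t_ r) = T r * X a.
Proof. exact: (M (xx a) (tt r)). Qed.
Lemma image_tt r s : Psi (t_ r * t_ s) = T s * T r.
Proof. exact: (M (tt r) (tt s)). Qed.
Lemma image_txe r a i : Psi (t_ r * x_ a * e i) = E i * (X a * T r).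
Proof. exact: (M (image_tx r a) (ee i)). Qed.
Lemma image_xte r a i : Psi (x_ a * t_ r * e i) = E i * (T r * X a).
Proof. exact: (M (image_xt r a) (ee i)). Qed.
Lemma image_tx1e r a i (b : bool) :
  Psi ((t_ r * x_ a + b%:R) * e i) = E i * (X a * T r + b%:R).
Proof. exact: (M (antiD_eq an (image_tx r a) (anti_nat an b)) (ee i)). Qed.
Lemma image_xt1e r a i (b : bool) :
  Psi ((x_ a * t_ r + b%:R) * e i) = E i * (T r * X a + b%:R).
Proof. exact: (M (antiD_eq an (image_xt r a) (anti_nat an b)) (ee i)). Qed.
Lemma image_tte r i : Psi (t_ r * t_ r * e i) = E i * (T r * T r).
Proof. exact: (M (image_tt r r) (ee i)). Qed.
Lemma image_Qpoly p q a b i :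
  Psi (Qpoly p q (x_ a) (x_ b) * e i) = E i * Qpoly (m := m) p q (X a) (X b).
Proof. exact: (M (anti_Qpoly_eq an p q (xx a) (xx b)) (ee i)). Qed.
Lemma image_braid r s i : Psi ((t_ s * t_ r * t_ s - t_ r * t_ s * t_ r) * e i) =
  E i * (T s * (T r * T s) - T r * (T s * T r)).
Proof.
exact: (M (antiB_eq an (M (image_tt s r) (tt s)) (M (image_tt r s) (tt r))) (ee i)).
Qed.
Lemma image_Qdiff p q a b c i :
  (forall a b : 'I_d, X a * X b = X b * X a) ->
  Psi (Qdiff p q (x_ a) (x_ b) (x_ c) * e i) =
  E i * Qdiff (m := m) p q (X a) (X b) (X c).
Proof.
move=> C.
exact: (M (anti_Qdiff_eq an p q (C _ _) (C _ _) (C _ _)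
  (xx a) (xx b) (xx c)) (ee i)).
Qed.
End Images.

Lemma psi_power_gens d (psi : klr k m d -> nat_end (powF d)) :
  linear psi -> psi 1 = 1 -> (forall a b, psi (a * b) = psi b * psi a) ->
  (forall i : multi_index m d, psi (klr_e k i) = word_proj inc pr i) ->
  (forall a : 'I_d, psi (klr_x k m a) = pow_x x d a) ->
  (forall r : 'I_d.-1, psi (klr_tau k m r) = pow_tau tau d r) ->
  power_gens (fun g => psi (quot_pi (@klr_rel k m d) g)).
Proof.
move=> lin_psi psi1 psiM psi_e psi_x psi_t; split=> //.
split=> [u v||u v].
- rewrite raddfB /=; set a := quot_pi _ u; set b := quot_pi _ v.
  by rewrite addrC -scaleN1r lin_psi scaleN1r addrC.
- exact: psi1.
- rewrite -(psiM (quot_pi _ u) (quot_pi _ v)).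
  by rewrite (quot_piM (@klr_rel k m d) u v).
Qed.

Lemma klr_rel_quot d u v : @klr_rel k m d u v ->
  quot_pi (@klr_rel k m d) u = quot_pi (@klr_rel k m d) v.
Proof.
move=> uv; apply/quot_piP.
have := ideal_spanD 1 1 uv (ideal_span0 (@klr_rel k m d)).
by rewrite mul1r mulr1 addr0.
Qed.
End Powers.

(** * Local relations from the actions on F, F^2 and F^3 *)

Section LocalFromPower.
Variables (k : fieldType) (D : linCat k) (m : nat).
Variables (Fi : 'I_m -> functor D D) (F : functor D D).
Variables (inc : forall i, nattrans (Fi i) F) (pr : forall i, nattrans F (Fi i)).
Variables (x : nat_end F) (tau : nat_end (compF F F)).
Hypothesis act : forall d, exists Psi : {malg k[{fmonom (klr_gen m d)}]} ->
  nat_end (powF F d), power_gens inc pr x tau Psi /\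
  forall u v, klr_rel u v -> Psi u = Psi v.

Let eval_at d (s s' : nat_end (powF F d)) M : s = s' -> s M = s' M.
Proof. by move->. Qed.

Lemma nat_end_bool (C : linCat k) (G : functor C C) (b : bool) M :
  (b%:R : nat_end G) M = b%:R *: idm (G M).
Proof. by case: b; rewrite ?scale1r ?scale0r. Qed.

Lemma power_local_rels : local_rels inc pr x tau.
Proof.
have [Psi1 [act1 rel1]] := act 1.
have [Psi2 [act2 rel2]] := act 2.
have [Psi3 [act3 rel3]] := act 3.
pose w3 (i j l : 'I_m) n : 'I_m :=
  if n is n'.+1 then if n' is _.+1 then l else j else i.
pose r0 : 'I_(2.-1) := (ord0 : 'I_1).
pose s0 : 'I_(3.-1) := (ord0 : 'I_2); pose s1 : 'I_(3.-1) := (ord_max : 'I_2).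
have lo2 M : pow_x x 2 (strand_lo (d := 2) r0) M = fmap F (x M).
  by rewrite pow_x_low // pow_x_top.
have hi2 M : pow_x x 2 (strand_hi (d := 2) r0) M = x (F M).
  exact: pow_x_top.
have ta2 M : pow_tau tau 2 r0 M = tau M by exact: pow_tau_top.
have ta30 M : pow_tau tau 3 s0 M = fmap F (tau M).
  by rewrite pow_tau_low // pow_tau_top.
have ta31 M : pow_tau tau 3 s1 M = tau (F M) by exact: pow_tau_top.
split.
- move=> i N; pose I := prefix_index 1 (fun=> i).
  have := etrans (esym (image_xe act1 ord0 I))
    (etrans (rel1 _ _ (klr_xe k ord0 I)) (image_ex act1 ord0 I)).
  move=> /(eval_at N).
  by rewrite !nat_endM word_proj_idem word_idem1 pow_x_top.
- move=> i j N; pose I := prefix_index 2 (w3 i j j).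
  have := etrans (esym (image_te act2 r0 I))
    (etrans (rel2 _ _ (klr_te (d := 2) k r0 I)) (image_et act2 r0 (swap r0 I))).
  move=> /(eval_at N).
  by rewrite !nat_endM swap_prefix_index !word_proj_idem !word_idem2 ta2.
(* Products are reversed: the relation for x tau gives [loc_in], and in the next case the one for
   tau x gives [loc_out]. *)
- move=> i j N; pose I := prefix_index 2 (w3 i j j).
  have := etrans (esym (image_xte act2 r0 _ I))
    (etrans (rel2 _ _ (klr_xt (d := 2) k r0 I)) (image_tx1e act2 r0 _ I _)).
  move=> /(eval_at N).
  rewrite !(nat_endM, nat_endD, nat_end_bool) word_proj_idem word_idem2 ta2.
  by rewrite hi2 lo2 !ffunE.
- move=> i j N; pose I := prefix_index 2 (w3 i j j).
  have := etrans (esym (image_txe act2 r0 _ I))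
    (etrans (rel2 _ _ (klr_tx (d := 2) k r0 I)) (image_xt1e act2 r0 _ I _)).
  move=> /(eval_at N).
  rewrite !(nat_endM, nat_endD, nat_end_bool) word_proj_idem word_idem2 ta2.
  by rewrite hi2 lo2 !ffunE.
- move=> i j N; pose I := prefix_index 2 (w3 i j j).
  have := etrans (esym (image_tte act2 r0 I))
    (etrans (rel2 _ _ (klr_tt (d := 2) k r0 I)) (image_Qpoly act2 _ _ _ _ I)).
  move=> /(eval_at N).
  rewrite !(nat_endM, nat_end_Qpoly) word_proj_idem word_idem2 ta2.
  by rewrite hi2 lo2 !ffunE.
- move=> i j l N; pose I := prefix_index 3 (w3 i j l).
  have X0 M : pow_x x 3 (strand_lo (d := 3) s0) M = fmap F (fmap F (x M)).
    by rewrite pow_x_low // pow_x_low // pow_x_top.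
  have X1 M : pow_x x 3 (strand_hi (d := 3) s0) M = fmap F (x (F M)).
    by rewrite pow_x_low // pow_x_top.
  have X2 M : pow_x x 3 (strand_hi (d := 3) s1) M = x (F (F M)).
    exact: pow_x_top.
  have XX a b : (pow_x x 3 (a : 'I_3) : nat_end (powF F 3)) * pow_x x 3 (b : 'I_3) =
      pow_x x 3 b * pow_x x 3 a.
    exact: etrans (esym (image_xx act3 b a))
      (etrans (rel3 _ _ (klr_xx k m b a)) (image_xx act3 a b)).
  have := klr_braid (d := 3) k (r := s0) (s := s1) I erefl; rewrite !ffunE.
  rewrite -[w3 i j l (strand_lo s0)]/i -[w3 i j l (strand_hi s0)]/j.
  rewrite -[w3 i j l (strand_hi s1)]/l => /rel3 br.
  have {}br := etrans (esym (image_braid act3 s0 s1 I)) br; move: br.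
  have [il|il] := eqVneq i l.
    move=> br; have := etrans br (image_Qdiff act3 i j _ _ _ I XX) => /(eval_at N).
    rewrite !(nat_endM, nat_endB, nat_end_Qdiff) word_proj_idem word_idem3.
    by rewrite ta30 ta31 X0 X1 X2.
  move=> br; have := etrans br (anti0 (act_anti act3)) => /(eval_at N).
  rewrite !(nat_endM, nat_endB) word_proj_idem word_idem3 ta30 ta31 => ->.
  by rewrite nat_end0 compm0.
Qed.
End LocalFromPower.

(** * Extension of the local relations to all powers *)

Section Whiskering.
Variables (k : fieldType) (D : linCat k) (F G : functor D D).

Fact whiskR_nat (s : nat_end F) M N (f : hom M N) :
  s (G N) \oc fmap (compF F G) f = fmap (compF F G) f \oc s (G M).
Proof. exact: (natural s (fmap G f)). Qed.
Definition whiskR (s : nat_end F) : nat_end (compF F G) :=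
  @NatTrans k D D (compF F G) (compF F G) (fun M => s (G M)) (@whiskR_nat s).

Fact whiskL_nat (s : nat_end G) M N (f : hom M N) :
  fmap F (s N) \oc fmap (compF F G) f = fmap (compF F G) f \oc fmap F (s M).
Proof. by rewrite /= -!fmap_comp natural. Qed.
Definition whiskL (s : nat_end G) : nat_end (compF F G) :=
  @NatTrans k D D (compF F G) (compF F G) (fun M => fmap F (s M)) (@whiskL_nat s).

Fact whiskR2_nat (s : nat_end (compF F F)) M N (f : hom M N) :
  s (G N) \oc fmap (compF F (compF F G)) f =
  fmap (compF F (compF F G)) f \oc s (G M).
Proof. exact: (natural s (fmap G f)). Qed.
(** Its bracketing [compF F (compF F G)] is that of [powF], where [whiskR] would give
    [compF (compF F F) G]. *)
Definition whiskR2 (s : nat_end (compF F F)) : nat_end (compF F (compF F G)) :=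
  @NatTrans k D D (compF F (compF F G)) (compF F (compF F G))
    (fun M => s (G M)) (@whiskR2_nat s).
End Whiskering.

Section Powers.
Variables (k : fieldType) (D : linCat k) (m : nat).
Variables (Fi : 'I_m -> functor D D) (F : functor D D).
Variables (inc : forall i, nattrans (Fi i) F) (pr : forall i, nattrans F (Fi i)).
Hypothesis sumF : functor_sum inc pr.
Variables (x : nat_end F) (tau : nat_end (compF F F)).
Hypothesis loc : local_rels inc pr x tau.
Implicit Types (M N : D) (w : nat -> 'I_m).
Local Notation idem := (idem_word1 inc pr).
Local Notation idem2 := (idem_word2 inc pr).
Local Notation idem3 := (idem_word3 inc pr).
Local Notation powF := (powF F).
Local Notation E := (word_idem inc pr).
Local Notation X := (pow_x x).
Local Notation T := (pow_tau tau).

Lemma word_idemS d w M : E d.+1 w M = idem (w d) (powF d M) \oc fmap F (E d w M).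
Proof. by []. Qed.

Lemma word_idemSS d w M :
  E d.+2 w M = idem2 (w d) (w d.+1) (powF d M) \oc fmap F (fmap F (E d w M)).
Proof. by rewrite !word_idemS /idem_word2 fmap_comp -!compA. Qed.

Lemma word_idemSSS d w M : E d.+3 w M =
  idem3 (w d) (w d.+1) (w d.+2) (powF d M) \oc
  fmap F (fmap F (fmap F (E d w M))).
Proof. by rewrite word_idemS word_idemSS /idem_word3 fmap_comp -!compA. Qed.

(* The product is taken in End(F^{d+1}): its source and target are not
   syntactically images under F. *)
Lemma fmap_pow d M (a b : hom (powF d M) (powF d M)) :
  (fmap F a : hom (powF d.+1 M) (powF d.+1 M)) \oc
    (fmap F b : hom (powF d.+1 M) (powF d.+1 M)) = fmap F (a \oc b).
Proof. exact: (esym (fmap_comp F a b)). Qed.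

Lemma word_idem_low d w M (a b : hom (powF d M) (powF d M)) :
  E d w M \oc a = E d w M \oc b ->
  E d.+1 w M \oc fmap F a = E d.+1 w M \oc fmap F b.
Proof. by move=> ab; rewrite word_idemS -!compA -!fmap_comp ab. Qed.

(** The part of the idempotent on the lower strands is a morphism of the object F^d M, so by
    naturality it slides to the right of [a] and [b], and only the two top letters remain. *)
Lemma word_idem_top2 d w M (a b : nat_end (compF F F)) :
  (forall N, idem2 (w d) (w d.+1) N \oc a N = idem2 (w d) (w d.+1) N \oc b N) ->
  E d.+2 w M \oc a (powF d M) = E d.+2 w M \oc b (powF d M).
Proof.
move=> ab; rewrite word_idemSS -!compA.
have /= <- := natural a (E d w M); have /= <- := natural b (E d w M).
by rewrite !compA ab.
Qed.

Lemma word_idem_top3 d w M (a b : nat_end (compF F (compF F F))) :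
  (forall N, idem3 (w d) (w d.+1) (w d.+2) N \oc a N =
             idem3 (w d) (w d.+1) (w d.+2) N \oc b N) ->
  E d.+3 w M \oc a (powF d M) = E d.+3 w M \oc b (powF d M).
Proof.
move=> ab; rewrite word_idemSSS -!compA.
have /= <- := natural a (E d w M); have /= <- := natural b (E d w M).
by rewrite !compA ab.
Qed.

Lemma idem_idem i N : idem i N \oc idem i N = idem i N.
Proof. by rewrite /idem_word1 -!compA (preL (pr_inc sumF i N)) comp1m. Qed.

Lemma idem_orth i j N : i != j -> idem i N \oc idem j N = 0.
Proof.
by move=> ij; rewrite /idem_word1 -!compA (preL (pr_inc0 sumF N ij)) comp0m compm0.
Qed.

Lemma idem_sum N : \sum_i idem i N = idm (F N).
Proof. by have [_ _] := sumF N. Qed.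

Lemma word_idem_mul d w w' M : E d w M \oc E d w' M =
  if [forall a : 'I_d, w a == w' a] then E d w M else 0.
Proof.
elim: d => [|d IH]; first by rewrite comp1m; case: forallP => // -[] [].
rewrite !word_idemS -[LHS]compA (preR (esym (idem_nat inc pr (w' d) (E d w M)))).
rewrite -(fmap_comp F (E d w M) (E d w' M)) IH [LHS]compA.
case: (eqVneq (w d) (w' d)) => [wd|wd]; last first.
  rewrite idem_orth // comp0m; case: forallP => // /(_ ord_max) /=.
  by rewrite (negPf wd).
rewrite -wd idem_idem; have -> : [forall a : 'I_d, w a == w' a] =
    [forall a : 'I_d.+1, w a == w' a].
  apply/forallP/forallP => [h a|h a]; last exact: (h (widen_ord (leqnSn d) a)).
  case: (unliftP ord_max a) => [b ->|-> /=]; last exact/eqP.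
  by rewrite lift_max.
by case: ifP => _ //; rewrite linear0 compm0.
Qed.

Lemma word_idem_sum d M :
  \sum_(i : multi_index m d) word_proj inc pr i M = idm (powF d M).
Proof.
elim: d => [|d IH].
  pose i0 : multi_index m 0 := [ffun a : 'I_0 => False_rect _ (notF (ltn_ord a))].
  rewrite (bigD1 i0) //= big1 ?addr0 => [|i /eqP[]]; first exact: comp1m.
  by apply/ffunP; case.
(* A multi-index of length d + 1 amounts to its last letter and a multi-index of length d. *)
pose ext (p : 'I_m * multi_index m d) : multi_index m d.+1 :=
  [ffun a => if unlift ord_max a is Some b then p.2 b else p.1].
rewrite (reindex ext); last first.
  pose split_last (i : multi_index m d.+1) : 'I_m * multi_index m d :=
    (i ord_max, [ffun b : 'I_d => i (lift ord_max b)]).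
  exists split_last.
    move=> [j g] _; rewrite /split_last /ext ffunE unlift_none; congr pair.
    by apply/ffunP => b; rewrite !ffunE liftK.
  move=> i _; apply/ffunP => a; rewrite ffunE /=.
  by case: unliftP => [b ->|->] //; rewrite ffunE.
transitivity (\sum_j \sum_(g : multi_index m d) word_proj inc pr (ext (j, g)) M).
  by rewrite pair_bigA; apply: eq_bigr => -[j g] _.
transitivity (\sum_j idem j (powF d M)); last exact: idem_sum.
apply: eq_bigr => j _.
transitivity (\sum_(g : multi_index m d)
    idem j (powF d M) \oc fmap F (word_proj inc pr g M)).
  apply: eq_bigr => g _; rewrite word_projS ffunE unlift_none.
  congr (_ \oc fmap F (word_proj inc pr _ M)).
  apply: functional_extensionality_dep => b; rewrite ffunE.
  have -> : widen_ord (leqnSn d) b = lift ord_max b.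
    by apply: val_inj; rewrite /= /bump leqNgt ltn_ord.
  by rewrite liftK.
by rewrite -comp_sumr -linear_sum IH fmap_id compm1.
Qed.

Lemma word_idem_x d r w M : (r < d)%N -> E d w M \oc X d r M = X d r M \oc E d w M.
Proof.
elim: d => [//|d IH]; rewrite ltnS leq_eqVlt => /orP[/eqP->|rd].
  rewrite pow_x_top word_idemS -[LHS]compA -(natural x) [LHS]compA [RHS]compA.
  by rewrite (loc_xe loc).
rewrite pow_x_low // word_idemS -[LHS]compA -(fmap_comp F (E d w M)) IH // fmap_comp.
by rewrite [LHS]compA (idem_nat inc pr (w d) (X d r M)) -[LHS]compA.
Qed.

Lemma swap_word_lt r w n : (n < r)%N -> swap_word r w n = w n.
Proof. by move=> nr; rewrite /swap_word !ltn_eqF // ltnW. Qed.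

Lemma swap_word_gt r w n : (r.+1 < n)%N -> swap_word r w n = w n.
Proof. by move=> nr; rewrite /swap_word !gtn_eqF // ltnW. Qed.

Lemma word_idem_t d r w M : (r.+1 < d)%N ->
  E d w M \oc T d r M = T d r M \oc E d (swap_word r w) M.
Proof.
elim: d => [//|d IH]; rewrite ltnS leq_eqVlt => /orP[/eqP<-|rd].
  rewrite pow_tau_top !word_idemSS -compA.
  have /= <- := natural tau (E r w M).
  rewrite compA (loc_te loc) -compA /swap_word eqxx eqn_leq ltnn /= eqxx.
  congr (_ \oc (_ \oc fmap F (fmap F _))); apply: word_idem_ext => n nr.
  by rewrite -[LHS](swap_word_lt w nr).
rewrite pow_tau_low // !word_idemS -[LHS]compA -(fmap_comp F (E d w M)).
rewrite IH // fmap_comp [LHS]compA (idem_nat inc pr (w d) (T d r M)).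
by rewrite swap_word_gt // -[LHS]compA.
Qed.

Lemma pow_xx d a b M : (a < d)%N -> (b < d)%N ->
  X d a M \oc X d b M = X d b M \oc X d a M.
Proof.
elim: d => [//|d IH]; rewrite !ltnS (leq_eqVlt a) (leq_eqVlt b).
move=> /orP[/eqP->|ad] /orP[/eqP->|bd] //.
- by rewrite pow_x_top pow_x_low //; apply: (natural x).
- by rewrite pow_x_top pow_x_low //; apply: (esym (natural x _)).
by rewrite !pow_x_low // !fmap_pow IH.
Qed.

Lemma pow_tx d r a M : (r.+1 < d)%N -> (a < d)%N -> a != r -> a != r.+1 ->
  T d r M \oc X d a M = X d a M \oc T d r M.
Proof.
elim: d => [//|d IH]; rewrite ltnS leq_eqVlt => /orP[/eqP<-|rd].
  rewrite ltnS leq_eqVlt => /orP[/eqP->|]; first by rewrite eqxx.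
  rewrite ltnS leq_eqVlt => /orP[/eqP->|ar]; first by rewrite eqxx.
  move=> _ _; rewrite pow_tau_top !pow_x_low ?(leqW ar) //.
  exact: (natural tau).
rewrite ltnS leq_eqVlt => /orP[/eqP->|ad] ar ar1.
  by rewrite pow_x_top pow_tau_low //; apply: (esym (natural x _)).
by rewrite pow_tau_low // pow_x_low // !fmap_pow IH.
Qed.

Lemma pow_tt d r s M : (s.+1 < d)%N -> (r.+1 < s)%N ->
  T d r M \oc T d s M = T d s M \oc T d r M.
Proof.
elim: d => [//|d IH]; rewrite ltnS leq_eqVlt => /orP[/eqP<-|sd] rs.
  rewrite pow_tau_top !pow_tau_low //; last by rewrite ltnW.
  exact: (esym (natural tau _)).
have rd : (r.+1 < d)%N := ltn_trans rs (ltnW sd).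
by rewrite !pow_tau_low // !fmap_pow IH.
Qed.

Let scale_low d (c : k) M : c *: idm (powF d.+1 M) = fmap F (c *: idm (powF d M)).
Proof. by rewrite linearZ /= fmap_id. Qed.

(** Induction on d: either the crossing is on the top strands, where the local relation holds at the
    object F^r M, or the relation is the image under F of one on F^d. The square and braid relations
    are proved in the same way. *)
Lemma pow_slide_in d r w M : (r.+1 < d)%N ->
  E d w M \oc (T d r M \oc X d r.+1 M) =
  E d w M \oc (X d r M \oc T d r M + (w r == w r.+1)%:R *: idm _).
Proof.
elim: d => [//|d IH]; rewrite ltnS leq_eqVlt => /orP[/eqP<-|rd].
  rewrite pow_tau_top pow_x_top pow_x_low // pow_x_top.
  exact: (@word_idem_top2 r w M ((tau : nat_end _) * whiskR F x)
    (whiskL F x * tau +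
      ((w r == w r.+1)%:R *: (1 : nat_end (compF F F)) : nat_end _))
    (loc_in loc _ _)).
rewrite !pow_tau_low // !pow_x_low // 1?ltnW // scale_low !fmap_pow -linearD.
exact/word_idem_low/IH.
Qed.

Lemma pow_slide_out d r w M : (r.+1 < d)%N ->
  E d w M \oc (X d r.+1 M \oc T d r M) =
  E d w M \oc (T d r M \oc X d r M + (w r == w r.+1)%:R *: idm _).
Proof.
elim: d => [//|d IH]; rewrite ltnS leq_eqVlt => /orP[/eqP<-|rd].
  rewrite pow_tau_top pow_x_top pow_x_low // pow_x_top.
  exact: (@word_idem_top2 r w M (whiskR F x * tau)
    ((tau : nat_end _) * whiskL F x +
      ((w r == w r.+1)%:R *: (1 : nat_end (compF F F)) : nat_end _))
    (loc_out loc _ _)).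
rewrite !pow_tau_low // !pow_x_low // 1?ltnW // scale_low !fmap_pow -linearD.
exact/word_idem_low/IH.
Qed.

Lemma pow_square d r w M : (r.+1 < d)%N ->
  E d w M \oc (T d r M \oc T d r M) =
  E d w M \oc Qpoly (w r) (w r.+1) (X d r M : endo _) (X d r.+1 M).
Proof.
elim: d => [//|d IH]; rewrite ltnS leq_eqVlt => /orP[/eqP<-|rd].
  rewrite pow_tau_top pow_x_top pow_x_low // pow_x_top.
  pose b : nat_end (compF F F) := Qpoly (w r) (w r.+1) (whiskL F x) (whiskR F x).
  have be N : b N = Qpoly (w r) (w r.+1) (fmap F (x N) : endo (F (F N))) (x (F N)).
    exact: nat_end_Qpoly.
  rewrite -be; apply: (@word_idem_top2 r w M ((tau : nat_end _) * tau) b) => N.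
  by rewrite be; apply: loc_square loc _ _ _.
rewrite !pow_tau_low // !pow_x_low // 1?ltnW // fmap_pow.
have := word_idem_low (IH rd).
by rewrite (fmap_Qpoly F (w r) (w r.+1) (X d r M : endo _) (X d r.+1 M)).
Qed.

Lemma pow_braid d r w M : (r.+2 < d)%N ->
  E d w M \oc (T d r.+1 M \oc (T d r M \oc T d r.+1 M) -
               T d r M \oc (T d r.+1 M \oc T d r M)) =
  E d w M \oc (if w r == w r.+2 then
    Qdiff (w r) (w r.+1) (X d r M : endo _) (X d r.+1 M) (X d r.+2 M) else 0).
Proof.
elim: d => [//|d IH]; rewrite ltnS leq_eqVlt => /orP[/eqP<-|rd].
  rewrite !pow_tau_top pow_tau_low // pow_tau_top.
  have -> : X r.+3 r M = fmap F (fmap F (x (powF r M))).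
    by rewrite pow_x_low 1?pow_x_low ?pow_x_top // ltnW.
  have -> : X r.+3 r.+1 M = fmap F (x (powF r.+1 M)).
    by rewrite pow_x_low ?pow_x_top.
  rewrite pow_x_top; pose t1 := whiskR2 F tau; pose t0 := whiskL F tau.
  pose b : nat_end (compF F (compF F F)) := if w r == w r.+2 then
    Qdiff (w r) (w r.+1) (whiskL F (whiskL F x)) (whiskL F (whiskR F x))
      (whiskR (compF F F) x) else 0.
  have be N : b N = if w r == w r.+2 then
    Qdiff (w r) (w r.+1) (fmap F (fmap F (x N)) : endo (F (F (F N))))
      (fmap F (x (F N))) (x (F (F N))) else 0.
    by rewrite /b; case: ifP => _ //; apply: nat_end_Qdiff.
  rewrite -be.
  pose a : nat_end (compF F (compF F F)) := t1 * (t0 * t1) - t0 * (t1 * t0).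
  have ae N : a N = tau (F N) \oc (fmap F (tau N) \oc tau (F N)) -
       fmap F (tau N) \oc (tau (F N) \oc fmap F (tau N)).
    exact: nat_endB.
  rewrite -ae; apply: (@word_idem_top3 r w M a b) => N.
  by rewrite ae be; apply: loc_braid loc _ _ _ _.
have rd1 : (r.+1 < d)%N := ltnW rd; have rd0 : (r < d)%N := ltnW rd1.
rewrite !pow_tau_low // !pow_x_low // !fmap_pow -linearB.
rewrite [X in _ = _ \oc X](_ : _ = fmap F (if w r == w r.+2 then
    Qdiff (w r) (w r.+1) (X d r M : endo _) (X d r.+1 M) (X d r.+2 M) else 0)).
  exact/word_idem_low/IH.
case: ifP => _; last by rewrite linear0.
exact/esym/(Qdiff_morph _ _ (fmap_endo F (X := powF d M))).
Qed.

Section Action.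
Variables (d : nat) (Psi : {malg k[{fmonom (klr_gen m d)}]} -> nat_end (powF d)).
Hypothesis act : power_gens inc pr x tau Psi.
Hypothesis m0 : (0 < m)%N.

Lemma power_gens_rel u v : klr_rel u v -> Psi u = Psi v.
Proof.
have word i : exists w, i = prefix_index d w := prefix_indexK (Ordinal m0) i.
have XX (a b : 'I_d) : (X d a : nat_end _) * X d b = X d b * X d a.
  by apply: nattransP => M; apply: pow_xx.
case=> [i j||a i|r i|a b|r i|r i|r a|r s|r i|r s i].
- apply: etrans (image_ee act i j) _; apply: nattransP => M; rewrite nat_endM.
  have [w ->] := word i; have [w' ->] := word j.
  rewrite !word_proj_idem word_idem_mul; case: eqP => [E|N].
    rewrite (act_e act) word_proj_idem.
    have ww' (n : 'I_d) : w n = w' n.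
      by move/ffunP/(_ n): E; rewrite !ffunE.
    have -> : [forall a : 'I_d, w' a == w a] by apply/forallP => a; rewrite ww'.
    by apply: word_idem_ext => n nd; rewrite (ww' (Ordinal nd)).
  case: forallP => [h|_]; last by rewrite (anti0 (act_anti act)).
  by case: N; apply/ffunP => a; rewrite !ffunE; apply/eqP; rewrite eq_sym.
- apply: etrans (anti_sum_eq (act_anti act) (act_e act)) _.
  rewrite (anti1 (act_anti act)); apply: nattransP => M.
  rewrite nat_end1 -(word_idem_sum d M).
  by apply: (big_morph (fun s : nat_end (powF d) => s M)).
- apply: etrans (image_xe act a i) (etrans _ (esym (image_ex act a i))).
  apply: nattransP => M; rewrite !nat_endM; have [w ->] := word i.
  by rewrite word_proj_idem word_idem_x.
- apply: etrans (image_te act r i) (etrans _ (esym (image_et act r _))).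
  apply: nattransP => M; rewrite !nat_endM; have [w ->] := word i.
  rewrite swap_prefix_index !word_proj_idem word_idem_t //.
  exact: strand_hi_subproof.
- apply: etrans (image_xx act a b) (etrans _ (esym (image_xx act b a))).
  exact: XX.
- apply: etrans (image_txe act r _ i) (etrans _ (esym (image_xt1e act r _ i _))).
  apply: nattransP => M; rewrite !(nat_endM, nat_endD, nat_end_bool).
  have [w ->] := word i; rewrite word_proj_idem !ffunE.
  by rewrite pow_slide_out //; apply: strand_hi_subproof.
- apply: etrans (image_xte act r _ i) (etrans _ (esym (image_tx1e act r _ i _))).
  apply: nattransP => M; rewrite !(nat_endM, nat_endD, nat_end_bool).
  have [w ->] := word i; rewrite word_proj_idem !ffunE.
  by rewrite pow_slide_in //; apply: strand_hi_subproof.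
- move=> alo ahi.
  apply: etrans (image_tx act r a) (etrans _ (esym (image_xt act r a))).
  apply: nattransP => M; rewrite !nat_endM; apply/esym/pow_tx => //.
  exact: strand_hi_subproof.
- move=> rs; apply: etrans (image_tt act r s) (etrans _ (esym (image_tt act s r))).
  apply: nattransP => M; rewrite !nat_endM; case/orP: rs => rs.
    by apply/esym/pow_tt => //; apply: strand_hi_subproof.
  by apply/pow_tt => //; apply: strand_hi_subproof.
- apply: etrans (image_tte act r i) (etrans _ (esym (image_Qpoly act _ _ _ _ i))).
  apply: nattransP => M; rewrite !(nat_endM, nat_end_Qpoly).
  have [w ->] := word i; rewrite word_proj_idem !ffunE.
  by rewrite pow_square //; apply: strand_hi_subproof.
- move=> sr; apply: etrans (image_braid act r s i) _.
  have sd : (r.+2 < d)%N by rewrite -sr; apply: strand_hi_subproof.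
  have [w ->] := word i; have br M := pow_braid w M sd.
  rewrite !ffunE /= sr; move: br; case: ifP => _ br.
    apply: etrans (esym (image_Qdiff act _ _ _ _ _ _ XX)).
    apply: nattransP => M; rewrite !(nat_endM, nat_endB, nat_end_Qdiff).
    by rewrite word_proj_idem /= sr br.
  rewrite (anti0 (act_anti act)); apply: nattransP => M.
  by rewrite !(nat_endM, nat_endB) word_proj_idem br compm0.
Qed.
End Action.
End Powers.

Section KlrAction.
Variables (k : fieldType) (D : linCat k) (m : nat).
Variables (Fi : 'I_m -> functor D D) (F : functor D D).
Variables (inc : forall i, nattrans (Fi i) F) (pr : forall i, nattrans F (Fi i)).
Hypothesis sumF : functor_sum inc pr.
Variables (x : nat_end F) (tau : nat_end (compF F F)).
Hypothesis loc : local_rels inc pr x tau.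
Hypothesis m0 : (0 < m)%N.

Lemma klr_action d : exists psi : klr k m d -> nat_end (powF F d),
  [/\ linear psi, psi 1 = 1 & forall a b, psi (a * b) = psi b * psi a] /\
  [/\ forall i : multi_index m d, psi (klr_e k i) = word_proj inc pr i,
      forall a : 'I_d, psi (klr_x k m a) = pow_x x d a
    & forall r : 'I_d.-1, psi (klr_tau k m r) = pow_tau tau d r].
Proof.
pose g (u : klr_gen m d) : nat_end (powF F d) :=
  match u with
  | inl (inl i) => word_proj inc pr i
  | inl (inr a) => pow_x x d a
  | inr r => pow_tau tau d r
  end.
pose Psi := free_eval g.
have act : power_gens inc pr x tau Psi.
  split; first exact: free_eval_anti.
  - by move=> i; apply: (free_eval_gen g (inl (inl i))).
  - by move=> a; apply: (free_eval_gen g (inl (inr a))).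
  - by move=> r; apply: (free_eval_gen g (inr r)).
have an := act_anti act.
have span0 u : ideal_span (@klr_rel k m d) u -> Psi u = 0.
  elim=> [|a u' v b z uv _ IH]; first exact: anti0 an.
  have E := antiD_eq an (antiM_eq an (antiM_eq an (erefl (Psi a))
    (antiB_eq an (erefl (Psi u')) (erefl (Psi v)))) (erefl (Psi b))) IH.
  apply: etrans E _.
  by rewrite (power_gens_rel sumF loc act m0 uv) subrr mul0r mulr0 addr0.
(* Defined on representatives; by [span0] the choice of a representative is immaterial. *)
pose psi (q : klr k m d) : nat_end (powF F d) := Psi (repr q).
have psiE u : psi (quot_pi (@klr_rel k m d) u) = Psi u.
  apply/eqP; rewrite -subr_eq0 -(anti_sub an); apply/eqP/span0.
  by apply/quot_piP; apply: quot_reprK.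
exists psi; split; split.
- move=> c; elim/quot_ind=> a; elim/quot_ind=> b.
  apply: etrans (congr1 psi (esym (quot_pi_linear (@klr_rel k m d) c a b))) _.
  apply: etrans (psiE _) _; apply: etrans (free_eval_linear g c a b) _.
  by congr (c *: _ + _); apply: (esym (psiE _)).
- by rewrite -(anti1 an); apply: psiE.
- elim/quot_ind=> a; elim/quot_ind=> b.
  apply: etrans (congr1 psi (esym (quot_pi_mul (@klr_rel k m d) a b))) _.
  apply: etrans (psiE _) _; apply: etrans (antiM an a b) _.
  by congr (_ * _); apply: (esym (psiE _)).
- by move=> i; apply: etrans (psiE _) (act_e act i).
- by move=> a; apply: etrans (psiE _) (act_x act a).
- by move=> r; apply: etrans (psiE _) (act_t act r).
Qed.
End KlrAction.

(** * Nilpotency of dots *)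

Section Nilpotency.
Variables (k : fieldType) (C : linCat k).

Lemma iter_comp_intertwine (X Y : C) (f : hom X Y) (u : hom X X) (v : hom Y Y) n :
  v \oc f = f \oc u ->
  iter n (comp v) (idm Y) \oc f = f \oc iter n (comp u) (idm X).
Proof.
move=> E; elim: n => [|n IH] /=; first by rewrite comp1m compm1.
by rewrite -compA IH !compA E.
Qed.

Lemma iter_comp_fmap (D : linCat k) (F : functor C D) (X : C) (u : hom X X) n :
  iter n (comp (fmap F u)) (idm (F X)) = fmap F (iter n (comp u) (idm X)).
Proof.
elim: n => [|n IH] /=; first by rewrite fmap_id.
by rewrite IH fmap_comp.
Qed.

Lemma iter_comp_zero (X : C) (u : hom X X) n p : (n <= p)%N ->
  iter n (comp u) (idm X) = 0 -> iter p (comp u) (idm X) = 0.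
Proof.
move=> /subnK <- E; rewrite iterD E.
by elim: (p - n)%N => [|q IH] //=; rewrite IH compm0.
Qed.
End Nilpotency.

(** * Representations as families of functors *)

Section Family.
Variables (k : fieldType) (D : linCat k) (m : nat).
Implicit Types Fi Ei : 'I_m -> functor D D.

(** The predicate [P] is trivial for a representation and is [in_sub] for the merged family in the
    ambient category. *)
Definition klr_family Fi (P : D -> Prop) : Prop :=
  exists (xi : forall i, nattrans (Fi i) (Fi i))
         (t : forall i j, cross (Fi i) (Fi j)),
    klr_rels P xi t /\
    forall i M, P M -> exists n, iter n (comp (xi i M)) (idm (Fi i M)) = 0.

Section Sum.
Variables (Fi : 'I_m -> functor D D) (F : functor D D).
Variables (inc : forall i, nattrans (Fi i) F) (pr : forall i, nattrans F (Fi i)).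
Hypothesis sumF : functor_sum inc pr.
Local Notation pr2 := (pr_word2 pr).
Local Notation inc2 := (inc_word2 inc).

Lemma pr2_nat i j N N' (f : hom N N') :
  pr2 i j N' \oc fmap F (fmap F f) = fmap (Fi j) (fmap (Fi i) f) \oc pr2 i j N.
Proof.
by rewrite /pr_word2 -compA (natural (pr j)) !compA -!fmap_comp (natural (pr i)).
Qed.

Lemma inc2_nat i j N N' (f : hom N N') :
  inc2 i j N' \oc fmap (Fi j) (fmap (Fi i) f) = fmap F (fmap F f) \oc inc2 i j N.
Proof.
rewrite /inc_word2 -compA -fmap_comp (natural (inc i)) fmap_comp !compA.
by rewrite (natural (inc j)).
Qed.

Lemma pr_inc2_0 i j i' j' N : (i, j) != (i', j') ->
  pr2 i j N \oc inc2 i' j' N = 0.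
Proof.
move=> ij; rewrite /pr_word2 /inc_word2 -compA [pr j _ \oc _]compA.
have [E|jj'] := eqVneq j j'; last by rewrite (pr_inc0 sumF _ jj') comp0m compm0.
subst j'; rewrite (pr_inc sumF) comp1m -fmap_comp (pr_inc0 sumF) ?linear0 //.
by apply: contraNneq ij => ->.
Qed.

Section FromComponents.
Variables (xi : forall i, nattrans (Fi i) (Fi i)).
Variable t : forall i j, cross (Fi i) (Fi j).

Fact sum_x_nat M N (f : hom M N) :
  (\sum_i inc i N \oc (xi i N \oc pr i N)) \oc fmap F f =
  fmap F f \oc \sum_i inc i M \oc (xi i M \oc pr i M).
Proof.
rewrite comp_suml comp_sumr; apply: eq_bigr => i _.
rewrite -!compA (natural (pr i)) (preR (natural (xi i) f)).
by rewrite (preR (natural (inc i) f)).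
Qed.
Definition sum_x : nat_end F := @NatTrans k D D F F _ sum_x_nat.

Fact sum_tau_nat M N (f : hom M N) :
  (\sum_(p : 'I_m * 'I_m)
     inc2 p.2 p.1 N \oc (t p.1 p.2 N \oc pr2 p.1 p.2 N)) \oc fmap (compF F F) f =
  fmap (compF F F) f \oc (\sum_(p : 'I_m * 'I_m)
     inc2 p.2 p.1 M \oc (t p.1 p.2 M \oc pr2 p.1 p.2 M)).
Proof.
rewrite comp_suml comp_sumr; apply: eq_bigr => p _ /=.
rewrite -[LHS]compA -[(_ \oc pr2 _ _ _) \oc _]compA pr2_nat.
rewrite (preR (cross_nat (t _ _) f)) [RHS]compA -inc2_nat -[RHS]compA.
by [].
Qed.
Definition sum_tau : nat_end (compF F F) :=
  @NatTrans k D D (compF F F) (compF F F) _ sum_tau_nat.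

Lemma sum_x_pr i N : pr i N \oc sum_x N = xi i N \oc pr i N.
Proof.
rewrite /= comp_sumr (bigD1 i) //= big1 ?addr0 => [|j ji].
  by rewrite (preL (pr_inc sumF _ _)) comp1m.
by rewrite (preL (pr_inc0 sumF _ _)) ?comp0m // eq_sym.
Qed.

Lemma sum_x_inc i N : sum_x N \oc inc i N = inc i N \oc xi i N.
Proof.
rewrite /= comp_suml (bigD1 i) //= big1 ?addr0 => [|j ji].
  by rewrite -!compA (pr_inc sumF) compm1.
by rewrite -!compA (pr_inc0 sumF) // !compm0.
Qed.

Lemma sum_tau_pr i j N : pr2 j i N \oc sum_tau N = t i j N \oc pr2 i j N.
Proof.
rewrite /= comp_sumr (bigD1 (i, j)) //= big1 ?addr0 => [|[i' j'] ij].
  by rewrite (preL (pr_inc2 sumF _ _ _)) comp1m.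
rewrite (preL (pr_inc2_0 _ _)) ?comp0m //.
by apply: contraNneq ij => -[-> ->].
Qed.

Lemma sum_tau_inc i j N : sum_tau N \oc inc2 i j N = inc2 j i N \oc t i j N.
Proof.
rewrite /= comp_suml (bigD1 (i, j)) //= big1 ?addr0 => [|[i' j'] ij].
  rewrite -[LHS]compA -[(_ \oc pr2 _ _ _) \oc _]compA (pr_inc2 sumF).
  by rewrite compm1.
rewrite -[LHS]compA -[(_ \oc pr2 _ _ _) \oc _]compA pr_inc2_0 ?compm0 //.
Qed.

Lemma sum_nilp : (forall i M, exists n, iter n (comp (xi i M)) (idm (Fi i M)) = 0) ->
  forall M, exists n, iter n (comp (sum_x M)) (idm (F M)) = 0.
Proof.
move=> nil M; have /choice[n hn] := fun i => nil i M.
exists (\max_i n i)%N; apply: (biproduct_coext (sumF M)) => i.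
rewrite compm0 -(iter_comp_intertwine _ (esym (sum_x_pr i M))).
by rewrite (iter_comp_zero _ (hn i)) ?comp0m //; apply: leq_bigmax.
Qed.
End FromComponents.

Section ToComponents.
Variables (x : nat_end F) (tau : nat_end (compF F F)).
Hypothesis loc : local_rels inc pr x tau.

Fact comp_x_nat i M N (f : hom M N) :
  (pr i N \oc (x N \oc inc i N)) \oc fmap (Fi i) f =
  fmap (Fi i) f \oc (pr i M \oc (x M \oc inc i M)).
Proof.
rewrite -!compA (natural (inc i)) (preR (natural x f)).
by rewrite (preR (natural (pr i) f)).
Qed.
Definition comp_x i : nattrans (Fi i) (Fi i) :=
  @NatTrans k D D (Fi i) (Fi i) _ (@comp_x_nat i).

Fact comp_t_nat i j M N (f : hom M N) :
  (pr2 j i N \oc (tau N \oc inc2 i j N)) \oc fmap (compF (Fi j) (Fi i)) f =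
  fmap (compF (Fi i) (Fi j)) f \oc (pr2 j i M \oc (tau M \oc inc2 i j M)).
Proof.
rewrite -[LHS]compA -[(_ \oc inc2 _ _ _) \oc _]compA inc2_nat.
have /= E := natural tau f.
by rewrite (preR E) (preR (pr2_nat j i f)).
Qed.
Definition comp_t i j : cross (Fi i) (Fi j) :=
  @NatTrans k D D (compF (Fi j) (Fi i)) (compF (Fi i) (Fi j)) _ (@comp_t_nat i j).

(** As [x] commutes with the idempotents, its blocks between different letters vanish. *)
Lemma comp_x_pr i N : pr i N \oc x N = comp_x i N \oc pr i N.
Proof.
rewrite /= -!compA -/(idem_word1 inc pr i N) -(loc_xe loc) /idem_word1 -!compA.
by rewrite (preL (pr_inc sumF _ _)) comp1m.
Qed.

Lemma comp_t_pr i j N : pr2 j i N \oc tau N = comp_t i j N \oc pr2 i j N.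
Proof.
rewrite /= -[RHS]compA -[(_ \oc inc2 _ _ _) \oc _]compA -(idem2E inc pr).
have E : idem_word2 inc pr j i N \oc tau N = inc2 j i N \oc (pr2 j i N \oc tau N).
  by rewrite idem2E -[LHS]compA.
rewrite -(loc_te loc) E.
by rewrite (preL (pr_inc2 sumF _ _ _)) comp1m.
Qed.

Lemma comp_x_inc i N : x N \oc inc i N = inc i N \oc comp_x i N.
Proof.
rewrite /= [RHS]compA -/(idem_word1 inc pr i N) [RHS]compA (loc_xe loc).
rewrite /idem_word1 -!compA.
by rewrite (pr_inc sumF) compm1.
Qed.

Lemma comp_nilp i M : (exists n, iter n (comp (x M)) (idm (F M)) = 0) ->
  exists n, iter n (comp (comp_x i M)) (idm (Fi i M)) = 0.
Proof.
move=> [n hn]; exists n; rewrite -[LHS]comp1m -[X in X \oc _](pr_inc sumF) -compA.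
by rewrite -(iter_comp_intertwine _ (comp_x_inc i M)) hn comp0m compm0.
Qed.

Lemma comp_klr_family : (forall M, exists n, iter n (comp (x M)) (idm (F M)) = 0) ->
  klr_family Fi (fun=> True).
Proof.
move=> nil; exists comp_x, comp_t; split=> [|i M _]; last exact: comp_nilp.
exact: (local_klr_rels sumF comp_x_pr comp_t_pr loc).
Qed.
End ToComponents.
End Sum.

Lemma rep_klr_family (Dw : weight m -> D -> Prop) Ei Fi (rep : cat_rep Dw Ei Fi) :
  klr_family Fi (fun=> True).
Proof.
apply: (comp_klr_family (rep_sumF rep) _ (rep_nilp rep) (tau := rep_tau rep)).
apply: power_local_rels => d.
have [psi [[h1 h2 h3] [h4 h5 h6]]] := rep_klr rep d.
exists (fun g => psi (quot_pi (@klr_rel k m d) g)); split.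
  exact: psi_power_gens.
by move=> u v /klr_rel_quot ->.
Qed.

(** The sums E and F inherit biadjointness from their components, and biadjoint functors are exact,
    so exactness is not an input. *)
Lemma klr_family_rep (Dw : weight m -> D -> Prop) Ei Fi : (0 < m)%N ->
  abelian D -> decomposition Dw ->
  (forall i, adjoint (Ei i) (Fi i)) -> (forall i, adjoint (Fi i) (Ei i)) ->
  (forall i mu X, Dw mu X -> Dw (mu + alpha i) (Ei i X)) ->
  (forall i mu X, Dw mu X -> Dw (mu - alpha i) (Fi i X)) ->
  klr_family Fi (fun=> True) -> inhabited (cat_rep Dw Ei Fi).
Proof.
move=> m0 abD decD adjEF adjFE wE wF [xi [t [rels nil]]].
have [E [incE [prE sumE]]] := functor_sum_exists Ei abD.
have [F [incF [prF sumF]]] := functor_sum_exists Fi abD.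
have aEF := adjoint_sum sumE sumF adjEF; have aFE := adjoint_sum sumF sumE adjFE.
have loc : local_rels incF prF (sum_x incF prF xi) (sum_tau incF prF t).
  apply: (klr_local_rels sumF (sum_x_pr sumF xi) (sum_tau_pr sumF t)) => //.
    exact: sum_tau_inc.
  exact: sum_x_inc.
constructor; apply: (CatRep (rep_E := E) (rep_F := F) (rep_x := sum_x incF prF xi)
  (rep_tau := sum_tau incF prF t) abD decD aEF aFE _ _ sumE sumF wE wF).
- exact: biadjoint_exact aEF aFE.
- exact: biadjoint_exact aFE aEF.
- exact: klr_action.
- by apply: (sum_nilp sumF) => i M; apply: nil.
Qed.
End Family.

(** * The thin representation *)

Section ThinFamily.
Variables (K : fieldType) (e : nat) (l : 'I_e).
Hypothesis e1 : (1 < e)%N.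
Variables (C : linCat K) (Cw : weight e.+1 -> C -> Prop).
Variable Fb : 'I_e.+1 -> functor C C.
Hypothesis weightF : forall i mu X, Cw mu X -> Cw (mu - alpha i) (Fb i X).
Hypothesis neg0 : forall mu : weight e.+1, (exists j, mu 0 j < 0) ->
  forall X : C, Cw mu X -> is_zero X.
Local Notation b1 := (low l).
Local Notation b2 := (up l).
Local Notation P := (in_sub l Cw).

(** The weights of M have the entry 0 in column [b1], so on each weight summand the entry after
    applying G is that of [nu], which is negative. *)
Lemma weight_shift_zero (G : functor C C) (nu : weight e.+1) :
  (forall mu X, Cw mu X -> Cw (mu + nu) (G X)) -> nu 0 b1 < 0 ->
  forall M, P M -> idm (G M) = 0.
Proof.
move=> wG nu0 M [n [mu [Xs [hXs dsM]]]].
apply: (direct_sum_zero (functor_direct_sum G dsM)) => a; apply/is_zeroP.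
apply: (neg0 _ (wG _ _ (hXs a))); exists b1; rewrite !mxE.
by rewrite unlift_none add0r.
Qed.

Lemma alpha_entry n (i j : 'I_n) :
  alpha i 0%R j = (j == ord_pred i)%:R - (j == i)%:R :> int.
Proof. by rewrite alphaE !mxE. Qed.

Let entryD (mu nu : weight e.+1) : (mu + nu) 0%R b1 = mu 0%R b1 + nu 0%R b1.
Proof. by rewrite mxE. Qed.
Let entryN (mu : weight e.+1) : (- mu) 0%R b1 = - mu 0%R b1.
Proof. by rewrite mxE. Qed.

Lemma ord_pred_low : (b1 == ord_pred b1) = false.
Proof.
apply/negbTE/eqP => /(congr1 (@nat_of_ord _)); rewrite val_ord_pred /=.
by have := e1; have := ltn_ord l; case: eqP => /=; lia.
Qed.

Lemma ord_pred_up : b1 == ord_pred b2.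
Proof.
by apply/eqP/val_inj/esym; apply: etrans (val_ord_pred b2) _.
Qed.

Lemma alpha_b1 : alpha b1 0%R b1 = -1.
Proof. by rewrite alpha_entry ord_pred_low eqxx sub0r. Qed.

Lemma alpha_b2 : alpha b2 0%R b1 = 1.
Proof. by rewrite alpha_entry ord_pred_up (negPf (pair_neq l)) subr0. Qed.

(** The support of [alpha a] consists of the columns of [a] and of its predecessor, and [b1] is the
    predecessor of [b2] alone. *)
Lemma alpha_single a : is_single l a -> alpha a 0%R b1 = 0.
Proof.
move=> sa; have /andP[a1 a2] := sa.
rewrite alpha_entry [b1 == a]eq_sym (negPf a1) subr0.
case: eqP => // E; case/eqP: a2.
by rewrite -[a]ord_predK -E (eqP ord_pred_up) ord_predK.
Qed.

Lemma F2_vanish M : P M -> idm (Fb b2 M) = 0.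
Proof.
apply: (weight_shift_zero (weightF b2)).
by rewrite entryN alpha_b2.
Qed.

Lemma F22_vanish M a : P M -> is_single l a ->
  idm (Fb b2 (Fb b2 (Fb a (Fb b1 M)))) = 0.
Proof.
move=> PM sa.
apply: (weight_shift_zero (G := compF (Fb b2) (compF (Fb b2) (compF (Fb a) (Fb b1))))
  (nu := - alpha b1 - alpha a - alpha b2 - alpha b2)) PM.
  by move=> mu X hX; rewrite !addrA; do 4!apply: weightF.
(* The entry in column [b1] is 1 + 0 - 1 - 1 = -1; for the word 11222 below it is 1 + 1 - 1 - 1 - 1
   = -1. *)
have := alpha_single sa; move: alpha_b1 alpha_b2.
move: (alpha b1) (alpha a) (alpha b2) => u v w hu hw hv.
by rewrite !(entryD, entryN) hu hv hw.
Qed.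

Lemma F222_vanish M : P M ->
  idm (Fb b2 (Fb b2 (Fb b2 (Fb b1 (Fb b1 M))))) = 0.
Proof.
move=> PM.
apply: (weight_shift_zero (G := compF (Fb b2) (compF (Fb b2) (compF (Fb b2)
  (compF (Fb b1) (Fb b1))))) (nu := - alpha b1 - alpha b1 - alpha b2 - alpha b2 -
  alpha b2)) PM.
  by move=> mu X hX; rewrite !addrA; do 5!apply: weightF.
move: alpha_b1 alpha_b2; move: (alpha b1) (alpha b2) => u w hu hw.
by rewrite !(entryD, entryN) hu hw.
Qed.

Lemma merge_code i : mergeF l Fb i = merged_functor l Fb (code l i).
Proof. by rewrite /mergeF /code; case: ifP => // _; case: ifP. Qed.

Lemma code_surj p : code_valid l p -> exists i, code l i = p.
Proof.
case: p => [a|] /= sa; last by exists l; rewrite /code ltnn eqxx.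
move: sa; rewrite is_singleE => /andP[a1 a2].
case: (ltnP a l) => al.
  have ae : (a < e)%N := ltn_trans al (ltn_ord l).
  exists (Ordinal ae); rewrite /code /= al; congr Some; exact: val_inj.
have ae : (a.-1 < e)%N by have := ltn_ord a; have := ltn_ord l; lia.
exists (Ordinal ae); rewrite /code /=.
have -> : (a.-1 < l)%N = false by lia.
have -> : (Ordinal ae == l) = false by rewrite -val_eqE /=; lia.
by congr Some; apply: val_inj; rewrite /= /bump /=; lia.
Qed.

Lemma merged_stable p M : code_valid l p -> P M -> P (merged_functor l Fb p M).
Proof. by move=> /code_surj[i <-]; rewrite -merge_code; apply: mergeF_stable. Qed.

Lemma merged_klr_family : klr_family Fb (fun=> True) -> klr_family (mergeF l Fb) P.
Proof.
move=> [x [t [rels nil]]].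
(* The family is replaced as a whole, so that no equality of functors has to be transported through
   the crossings. *)
have -> : mergeF l Fb = fun i => merged_functor l Fb (code l i).
  by apply: functional_extensionality_dep => i; apply: merge_code.
exists (fun i => merged_x l x (code l i)).
exists (fun i j => merged_t l t (code l i) (code l j)).
split.
  exact: (merged_rels e1 rels merged_stable F2_vanish F22_vanish F222_vanish).
move=> i M PM; case: (code l i) => [a|]; first exact: nil.
(* The dot of the pair is F_2 applied to the dot on F_1, so the same exponent works. *)
have [n hn] := nil b1 M I; exists n.
by rewrite /= /pair_x_comp iter_comp_fmap hn linear0.
Qed.
End ThinFamily.

Section Restriction.
Variables (K : fieldType) (C : linCat K) (P : C -> Prop) (m : nat).
Variables (Fi : 'I_m -> functor C C) (stable : forall i X, P X -> P (Fi i X)).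
Local Notation R := (fun i => restrict (stable i)).

(** Morphisms of a full subcategory are those of the ambient category, so dots and crossings
    restrict unchanged, and [P] holds at every object of the subcategory. *)
Lemma restrict_klr_family : klr_family Fi P -> klr_family R (fun=> True).
Proof.
move=> [x [t [rels nil]]].
pose xr i : nattrans (R i) (R i) := @NatTrans K (full_sub P) (full_sub P) (R i) (R i)
  (fun X => x i (sval X)) (fun X Y f => natural (x i) f).
pose tr i j : cross (R i) (R j) := @NatTrans K (full_sub P) (full_sub P)
  (compF (R j) (R i)) (compF (R i) (R j))
  (fun X => t i j (sval X)) (fun X Y f => natural (t i j) f).
exists xr, tr; split; last by move=> i M _; apply: nil; apply: (svalP M).
split.
- move=> i j M _; exact: (rel_slide_in rels (svalP M)).
- move=> i j M _; exact: (rel_slide_out rels (svalP M)).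
- move=> i M _; exact: (rel_slide_in_eq rels _ (svalP M)).
- move=> i M _; exact: (rel_slide_out_eq rels _ (svalP M)).
- move=> i j M _; exact: (rel_square rels _ _ (svalP M)).
- move=> i j h M _; exact: (rel_braid rels _ (svalP M)).
- move=> i j M _; exact: (rel_braid_eq rels _ _ (svalP M)).
Qed.
End Restriction.

Theorem theorem1p1 (K : fieldType) (e : nat) (he : (1 < e)%N) (k : 'I_e)
    (Cbar : linCat K) (Cbarw : weight e.+1 -> Cbar -> Prop)
    (Ebar Fbar : 'I_e.+1 -> functor Cbar Cbar)
    (rep : cat_rep Cbarw Ebar Fbar)
    (neg0 : forall mu : weight e.+1, (exists j, mu 0 j < 0) ->
       forall X : Cbar, Cbarw mu X -> is_zero X) :
  inhabited (cat_rep (@subCw e k K Cbar Cbarw)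
               (subE k (rep_weightE rep)) (subF k (rep_weightF rep))).
Proof.
have adj i := rep_adjoint_EF rep i (ltnW he : (1 < e.+1)%N).
have merge_adj i : adjoint (mergeE k Ebar i) (mergeF k Fbar i) /\
    adjoint (mergeF k Fbar i) (mergeE k Ebar i).
  rewrite /mergeE /mergeF; case: ifP => _; first exact: adj.
  case: ifP => _; last exact: adj.
  (* Adjoints compose in the opposite order, matching the opposite orders of the two letters in
     [mergeE] and [mergeF]. *)
  by split; apply: adjoint_comp; apply adj.
apply: klr_family_rep.
- exact: ltnW he.
- exact: subC_abelian (rep_dec rep) (rep_abelian rep).
- exact: subC_decomposition (rep_dec rep).
- by move=> i; apply: adjoint_restrict; apply merge_adj.
- by move=> i; apply: adjoint_restrict; apply merge_adj.
- by move=> i mu X; apply: mergeE_weight (rep_weightE rep) _ _ _.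
- by move=> i mu X; apply: mergeF_weight (rep_weightF rep) _ _ _.
apply: restrict_klr_family; apply: merged_klr_family => //.
- exact: rep_weightF rep.
- exact: rep_klr_family rep.
Qed.
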